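(* Let $c,\alpha,\beta\in(0,1)$. For a generic $f\in\mathcal{L}(c,\alpha,\beta)$ (i.e. for all $f$ in a residual subset of $\mathcal{L}(c,\alpha,\beta)$ with respect to the metric $\operatorname{dist}$), the singular values of $f$ are not contained in the basin of attraction of the SRB measure of $f$, i.e. $\{f(c_-),f(c_+)\}\not\subset\mathcal{B}(\mu_{SRB})$.
   Context: $C^{1+}$ means $C^1$ with Hölder continuous derivative; a Hölder exponent $\rho\in(0,1)$ is fixed, $C^{1+}=C^{1+\rho}$ (locally, for maps on $[0,1]\setminus\{c\}$), and $\|\varphi\|_{C^{1+}}=\sup|\varphi|+\sup|\varphi'|+\sup_{x\ne y}\frac{|\varphi'(x)-\varphi'(y)|}{|x-y|^{\rho}}$. Expanding Lorenz map: for $0<c<1$, a $C^{1+}$ map $f:[0,1]\setminus\{c\}\to[0,1]$ such that $f(0)=0$, $f(1)=1$, there is a constant $\sigma>1$ with $f'(x)\ge\sigma$ for all $x\in[0,1]\setminus\{c\}$, and $f'(c_-)=f'(c_+)=+\infty$. The point $c$ is called the singularity. Here $f'(c_-)=\lim_{x\uparrow c}f'(x)$, $f'(c_+)=\lim_{x\downarrow c}f'(x)$, $f(c_-)=\lim_{x\uparrow c}f(x)$, $f(c_+)=\lim_{x\downarrow c}f(x)$; the singular values are $f(c_-)$ and $f(c_+)$. $\mathcal{L}(c,\alpha,\beta)$: the set of all expanding Lorenz maps $f$ with singularity $c$ for which there are $d_0,d_1\in[0,1]$ and $C^{1+}$ diffeomorphisms $\phi_{0,f}:[0,c]\to[0,d_0^{1/\alpha}]$,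 $\phi_{1,f}:[c,1]\to[0,d_1^{1/\beta}]$ with $\phi_{0,f}(c)=\phi_{1,f}(c)=0$, $\phi_{0,f}(0)=d_0^{1/\alpha}$, $\phi_{1,f}(1)=d_1^{1/\beta}$, such that $f(x)=d_0-(\phi_{0,f}(x))^{\alpha}$ for $x<c$ and $f(x)=1-d_1+(\phi_{1,f}(x))^{\beta}$ for $x>c$. The metric is $$\operatorname{dist}(f,g)=|f(c_-)-g(c_-)|+|f(c_+)-g(c_+)|+\|\phi_{0,f}-\phi_{0,g}\|_{C^{1+}}+\|\phi_{1,f}-\phi_{1,g}\|_{C^{1+}}.$$ Residual means containing a countable intersection of open dense subsets. Invariant probability: a Borel probability $\mu$ on $[0,1]$ with $\mu(f^{-1}(B))=\mu(B)$ for all Borel $B\subset[0,1]$, where $f^{-1}(B)\subset[0,1]\setminus\{c\}$. SRB measure: an ergodic $f$-invariant probability $\mu$ whose basin of attraction $\mathcal{B}(\mu)=\{x\in[0,1]\,;\,\lim_{n\to\infty}\frac1n\sum_{j=0}^{n-1}\varphi(f^j(x))=\int\varphi\,d\mu\ \ \forall\varphi\in C([0,1])\}$ (points $x$ with $f^j(x)$ defined for all $j\ge0$) has positive Lebesgue measure. It is well known that every $f\in\mathcal{L}(c,\alpha,\beta)$ has a unique SRB measure, denoted $\mu_{SRB}$. *)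

(* Defs.v *)
From HB Require Import structures.
From mathcomp Require Import all_boot all_order all_algebra.
From mathcomp Require Import all_classical all_reals all_analysis.

Set Implicit Arguments.
Unset Strict Implicit.
Unset Printing Implicit Defensive.

Import Order.TTheory GRing.Theory Num.Theory.
Import numFieldNormedType.Exports.

Local Open Scope classical_set_scope.
Local Open Scope ring_scope.

(* The derivative is taken inside the domain D, so that it is one-sided at    *)
(* the endpoints of an interval and does not see the values outside D.        *)
Definition derivable_in {R : realType} (D : set R) (u : R -> R) (x : R) : Prop :=
  cvg ((u y - u x) / (y - x) @[y --> within D x^']).

Definition derive_in {R : realType} (D : set R) (u : R -> R) (x : R) : R :=
  lim ((u y - u x) / (y - x) @[y --> within D x^']).

(* C^{1+rho} on D; for 0 < rho the Hoelder bounds imply that the derivative   *)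
(* is continuous on D.                                                        *)
Definition C1holder {R : realType} (rho : R) (D : set R) (u : R -> R) : Prop :=
  (forall x, D x -> derivable_in D u x) /\
  exists K : R, forall x y, D x -> D y ->
    `|derive_in D u x - derive_in D u y| <= K * `|x - y| `^ rho.

Definition C1holder_loc {R : realType} (rho : R) (D : set R) (u : R -> R) : Prop :=
  (forall x, D x -> derivable_in D u x) /\
  forall z, D z -> exists (K : R) (U : set R), nbhs z U /\
    forall x y, (U `&` D) x -> (U `&` D) y ->
      `|derive_in D u x - derive_in D u y| <= K * `|x - y| `^ rho.

Definition C1holder_norm {R : realType} (rho : R) (D : set R) (u : R -> R)
    : \bar R :=
  (ereal_sup [set (`|u x|)%:E | x in D] +
   ereal_sup [set (`|derive_in D u x|)%:E | x in D] +
   ereal_sup [set (`|derive_in D u p.1 - derive_in D u p.2|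
                     / `|p.1 - p.2| `^ rho)%:E
              | p in [set p : R * R | [/\ D p.1, D p.2 & p.1 != p.2]]])%E.

Definition C1holder_diffeo {R : realType} (rho : R) (A B : set R) (u : R -> R)
    : Prop :=
  C1holder rho A u /\
  exists v : R -> R, C1holder rho B v /\
    [/\ set_fun A B u, set_fun B A v,
        forall x, A x -> v (u x) = x & forall y, B y -> u (v y) = y].

Definition lorenz_dom {R : realType} (c : R) : set R := `[0, 1] `\ c.

Definition left_value {R : realType} (c : R) (f : R -> R) : R :=
  lim (f x @[x --> c^'-]).

Definition right_value {R : realType} (c : R) (f : R -> R) : R :=
  lim (f x @[x --> c^'+]).

(* A map [0,1] \ {c} -> [0,1] is a function R -> R whose values outside       *)
(* lorenz_dom c are never used.                                               *)
Definition expanding_lorenz {R : realType} (rho c : R) (f : R -> R) : Prop :=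
  [/\ 0 < c < 1,
      set_fun (lorenz_dom c) `[0, 1] f /\ C1holder_loc rho (lorenz_dom c) f,
      f 0 = 0 /\ f 1 = 1,
      exists2 sigma : R, 1 < sigma &
        forall x, lorenz_dom c x -> sigma <= derive_in (lorenz_dom c) f x &
      (derive_in (lorenz_dom c) f x @[x --> c^'-] --> +oo) /\
      (derive_in (lorenz_dom c) f x @[x --> c^'+] --> +oo)].

(* The data d0, d1 and, on [0,c] and [c,1], phi0, phi1 are determined by the  *)
(* restriction of f to lorenz_dom c: d0 = f(c-), 1 - d1 = f(c+),              *)
(* phi0 = (d0 - f)^(1/alpha) and phi1 = (f - (1 - d1))^(1/beta).              *)
Record lorenz_map (R : realType) (rho c alpha beta : R) := LorenzMap {
  lorenz_fun :> R -> R ;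
  lorenz_d0 : R ;
  lorenz_d1 : R ;
  lorenz_phi0 : R -> R ;
  lorenz_phi1 : R -> R ;
  lorenz_expanding : expanding_lorenz rho c lorenz_fun ;
  lorenz_d0_itv : 0 <= lorenz_d0 <= 1 ;
  lorenz_d1_itv : 0 <= lorenz_d1 <= 1 ;
  lorenz_diffeo0 : C1holder_diffeo rho `[0, c]
    `[0, lorenz_d0 `^ alpha^-1] lorenz_phi0 ;
  lorenz_diffeo1 : C1holder_diffeo rho `[c, 1]
    `[0, lorenz_d1 `^ beta^-1] lorenz_phi1 ;
  lorenz_phi_c : lorenz_phi0 c = 0 /\ lorenz_phi1 c = 0 ;
  lorenz_phi_end : lorenz_phi0 0 = lorenz_d0 `^ alpha^-1 /\
                   lorenz_phi1 1 = lorenz_d1 `^ beta^-1 ;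
  lorenz_fun_left : forall x : R, 0 <= x < c ->
    lorenz_fun x = lorenz_d0 - lorenz_phi0 x `^ alpha ;
  lorenz_fun_right : forall x : R, c < x <= 1 ->
    lorenz_fun x = 1 - lorenz_d1 + lorenz_phi1 x `^ beta
}.

Definition lorenz_dist {R : realType} {rho c alpha beta : R}
    (f g : lorenz_map rho c alpha beta) : \bar R :=
  ((`|left_value c f - left_value c g|)%:E +
   (`|right_value c f - right_value c g|)%:E +
   C1holder_norm rho `[0%R, c] (lorenz_phi0 f \- lorenz_phi0 g)%R +
   C1holder_norm rho `[c, 1%R] (lorenz_phi1 f \- lorenz_phi1 g)%R)%E.

Section derive_in_itv.
Context {R : realType} (a b : R).
Hypothesis ab : a < b.
Implicit Types (u v : R -> R) (x : R).

Lemma within_itv_dnbhs_proper x : `[a, b]%classic x ->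
  ProperFilter (within `[a, b] x^').
Proof.
rewrite /= in_itv/= => /andP[ax xb].
apply: Build_ProperFilter_ex => P [e /= e0 eP].
have [xb'|bx] := ltP x b.
  pose y := x + Num.min (e / 2) (b - x).
  have m0 : 0 < Num.min (e / 2) (b - x) by rewrite lt_min divr_gt0//= subr_gt0.
  exists y; apply: eP => /=.
  - rewrite /y opprD addrA subrr add0r normrN gtr0_norm// gt_min.
    by rewrite ltr_pdivrMr// ltr_pMr// ltr1n.
  - by rewrite /y -subr_eq0 addrAC subrr add0r gt_eqF.
  - rewrite in_itv/= /y; apply/andP; split; first by rewrite ler_wpDr// ltW.
    by rewrite -lerBrDl ge_min lexx orbT.
have xa : a < x by apply: lt_le_trans bx.
pose y := x - Num.min (e / 2) (x - a).
have m0 : 0 < Num.min (e / 2) (x - a) by rewrite lt_min divr_gt0//= subr_gt0.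
exists y; apply: eP => /=.
- rewrite /y opprB addrC subrK gtr0_norm// gt_min.
  by rewrite ltr_pdivrMr// ltr_pMr// ltr1n.
- by rewrite /y -subr_eq0 addrAC subrr add0r oppr_eq0 gt_eqF.
- rewrite in_itv/= /y; apply/andP; split.
    by rewrite lerBrDr -lerBrDl ge_min lexx orbT.
  by rewrite lerBlDr ler_wpDr// ltW.
Qed.

Lemma derivable_inD u v x :
  derivable_in `[a, b] u x -> derivable_in `[a, b] v x ->
  derivable_in `[a, b] (u \+ v) x.
Proof.
move=> du dv; rewrite /derivable_in.
rewrite (_ : (fun y => _) = (fun y => (u y - u x) / (y - x)) \+
                            (fun y => (v y - v x) / (y - x))).
  by apply: is_cvgD.
by apply/funext => y /=; rewrite -mulrDl opprD addrACA.
Qed.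

Lemma derivable_inN u x :
  derivable_in `[a, b] u x -> derivable_in `[a, b] (\- u) x.
Proof.
move=> du; rewrite /derivable_in.
rewrite (_ : (fun y => _) = \- (fun y => (u y - u x) / (y - x))).
  exact: is_cvgN.
by apply/funext => y /=; rewrite -mulNr opprD.
Qed.

Lemma derivable_inB u v x :
  derivable_in `[a, b] u x -> derivable_in `[a, b] v x ->
  derivable_in `[a, b] (u \- v) x.
Proof. by move=> du dv; apply: derivable_inD => //; exact: derivable_inN. Qed.

Lemma derive_inD u v x : `[a, b]%classic x ->
  derivable_in `[a, b] u x -> derivable_in `[a, b] v x ->
  derive_in `[a, b] (u \+ v) x = derive_in `[a, b] u x + derive_in `[a, b] v x.
Proof.
move=> abx du dv; have PF := within_itv_dnbhs_proper abx.
have E : (fun y => ((u \+ v) y - (u \+ v) x) / (y - x)) =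
    (fun y => (u y - u x) / (y - x)) \+ (fun y => (v y - v x) / (y - x)).
  by apply/funext => y /=; rewrite -mulrDl opprD addrACA.
by rewrite /derive_in E; exact: limD.
Qed.

Lemma derive_inN u x : `[a, b]%classic x ->
  derivable_in `[a, b] u x ->
  derive_in `[a, b] (\- u) x = - derive_in `[a, b] u x.
Proof.
move=> abx du; have PF := within_itv_dnbhs_proper abx.
have E : (fun y => ((\- u) y - (\- u) x) / (y - x)) =
    \- (fun y => (u y - u x) / (y - x)).
  by apply/funext => y /=; rewrite -mulNr opprD.
by rewrite /derive_in E; exact: limN.
Qed.

Lemma derive_in0 x : `[a, b]%classic x -> derive_in `[a, b] (cst 0) x = 0.
Proof.
move=> abx; have PF := within_itv_dnbhs_proper abx.
rewrite /derive_in (_ : (fun y => _) = cst 0).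
  by apply: cvg_lim => //; exact: cvg_cst.
by apply/funext => y /=; rewrite subrr mul0r.
Qed.

Lemma C1holder_normD (rho : R) u v :
  (forall x, `[a, b]%classic x -> derivable_in `[a, b] u x) ->
  (forall x, `[a, b]%classic x -> derivable_in `[a, b] v x) ->
  (C1holder_norm rho `[a, b] (u \+ v)%R <=
   C1holder_norm rho `[a, b] u + C1holder_norm rho `[a, b] v)%E.
Proof.
move=> du dv; rewrite /C1holder_norm addeACA leeD//; last first.
  apply: ge_ereal_sup => _ [[x y] /= [xab yab xy] <-].
  rewrite (derive_inD xab (du _ xab) (dv _ xab)).
  rewrite (derive_inD yab (du _ yab) (dv _ yab)).
  apply: (@le_trans _ _ ((`|derive_in `[a, b] u x - derive_in `[a, b] u y|
        / `|x - y| `^ rho)%:E + (`|derive_in `[a, b] v x - derive_in `[a, b] v y|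
        / `|x - y| `^ rho)%:E)%E).
    rewrite -EFinD lee_fin -mulrDl ler_wpM2r ?invr_ge0 ?powR_ge0//.
    by rewrite opprD addrACA ler_normD.
  by apply: leeD; apply: ereal_sup_ubound; exists (x, y).
rewrite addeACA leeD//.
  apply: ge_ereal_sup => _ [x xab <-].
  apply: (@le_trans _ _ ((`|u x|)%:E + (`|v x|)%:E)%E).
    by rewrite -EFinD lee_fin ler_normD.
  by apply: leeD; apply: ereal_sup_ubound; exists x.
apply: ge_ereal_sup => _ [x xab <-].
rewrite (derive_inD xab (du _ xab) (dv _ xab)).
apply: (@le_trans _ _ ((`|derive_in `[a, b] u x|)%:E +
                       (`|derive_in `[a, b] v x|)%:E)%E).
  by rewrite -EFinD lee_fin ler_normD.
by apply: leeD; apply: ereal_sup_ubound; exists x.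
Qed.

Lemma C1holder_normN (rho : R) u :
  (forall x, `[a, b]%classic x -> derivable_in `[a, b] u x) ->
  C1holder_norm rho `[a, b] (\- u)%R = C1holder_norm rho `[a, b] u.
Proof.
move=> du; rewrite /C1holder_norm; congr (ereal_sup _ + ereal_sup _ + ereal_sup _)%E.
- by apply: eq_imagel => x _ /=; rewrite normrN.
- by apply: eq_imagel => x xab /=; rewrite derive_inN ?normrN//; exact: du.
- apply: eq_imagel => -[x y] [/= xab yab _].
  rewrite (derive_inN xab (du _ xab)) (derive_inN yab (du _ yab)).
  by rewrite -opprD normrN.
Qed.

Lemma C1holder_norm0 (rho : R) : C1holder_norm rho `[a, b] (cst 0) = 0%E.
Proof.
have aab : `[a, b]%classic a by rewrite /= in_itv/= lexx ltW.
have bab : `[a, b]%classic b by rewrite /= in_itv/= lexx ltW.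
rewrite /C1holder_norm.
rewrite (_ : [set _ | x in _] = [set 0%E]); last first.
  apply/seteqP; split => [_ [x _ <-]|_ ->]/=; first by rewrite normr0.
  by exists a => //; rewrite normr0.
rewrite (_ : [set (`|derive_in _ _ x|)%:E | x in _] = [set 0%E]); last first.
  apply/seteqP; split => [_ [x xab <-]|_ ->]/=.
    by rewrite derive_in0// normr0.
  by exists a => //; rewrite derive_in0// normr0.
rewrite (_ : [set _ | p in _] = [set 0%E]); last first.
  apply/seteqP; split => [_ [[x y] /= [xab yab _] <-]|_ ->]/=.
    by rewrite !derive_in0// subrr normr0 mul0r.
  exists (a, b) => /=; first by split => //; rewrite lt_eqF.
  by rewrite !derive_in0// subrr normr0 mul0r.
by rewrite !ereal_sup1 !adde0.
Qed.

End derive_in_itv.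

Section lorenz_pseudometric.
Context {R : realType} {rho c alpha beta : R}.
Local Notation L := (lorenz_map rho c alpha beta).
Implicit Types f g h : L.

Let c_gt0 f : 0 < c.
Proof. by have [/andP[]] := lorenz_expanding f. Qed.

Let c_lt1 f : c < 1.
Proof. by have [/andP[]] := lorenz_expanding f. Qed.

Let dphi0 f x : `[0, c]%classic x -> derivable_in `[0, c] (lorenz_phi0 f) x.
Proof. by have [[+ _] _] := lorenz_diffeo0 f; apply. Qed.

Let dphi1 f x : `[c, 1]%classic x -> derivable_in `[c, 1] (lorenz_phi1 f) x.
Proof. by have [[+ _] _] := lorenz_diffeo1 f; apply. Qed.

Lemma lorenz_distxx f : lorenz_dist f f = 0%E.
Proof.
have subff (u : R -> R) : u \- u = cst 0.
  by apply/funext => x /=; rewrite subrr.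
rewrite /lorenz_dist !subff !C1holder_norm0 ?(c_gt0 f) ?(c_lt1 f)//.
by rewrite !subrr normr0 !adde0.
Qed.

Lemma lorenz_dist_sym f g : lorenz_dist f g = lorenz_dist g f.
Proof.
have subfg (u v : R -> R) : u \- v = \- (v \- u).
  by apply/funext => x /=; rewrite opprB.
rewrite /lorenz_dist (subfg (lorenz_phi0 f)) (subfg (lorenz_phi1 f)).
rewrite !C1holder_normN ?(c_gt0 f) ?(c_lt1 f)//.
- by rewrite (distrC (left_value _ _)) (distrC (right_value _ _)).
- by move=> x xab; apply: derivable_inB; exact: dphi1.
- by move=> x xab; apply: derivable_inB; exact: dphi0.
Qed.

Lemma lorenz_dist_triangle f g h :
  (lorenz_dist f h <= lorenz_dist f g + lorenz_dist g h)%E.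
Proof.
have sub3 (u v w : R -> R) : u \- w = (u \- v) \+ (v \- w).
  by apply/funext => x /=; rewrite addrA subrK.
have N0 : (C1holder_norm rho `[0%R, c] (lorenz_phi0 f \- lorenz_phi0 h)%R <=
    C1holder_norm rho `[0%R, c] (lorenz_phi0 f \- lorenz_phi0 g)%R +
    C1holder_norm rho `[0%R, c] (lorenz_phi0 g \- lorenz_phi0 h)%R)%E.
  rewrite (sub3 (lorenz_phi0 f) (lorenz_phi0 g)).
  by apply: (C1holder_normD (c_gt0 f)) => x xab; apply: derivable_inB;
    exact: dphi0.
have N1 : (C1holder_norm rho `[c, 1%R] (lorenz_phi1 f \- lorenz_phi1 h)%R <=
    C1holder_norm rho `[c, 1%R] (lorenz_phi1 f \- lorenz_phi1 g)%R +
    C1holder_norm rho `[c, 1%R] (lorenz_phi1 g \- lorenz_phi1 h)%R)%E.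
  rewrite (sub3 (lorenz_phi1 f) (lorenz_phi1 g)).
  by apply: (C1holder_normD (c_lt1 f)) => x xab; apply: derivable_inB;
    exact: dphi1.
have V (x y z : R) : ((`|x - z|)%:E <= (`|x - y|)%:E + (`|y - z|)%:E)%E.
  by rewrite -EFinD lee_fin ler_distD.
have AC (a b d e a' b' d' e' : \bar R) :
    (a + a' + (b + b') + (d + d') + (e + e') =
     a + b + d + e + (a' + b' + d' + e'))%E.
  by rewrite (addeACA a) (addeACA (a + b)%E) (addeACA (a + b + d)%E).
rewrite /lorenz_dist -AC.
exact: leeD (leeD (leeD (V _ _ _) (V _ _ _)) N0) N1.
Qed.

End lorenz_pseudometric.

Section lorenz_topology.
Context {R : realType} {rho c alpha beta : R}.
Local Notation L := (lorenz_map rho c alpha beta).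

HB.instance Definition _ := gen_eqMixin L.
HB.instance Definition _ := gen_choiceMixin L.

Definition lorenz_ball (f : L) (e : R) : set L :=
  [set g | (lorenz_dist f g < e%:E)%E].

Definition lorenz_ent : set_system (L * L) := entourage_ lorenz_ball.

HB.instance Definition _ := hasNbhs.Build L (nbhs_ lorenz_ent).

Let lorenz_nbhsE : @nbhs L L = nbhs_ lorenz_ent.
Proof. by []. Qed.

Let lorenz_ball_center f (e : R) : 0 < e -> lorenz_ball f e f.
Proof. by move=> e0; rewrite /lorenz_ball/= lorenz_distxx lte_fin. Qed.

Let lorenz_ball_sym f g (e : R) : lorenz_ball f e g -> lorenz_ball g e f.
Proof. by rewrite /lorenz_ball/= lorenz_dist_sym. Qed.

Let lorenz_ball_triangle f g h (e1 e2 : R) :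
  lorenz_ball f e1 g -> lorenz_ball g e2 h -> lorenz_ball f (e1 + e2) h.
Proof.
rewrite /lorenz_ball/= => fg gh.
by rewrite (le_lt_trans (lorenz_dist_triangle _ g _))// EFinD lteD.
Qed.

Let lorenz_entE : lorenz_ent = entourage_ lorenz_ball.
Proof. by []. Qed.

(* Only a pseudometric: two records with the same restriction of the map to   *)
(* [0,1] \ {c} are at distance 0. Open, dense and residual sets are those of  *)
(* the metric quotient.                                                       *)
HB.instance Definition _ := @Nbhs_isPseudoMetric.Build R L
  lorenz_ent lorenz_nbhsE lorenz_ball lorenz_ball_center lorenz_ball_sym
  lorenz_ball_triangle lorenz_entE.

End lorenz_topology.

Definition residual {T : topologicalType} (A : set T) : Prop :=
  exists U : nat -> set T,
    (forall n, open (U n) /\ dense (U n)) /\ \bigcap_n U n `<=` A.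

Section srb.
Context {R : realType} (c : R) (f : R -> R).

Definition lorenz_preimage (B : set R) : set R := lorenz_dom c `&` f @^-1` B.

Definition invariant_probability
    (mu : probability (measurableTypeR R) R) : Prop :=
  mu `[0, 1]%classic = 1%E /\
  forall B : set (measurableTypeR R), measurable B -> B `<=` `[0, 1] ->
    mu (lorenz_preimage B) = mu B.

Definition ergodic_probability
    (mu : probability (measurableTypeR R) R) : Prop :=
  invariant_probability mu /\
  forall B : set (measurableTypeR R), measurable B -> B `<=` `[0, 1] ->
    lorenz_preimage B = B -> mu B = 0%E \/ mu B = 1%E.

Definition basin (mu : probability (measurableTypeR R) R) : set R :=
  [set x | [/\ `[0, 1]%classic x,
    forall j : nat, lorenz_dom c (iter j f x) &
    forall phi : R -> R, {within `[0, 1], continuous phi} ->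
      n%:R^-1 * (\sum_(j < n) phi (iter j f x)) @[n --> \oo] -->
      \int[mu]_(y in `[0, 1]) phi y]].

(* The basin is a Borel set; lebesgue_measure is total (an outer measure).    *)
Definition SRB_measure (mu : probability (measurableTypeR R) R) : Prop :=
  ergodic_probability mu /\ (0 < lebesgue_measure (basin mu))%E.

End srb.

(* Main.v *)
Require Import Defs.
From mathcomp Require Import all_boot all_order all_algebra.
From mathcomp Require Import all_classical all_reals all_analysis.
From mathcomp Require Import ring lra measurable_realfun.

Set Implicit Arguments.
Unset Strict Implicit.
Unset Printing Implicit Defensive.

Import Order.TTheory GRing.Theory Num.Theory.
Import numFieldNormedType.Exports.

Local Open Scope classical_set_scope.
Local Open Scope ring_scope.

(** For a generic [f] it is already the left singular value [f(c-)] that lies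
    outside the basin of every SRB measure: along a subsequence of times its
    orbit spends almost all its time near two periodic orbits, whereas almost
    no point does so for all large times.

    - Growth. The derivative is at least [lam > 1] and exceeds [8] near [c]. An
      interval whose iterates grow until they contain [c], and are then cut at
      [c] and replaced by the larger half, doubles in length from one cut to the
      next as long as it stays near [c]; hence some iterate of every interval
      sweeps across a prescribed interval on the left of [c] or one on the right
      of [c] ([family_sweeps]). Nothing changes when the map moves with a
      parameter, provided that it increases with it.
    - Phase space. Applied to the map itself, growth yields periodic points and,
      on each side of [c] and arbitrarily near [c], a point that is eventually
      mapped to one of them ([preperiodic_near]).
    - Parameter space. Multiplying the left branch by [tau^alpha], with [tau]
      slightly below [1], is a small perturbation in the metric
      ([lorenz_scale]) and makes the iterates of [f(c-)] move monotonically and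
      expandingly with [tau]. By growth they sweep across one of the two
      preperiodic points, so that some perturbation sends [f(c-)] near a
      periodic orbit and keeps it there as long as desired
      ([visits_often_dense]). As finite orbit segments that avoid [c] depend
      continuously on the map ([lorenz_orbit_near]), it is an open condition
      that at some time [m >= k] the proportion of visits to a neighbourhood of
      the periodic orbits exceeds [1 - eps] ([visits_often_open]).
    - Measure. A map is injective on its periodic orbits, so that among the two
      preimages of a point at most one lies in a small neighbourhood of them.
      Since inverse branches contract by [1/lam], the points with at most [k] of
      their first [n] iterates outside the neighbourhood form a set of measure
      at most [theta^-k ((1 + 2 theta)/lam)^n] ([few_misses_le]), and almost no
      point visits the neighbourhood with asymptotic proportion close to [1]
      ([frequent_visits_null]). If [f(c-)] were in the basin of a measure, all
      points of the basin would have the asymptotic proportion of [f(c-)], and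
      the basin would be a null set ([not_basin]).

    All constants can be kept the same on a neighbourhood of a given map: in this
    metric a map near [f] has increments at least [k < 1] times those of [f]
    ([lorenz_near_slope]), because [x^alpha] is concave and the diffeomorphisms
    are bi-Lipschitz. The neighbourhoods of the periodic orbits are described by
    rational centres and radii, so that the local statements involve countably
    many open sets and combine into a residual set
    ([residual_countable_local]). *)

(** * Monotone families of expanding maps *)

(** [f] expands by the factor [lam] on each of the two components of the
    interval from [a] to [b] deprived of [c]. In particular [f] is increasing on
    each of them. *)
Definition expanding {R : realType} (c a b lam : R) (f : R -> R) : Prop :=
  forall x y, a < x -> x <= y -> y < b -> y < c \/ c < x ->
    lam * (y - x) <= f y - f x.

(** Maps [h t] of the open unit interval, with a common singularity [c], and
    initial points [X0 t], where [t] ranges over the interval from [a0] to [b0].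
    Both are increasing in [t], and each [h t] is expanding, by the factor [8]
    within distance [r] of [c]. A constant family with [X0 t = t] describes the
    phase space of a single map. The factor [8] loses [2] when an interval ending
    at [c] is halved, and [2] when its image is cut at [c]; it still doubles. *)
Record expanding_family {R : realType} (c r lam a0 b0 : R)
    (h : R -> R -> R) (X0 : R -> R) : Prop := ExpandingFamily {
  family_lam1 : 1 < lam ;
  family_ab : a0 < b0 ;
  family_itv : forall t x, a0 <= t <= b0 -> 0 < x < 1 -> x != c ->
    0 < h t x < 1 ;
  family_mono : forall s t x, a0 <= s -> s <= t -> t <= b0 ->
    0 < x < 1 -> x != c -> h s x <= h t x ;
  family_exp : forall t, a0 <= t <= b0 -> expanding c 0 1 lam (h t) ;
  family_exp8 : forall t, a0 <= t <= b0 ->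
    expanding c (c - r) (c + r) 8 (h t) ;
  family_cont : forall t x, a0 <= t <= b0 -> 0 < x < 1 -> x != c ->
    h z.1 z.2 @[z --> (t, x)] --> h t x ;
  family_X0_itv : forall t, a0 <= t <= b0 -> 0 < X0 t < 1 ;
  family_X0_mono : forall s t, a0 <= s -> s < t -> t <= b0 -> X0 s < X0 t ;
  family_X0_cont : {within `[a0, b0], continuous X0}
}.

Section growth.
Context {R : realType} (c r lam a0 b0 : R) (h : R -> R -> R) (X0 : R -> R).
Hypothesis EF : expanding_family c r lam a0 b0 h X0.

Let lam1 := family_lam1 EF.
Let ab0 := family_ab EF.
Let h_itv := family_itv EF.
Let h_mono := family_mono EF.
Let h_exp := family_exp EF.
Let h_exp8 := family_exp8 EF.
Let h_cont := family_cont EF.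
Let X0_itv := family_X0_itv EF.
Let X0_mono := family_X0_mono EF.
Let X0_cont := family_X0_cont EF.

(** The [n]-th iterate of the moving initial point. *)
Let X n t := iter n (h t) (X0 t).

(** No parameter between [a] and [b] meets the singularity before time [n]. *)
Let free n a b := forall j t, (j < n)%N -> a <= t <= b -> X j t != c.

(** Between the parameters [a] and [b], the [n]-th iterate is a continuous,
    strictly increasing function with values in the open unit interval. *)
Record increasing_branch n a b : Prop := IncreasingBranch {
  branch_cont : {within `[a, b], continuous (X n)} ;
  branch_itv : forall t, a <= t <= b -> 0 < X n t < 1 ;
  branch_mono : forall s t, a <= s -> s < t -> t <= b -> X n s < X n t }.

Let branch_sub n a b a' b' : a <= a' -> b' <= b -> increasing_branch n a b -> increasing_branch n a' b'.
Proof.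
move=> aa bb [C I M]; split.
- apply: continuous_subspaceW C => t /=; rewrite !in_itv/= => /andP[? ?].
  by apply/andP; split; lra.
- by move=> t /andP[? ?]; apply: I; apply/andP; split; lra.
- by move=> s t ? ? ?; apply: M => //; lra.
Qed.

Let branch_side n a b : a <= b -> increasing_branch n a b ->
  (forall t, a <= t <= b -> X n t != c) ->
  (forall t, a <= t <= b -> X n t < c) \/ (forall t, a <= t <= b -> c < X n t).
Proof.
move=> ab [C I M] nc.
have le s t : a <= s -> s <= t -> t <= b -> X n s <= X n t.
  by move=> as_ st tb; move: st; rewrite le_eqVlt => /orP[/eqP->//|st];
     apply/ltW/M.
have [bc|cb] := ltP (X n b) c.
  left => t /andP[at_ tb]; apply: le_lt_trans bc; exact: le.
have [ac|ca] := ltP c (X n a).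
  right => t /andP[at_ tb]; apply: lt_le_trans ac _; exact: le.
have [|d dab dc] := @IVT R (X n) a b c ab C.
  have := le a b; rewrite lexx => /(_ isT ab (lexx _)) h1.
  by rewrite (min_idPl h1) (max_idPr h1) ca.
by move: dab (nc d); rewrite in_itv/= dc eqxx => dab /(_ dab).
Qed.

Let branch_step n a b : a0 <= a -> a <= b -> b <= b0 -> increasing_branch n a b ->
  (forall t, a <= t <= b -> X n t != c) ->
  [/\ increasing_branch n.+1 a b, (forall s t, a <= s -> s <= t -> t <= b ->
     lam * (X n t - X n s) <= X n.+1 t - X n.+1 s) &
     c - r < X n a -> X n b < c + r ->
     8 * (X n b - X n a) <= X n.+1 b - X n.+1 a].
Proof.
move=> aa ab bb G nc; have [C I M] := G.
have le s t : a <= s -> s <= t -> t <= b -> X n s <= X n t.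
  by move=> as_ st tb; move: st; rewrite le_eqVlt => /orP[/eqP->//|st];
     apply/ltW/M.
have sides := branch_side ab G nc.
have side s t : a <= s -> s <= t -> t <= b -> X n t < c \/ c < X n s.
  move=> as_ st tb; case: sides => [S|S]; [left|right]; apply: S;
  by apply/andP; split; lra.
have E s t : a <= s -> s <= t -> t <= b ->
     lam * (X n t - X n s) <= X n.+1 t - X n.+1 s.
  move=> as_ st tb.
  have Is := I s; have It := I t.
  have /andP[Is1 Is2] : 0 < X n s < 1 by apply: I; apply/andP; split; lra.
  have /andP[It1 It2] : 0 < X n t < 1 by apply: I; apply/andP; split; lra.
  have e1 : lam * (X n t - X n s) <= h s (X n t) - h s (X n s).
    by apply: h_exp => //; [apply/andP; split; lra|exact: le|exact: side].
  have e2 : h s (X n t) <= h t (X n t).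
    apply: h_mono; rewrite ?It1 ?It2//; try lra.
    by apply: nc; apply/andP; split; lra.
  rewrite /X !iterS -/(X n t) -/(X n s); lra.
split => //.
- split.
  + apply/subspace_continuousP => t tab.
    have /subspace_continuousP/(_ t tab) Ct := C.
    move: (tab); rewrite /= in_itv/= => tab'.
    have /andP[t1 t2] := tab'.
    rewrite (_ : X n.+1 = fun s => h s (X n s))//.
    have a0t : a0 <= t <= b0 by apply/andP; split; lra.
    have H := h_cont a0t (I _ tab') (nc _ tab').
    have Ci : s @[s --> within `[a, b] (nbhs t)] --> t by exact: cvg_within.
    exact: (continuous2_cvg _ H Ci Ct).
  + move=> t /andP[t1 t2]; rewrite /X iterS; apply: h_itv.
    * by apply/andP; split; lra.
    * by apply: I; rewrite t1.
    * by apply: nc; rewrite t1.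
  + move=> s t s1 st t1.
    rewrite -subr_gt0 (lt_le_trans _ (E _ _ s1 (ltW st) t1))//.
    by rewrite mulr_gt0 ?subr_gt0 ?(lt_trans ltr01 lam1)//; exact: M.
- move=> A B.
  have /andP[Is1 Is2] : 0 < X n a < 1 by apply: I; apply/andP; split; lra.
  have /andP[It1 It2] : 0 < X n b < 1 by apply: I; apply/andP; split; lra.
  have e1 : 8 * (X n b - X n a) <= h a (X n b) - h a (X n a).
    apply: h_exp8 => //; [apply/andP; split; lra|exact: le|].
    by apply: side; rewrite ?lexx.
  have e2 : h a (X n b) <= h b (X n b).
    apply: h_mono; rewrite ?It1 ?It2//; try lra.
    by apply: nc; apply/andP; split; lra.
  rewrite /X !iterS -/(X n a) -/(X n b); lra.
Qed.

Let branch0 : increasing_branch 0 a0 b0.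
Proof. by split => // s t; exact: X0_mono. Qed.

Let freeS n a b : free n a b -> (forall t, a <= t <= b -> X n t != c) ->
  free n.+1 a b.
Proof.
move=> F N j t; rewrite ltnS leq_eqVlt => /orP[/eqP->|jn]; first exact: N.
exact: F.
Qed.

Let free_branch n a b : a0 <= a -> a <= b -> b <= b0 -> free n a b -> increasing_branch n a b.
Proof.
move=> aa ab bb; elim: n => [|n IH] F; first exact: branch_sub branch0.
have Gn : increasing_branch n a b by apply: IH => j t jn; apply: F; exact: ltnW.
by have [] := branch_step aa ab bb Gn (fun t tab => F n t (ltnSn n) tab).
Qed.

(** Expansion forces the iterates over a parameter interval to meet [c], and up to
    the first time at which this happens they spread over longer and longer
    intervals. *)
Let hit n a b : a0 <= a -> a < b -> b <= b0 -> free n a b ->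
  exists k, [/\ (n <= k)%N, free k a b,
    exists2 d, a <= d <= b & X k d = c &
    X n b - X n a <= X k b - X k a].
Proof.
move=> aa ab bb F.
have ab' := ltW ab.
have [[k fk]|nk] := pselect (exists k, (n <= k)%N /\ ~ free k.+1 a b).
  have ex : exists k, (n <= k)%N && ~~ `[< free k.+1 a b >].
    by case: fk => nk fk; exists k; rewrite nk; apply/negP => /asboolP.
  case: (ex_minnP ex) => m /andP[nm /asboolPn fm] min.
  have H j : (n <= j <= m)%N ->
      free j a b /\ X n b - X n a <= X j b - X j a.
    elim: j => [|j IH].
      by rewrite leqn0 => /andP[/eqP n0 _]; rewrite -n0.
    move=> /andP[]; rewrite leq_eqVlt => /orP[/eqP <- //|nj jm].
    rewrite ltnS in nj.
    have [Fj Ej] : free j a b /\ X n b - X n a <= X j b - X j a.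
      by apply: IH; rewrite nj ltnW.
    have Fj1 : free j.+1 a b.
      apply/asboolP/negPn/negP => fj; have := min j; rewrite nj fj => /(_ isT).
      by rewrite leqNgt jm.
    split => //; apply: le_trans Ej _.
    have Gj := free_branch aa ab' bb Fj.
    have [_ /(_ a b) E _] := branch_step aa ab' bb Gj
      (fun t tab => Fj1 j t (ltnSn j) tab).
    have m1 := E (lexx _) ab' (lexx _).
    have m2 := branch_mono Gj (lexx _) ab (lexx _).
    by apply: le_trans m1; rewrite ler_peMl ?subr_ge0 ?(ltW lam1)// ltW.
  exists m.
  have {H} [Fm Em] : free m a b /\ X n b - X n a <= X m b - X m a.
    by apply: H; rewrite nm leqnn.
  split => //; apply: contrapT => nd; apply: fm; apply: freeS => // t tab.
  by apply/eqP => Xc; apply: nd; exists t.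
have Fr k : free k a b.
  have [nk'|kn] := leqP n k.
    apply: contrapT => fk; apply: nk; exists k; split => // fk1; apply: fk.
    by move=> j t jk; apply: fk1; exact: ltnW.
  by move=> j t jk; apply: F; exact: ltn_trans kn.
exfalso.
have lam0 : 0 <= lam by rewrite (le_trans ler01)// ltW.
have gr k : lam ^+ k * (X 0 b - X 0 a) <= X k b - X k a.
  elim: k => [|k IH]; first by rewrite expr0 mul1r.
  have [_ /(_ a b (lexx _) ab' (lexx _)) E _] := branch_step aa ab' bb
    (free_branch aa ab' bb (Fr k)) (fun t tab => Fr k.+1 k t (ltnSn k) tab).
  by apply: le_trans E; rewrite exprS -mulrA; exact: ler_wpM2l.
have lt1 k : X k b - X k a < 1.
  have [_ I _] := free_branch aa ab' bb (Fr k).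
  have /andP[? ?] : 0 < X k b < 1 by apply: I; rewrite ab' lexx.
  have /andP[? ?] : 0 < X k a < 1 by apply: I; rewrite ab' lexx.
  lra.
have pos : 0 < X 0 b - X 0 a.
  by rewrite subr_gt0; apply: X0_mono.
have bern k : 1 + (lam - 1) * k%:R <= lam ^+ k.
  elim: k => [|k IH]; first by rewrite mulr0 addr0 expr0.
  have k0 : 0 <= k%:R :> R by [].
  have m1 := ler_wpM2l lam0 IH.
  have m2 : 0 <= (lam - 1) * (lam - 1) * k%:R by rewrite !mulr_ge0// subr_ge0 ltW.
  by rewrite exprS; apply: le_trans m1; rewrite -natr1; lra.
pose k := Num.truncn ((X 0 b - X 0 a)^-1 / (lam - 1)).
have kk : (X 0 b - X 0 a)^-1 / (lam - 1) < k.+1%:R by rewrite truncnS_gt.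
have m1 := lt1 k.+1; have m2 := gr k.+1; have m3 := bern k.+1.
move: kk; rewrite ltr_pdivrMr ?subr_gt0// => kk.
have uv : (X 0 b - X 0 a)^-1 * (X 0 b - X 0 a) = 1 by rewrite mulVf// gt_eqF.
set v := X 0 b - X 0 a in pos uv m2 kk.
have m4 : v^-1 < lam ^+ k.+1 by lra.
have m5 : v^-1 * v < lam ^+ k.+1 * v by rewrite ltr_pM2r.
lra.
Qed.

Let ivt n a b v : a <= b -> increasing_branch n a b -> X n a <= v <= X n b ->
  exists2 d, a <= d <= b & X n d = v.
Proof.
move=> ab G /andP[av vb].
have avb : X n a <= X n b by lra.
have [|d dab dv] := @IVT R (X n) a b v ab (branch_cont G).
  by rewrite (min_idPl avb) (max_idPr avb) av.
by exists d => //; move: dab; rewrite in_itv.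
Qed.

(** Parameter intervals one end of which is mapped to the singularity. *)
Let state n a b := [/\ a0 <= a, a < b, b <= b0, free n a b &
  X n a = c \/ X n b = c].

(** The image of an interval near [c] grows by the factor [8]; when it meets [c],
    the larger of the two pieces keeps half of this. *)
Let grow n a b : a0 <= a -> a < b -> b <= b0 -> free n a b ->
  (forall t, a <= t <= b -> X n t != c) -> c - r < X n a -> X n b < c + r ->
  exists k a' b', state k a' b' /\
    4 * (X n b - X n a) <= X k b' - X k a'.
Proof.
move=> aa ab bb F nc ra rb; have ab' := ltW ab.
have G := free_branch aa ab' bb F.
have [G1 _ /(_ ra rb) E] := branch_step aa ab' bb G nc.
have [k [nk Fk [d /andP[ad db] Xd] Ek]] := hit aa ab bb (freeS F nc).
have Gk := free_branch aa ab' bb Fk.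
have Xab := branch_mono G (lexx _) ab (lexx _).
have [L|L] := leP (4 * (X n b - X n a)) (X k b - X k d).
  exists k, d, b; split => //; split => //.
  - lra.
  - by rewrite lt_neqAle db andbT; apply/negP => /eqP db'; rewrite db' in L; lra.
  - by move=> j t jk /andP[dt tb]; apply: Fk => //; rewrite tb andbT; lra.
  - by left.
exists k, a, d; split => //; last by lra.
split => //; last by right.
- by rewrite lt_neqAle ad andbT; apply/negP => /eqP db'; rewrite -db' in L; lra.
- lra.
- by move=> j t jk /andP[dt tb]; apply: Fk => //; rewrite dt; lra.
Qed.

Let cover_itv n a b v1 v2 : a0 <= a -> a <= b -> b <= b0 -> free n a b ->
  X n a <= v1 -> v1 < v2 -> v2 <= X n b ->
  exists a' b', [/\ a <= a', a' < b', b' <= b, X n a' = v1 & X n b' = v2].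
Proof.
move=> aa ab bb F A v12 B; have G := free_branch aa ab bb F.
have [|a' /andP[aa' ab1] E1] := ivt ab G (v := v1).
  by apply/andP; split; lra.
have [|b' /andP[ba' bb1] E2] := ivt ab G (v := v2).
  by apply/andP; split; lra.
exists a', b'; split => //; have [//|ba] := ltP a' b'.
have : X n b' <= X n a'.
  move: ba; rewrite le_eqVlt => /orP[/eqP->//|ba].
  by apply/ltW/(branch_mono G).
lra.
Qed.

Lemma family_branch n a b : a0 <= a -> a <= b -> b <= b0 ->
  (forall j t, (j < n)%N -> a <= t <= b -> iter j (h t) (X0 t) != c) ->
  increasing_branch n a b.
Proof. exact: free_branch. Qed.

Let branch_between n a b t : increasing_branch n a b -> a <= t <= b -> X n a <= X n t <= X n b.
Proof.
move=> G /andP[at_ tb]; apply/andP; split.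
  by move: at_; rewrite le_eqVlt => /orP[/eqP->//|at_]; exact/ltW/(branch_mono G).
by move: tb; rewrite le_eqVlt => /orP[/eqP->//|tb]; exact/ltW/(branch_mono G).
Qed.

(** If the [n]-th iterates sweep the interval from [v1] to [v2], which all the
    maps stretch in [k] steps across the interval from [y1] to [y2], then on a
    smaller parameter interval the iterates of order [n + k] sweep the latter. *)
Lemma family_follow n k a b v1 v2 y1 y2 :
  a0 <= a -> a < b -> b <= b0 -> free n a b ->
  iter n (h a) (X0 a) = v1 -> iter n (h b) (X0 b) = v2 -> y1 < y2 ->
  (forall t y j, a0 <= t <= b0 -> v1 <= y <= v2 -> (j < k)%N ->
     iter j (h t) y != c) ->
  (forall t, a0 <= t <= b0 -> iter k (h t) v1 <= y1 /\ y2 <= iter k (h t) v2) ->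
  (forall t, a <= t <= b -> v1 <= iter n (h t) (X0 t) <= v2) /\
  exists a' b', [/\ a <= a', a' < b', b' <= b,
   (forall j t, (j < n + k)%N -> a' <= t <= b' -> iter j (h t) (X0 t) != c) &
    iter (n + k) (h a') (X0 a') = y1 /\ iter (n + k) (h b') (X0 b') = y2].
Proof.
move=> aa ab bb F E1 E2 y12 kc kv; have G := free_branch aa (ltW ab) bb F.
have B t : a <= t <= b -> v1 <= X n t <= v2.
  by move=> tab; rewrite -E1 -E2; exact: branch_between.
split; first exact: B.
have F' : free (n + k) a b.
  move=> j t jn tab; have [jn'|nj] := ltnP j n; first exact: F.
  rewrite /X -(subnK nj) iterD; apply: kc; last by rewrite ltn_subLR.
    by case/andP: tab => ta tb; rewrite (le_trans aa ta) (le_trans tb bb).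
  exact: B.
have aI : a0 <= a <= b0 by apply/andP; split => //; lra.
have bI : a0 <= b <= b0 by apply/andP; split => //; lra.
have A1 : X (n + k) a <= y1.
  by rewrite /X addnC iterD E1; have [] := kv _ aI.
have B1 : y2 <= X (n + k) b.
  by rewrite /X addnC iterD E2; have [] := kv _ bI.
have [a' [b' [a1 ab1 b1 e1 e2]]] := cover_itv aa (ltW ab) bb F' A1 y12 B1.
exists a', b'; split => // j t jn /andP[ta tb]; apply: F' => //.
by rewrite (le_trans a1 ta) (le_trans tb b1).
Qed.

(** An interval that all the maps stretch across itself in [k] steps can be
    visited [M] times in a row. *)
Lemma family_stay M n k a b y1 y2 :
  a0 <= a -> a < b -> b <= b0 -> free n a b ->
  iter n (h a) (X0 a) = y1 -> iter n (h b) (X0 b) = y2 -> y1 < y2 ->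
  (forall t y j, a0 <= t <= b0 -> y1 <= y <= y2 -> (j < k)%N ->
     iter j (h t) y != c) ->
  (forall t, a0 <= t <= b0 -> iter k (h t) y1 <= y1 /\ y2 <= iter k (h t) y2) ->
  exists t, [/\ a <= t <= b,
   (forall j, (j < n + M * k)%N -> iter j (h t) (X0 t) != c) &
   forall m, (m < M)%N -> y1 <= iter (n + m * k) (h t) (X0 t) <= y2].
Proof.
move=> aa ab bb F E1 E2 y12 kc kv.
suff [a' [b' [a1 ab1 b1 F' [e1 e2]]]] : exists a' b', [/\ a <= a', a' < b', b' <= b,
   free (n + M * k) a' b' /\ (forall m t, (m < M)%N -> a' <= t <= b' ->
     y1 <= iter (n + m * k) (h t) (X0 t) <= y2) &
   iter (n + M * k) (h a') (X0 a') = y1 /\ iter (n + M * k) (h b') (X0 b') = y2].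
  have [F1 F2] := F'; have aI : a' <= a' <= b' by rewrite lexx ltW.
  exists a'; split; first by rewrite a1 (le_trans (ltW ab1)).
  - by move=> j jn; exact: F1.
  - by move=> m mM; exact: F2.
elim: M => [|M [a' [b' [a1 ab1 b1 [F1 F2] [e1 e2]]]]].
  by exists a, b; rewrite mul0n addn0; split.
have [B [a2 [b2 [a3 ab3 b3 F3 [e3 e4]]]]] := family_follow
  (le_trans aa a1) ab1 (le_trans b1 bb) F1 e1 e2 y12 kc kv.
have En : (n + M.+1 * k = n + M * k + k)%N by rewrite mulSn (addnC k) addnA.
exists a2, b2; rewrite En; split => //; [exact: le_trans a3|exact: le_trans b1|].
split => // m t; rewrite ltnS leq_eqVlt => /orP[/eqP->|mM] /andP[ta tb].
  by apply: B; rewrite (le_trans a3 ta) (le_trans tb b3).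
by apply: F2 => //; rewrite (le_trans a3 ta) (le_trans tb b3).
Qed.

Variables u1 u2 w1 w2 : R.
Hypothesis u12 : u1 < u2.
Hypothesis w12 : w1 < w2.
Hypothesis u2c : u2 < c.
Hypothesis cw1 : c < w1.
Hypothesis ru1 : c - r < u1.
Hypothesis rw2 : w2 < c + r.

Let covers := exists n a b, [/\ a0 <= a, a < b, b <= b0,
  (forall j t, (j < n)%N -> a <= t <= b -> X j t != c) &
  X n a = u1 /\ X n b = u2 \/ X n a = w1 /\ X n b = w2].

(** Either one of the two prescribed intervals is swept, or the interval ending
    at [c] is within distance [r] of [c] and gives rise to one twice as long. *)
Let double n a b : state n a b -> covers \/ exists k a' b', state k a' b' /\
  2 * (X n b - X n a) <= X k b' - X k a'.
Proof.
have [cw1' u2c'] := conj cw1 u2c; have [ru1' rw2'] := conj ru1 rw2.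
have [u12' w12'] := conj u12 w12.
move=> [aa ab bb F S]; have ab' := ltW ab.
have G := free_branch aa ab' bb F; have Xab := branch_mono G (lexx _) ab (lexx _).
case: S => S.
- have [L|L] := leP w2 (X n b).
    have wa : X n a <= w1 by lra.
    have [a' [b' [aa1 ab1 bb1 E1 E2]]] := cover_itv aa ab' bb F wa w12 L.
    left; exists n, a', b'; split; [lra|by []|lra| |by right].
    by move=> j t jn /andP[t1 t2]; apply: F => //; apply/andP; split; lra.
  have [|d /andP[ad db] Ed] := ivt (v := (X n b + c) / 2) ab' G.
    by apply/andP; split; lra.
  have db1 : d < b.
    by rewrite lt_neqAle db andbT; apply/negP => /eqP E; rewrite E in Ed; lra.
  have Gd := branch_sub ad (lexx _) G.
  have nc t : d <= t <= b -> X n t != c.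
    move=> /andP[dt tb]; rewrite gt_eqF//; apply: (@lt_le_trans _ _ (X n d)).
      by rewrite Ed; lra.
    by move: dt; rewrite le_eqVlt => /orP[/eqP->//|dt]; apply/ltW/(branch_mono G).
  right; have [|||k [a' [b' [st E]]]] := grow (le_trans aa ad) db1 bb _ nc.
  - by move=> j t jk /andP[dt tb]; apply: F => //; apply/andP; split; lra.
  - lra.
  - lra.
  by exists k, a', b'; split => //; lra.
- have [L|L] := leP (X n a) u1.
    have ub : u2 <= X n b by lra.
    have [a' [b' [aa1 ab1 bb1 E1 E2]]] := cover_itv aa ab' bb F L u12 ub.
    left; exists n, a', b'; split; [lra|by []|lra| |by left].
    by move=> j t jn /andP[t1 t2]; apply: F => //; apply/andP; split; lra.
  have [|d /andP[ad db] Ed] := ivt (v := (X n a + c) / 2) ab' G.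
    by apply/andP; split; lra.
  have ad1 : a < d.
    by rewrite lt_neqAle ad andbT; apply/negP => /eqP E; rewrite -E in Ed; lra.
  have nc t : a <= t <= d -> X n t != c.
    move=> /andP[dt tb]; rewrite lt_eqF//; apply: (@le_lt_trans _ _ (X n d)).
      by move: tb; rewrite le_eqVlt => /orP[/eqP->//|tb]; apply/ltW/(branch_mono G).
    by rewrite Ed; lra.
  right; have [|||k [a' [b' [st E]]]] := grow aa ad1 (le_trans db bb) _ nc.
  - by move=> j t jk /andP[dt tb]; apply: F => //; apply/andP; split; lra.
  - lra.
  - lra.
  by exists k, a', b'; split => //; lra.
Qed.

(** Given one interval on each side of [c], within distance [r] of [c], the
    iterates of the moving point sweep across one of them. *)
Lemma family_sweeps : exists n a b, [/\ a0 <= a, a < b, b <= b0,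
  (forall j t, (j < n)%N -> a <= t <= b -> iter j (h t) (X0 t) != c) &
  iter n (h a) (X0 a) = u1 /\ iter n (h b) (X0 b) = u2 \/
  iter n (h a) (X0 a) = w1 /\ iter n (h b) (X0 b) = w2].
Proof.
change covers.
have F0 : free 0 a0 b0 by [].
have [k [_ Fk [d /andP[ad db] Xd] Ek]] := hit (lexx _) ab0 (lexx _) F0.
have Gk := free_branch (lexx _) (ltW ab0) (lexx _) Fk.
have Xab := branch_mono Gk (lexx _) ab0 (lexx _).
have [n [a [b S]]] : exists n a b, state n a b.
  have [da|da] := eqVneq d b0.
    by exists k, a0, b0; split => //; right; rewrite -da.
  exists k, d, b0; split => //; [by rewrite lt_neqAle da| |by left].
  by move=> j t jk /andP[dt tb]; apply: Fk => //; apply/andP; split; lra.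
have pos n' a' b' : state n' a' b' -> 0 < X n' b' - X n' a' < 1.
  move=> [aa ab bb F _]; have G := free_branch aa (ltW ab) bb F.
  have E := branch_mono G (lexx _) ab (lexx _).
  have /andP[? ?] : 0 < X n' a' < 1 by apply: branch_itv G _ _; rewrite lexx ltW.
  have /andP[? ?] : 0 < X n' b' < 1 by apply: branch_itv G _ _; rewrite lexx ltW.
  by apply/andP; split; lra.
apply: contrapT => ncov.
have it m : exists n' a' b', state n' a' b' /\
    2 ^+ m * (X n b - X n a) <= X n' b' - X n' a'.
  elim: m => [|m [n' [a' [b' [S' E']]]]]; first by exists n, a, b; rewrite mul1r.
  have [//|[k' [a'' [b'' [S'' E'']]]]] := double S'.
  by exists k', a'', b''; split => //; rewrite exprS; lra.
have /andP[p0 _] := pos _ _ _ S.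
set v := X n b - X n a in p0 it.
have [n' [a' [b' [S' E']]]] := it (Num.truncn v^-1).+1.
have /andP[_ p1] := pos _ _ _ S'.
have e1 : v^-1 < (Num.truncn v^-1).+1%:R by rewrite truncnS_gt.
have e2 : (Num.truncn v^-1).+1%:R <= 2 ^+ (Num.truncn v^-1).+1 :> R.
  by rewrite -natrX ler_nat ltnW// ltn_expl.
have e3 : v^-1 * v < 2 ^+ (Num.truncn v^-1).+1 * v by rewrite ltr_pM2r//; lra.
have e4 : v^-1 * v = 1 by rewrite mulVf// gt_eqF.
lra.
Qed.

End growth.

(** * Points that rarely leave a region of injectivity *)

Section counting.
Context {R : realType}.
Local Notation mu := (@lebesgue_measure R).
Local Open Scope ereal_scope.

Lemma lebesgue_le_diam (A : set R) (d : R) :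
  (forall x y, A x -> A y -> x <= y -> y - x <= d)%R -> mu A <= d%:E \/ A = set0.
Proof.
move=> Ad; have [A0|/set0P[x0 Ax0]] := eqVneq A set0; first by right.
left; have lbA : has_inf A.
  split; first by exists x0.
  exists (x0 - d)%R => y Ay; have [xy|yx] := leP x0 y.
    by have := Ad _ _ Ax0 Ay xy; have := Ad _ _ Ax0 Ax0 (lexx _); lra.
  by have := Ad _ _ Ay Ax0 (ltW yx); lra.
have d0 : (0 <= d)%R by have := Ad _ _ Ax0 Ax0 (lexx _); lra.
have h1 : mu A <= mu `[inf A, (inf A + d)%R]%classic.
  apply: le_outer_measure => y Ay; rewrite /= in_itv/=; apply/andP; split.
    by apply: ge_inf => //; case: lbA.
  rewrite -lerBlDr; apply: lb_le_inf; first by exists x0.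
  move=> x Ax; have [xy|yx] := leP x y; first by have := Ad _ _ Ax Ay xy; lra.
  lra.
apply: (le_trans h1).
rewrite lebesgue_measure_itv/=; case: ifPn => _; last by rewrite lee_fin.
by rewrite -EFinD lee_fin; lra.
Qed.

(** Stated for arbitrary sets and outer measure, which spares the measurability
    of preimages. *)
Lemma expanding_outer_measure (lam : R) (f : R -> R) (A : set R) : (0 < lam)%R ->
  (forall x y, A x -> A y -> x <= y -> lam * (y - x) <= `|f y - f x|)%R ->
  lam%:E * mu A <= mu (f @` A).
Proof.
move=> lam0 fA.
rewrite [leRHS](outer_measure_open_itv_cover (f @` A)).
apply: le_ereal_inf_tmp => _ [F [Fi FA] <-].
have H k : mu (A `&` f @^-1` F k) <= (lam^-1)%:E * wlength idfun (F k).
  have [[a b] ->] /= := Fi k.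
  have [|ba] := ltP a b; last first.
    rewrite (_ : _ `&` _ = set0) ?measure0//; last first.
      by apply/seteqP; split => // x [_ /=]; rewrite in_itv/=; lra.
    by rewrite wlength_itv/= lte_fin ltNge ba mule0.
  move=> ab; rewrite wlength_itv/= lte_fin ab -EFinB.
  have [||->] := @lebesgue_le_diam (A `&` f @^-1` `]a, b[%classic) (lam^-1 * (b - a))%R.
  - move=> x y [Ax /=]; rewrite in_itv/= => /andP[x1 x2] [Ay /=].
    rewrite in_itv/= => /andP[y1 y2] xy.
    have := fA _ _ Ax Ay xy; rewrite -ler_pdivlMl// => /le_trans; apply.
    rewrite ler_wpM2l ?invr_ge0 ?(ltW lam0)// ler_norml; lra.
  - by [].
  - by rewrite measure0 lee_fin mulr_ge0 ?invr_ge0 ?(ltW lam0)// subr_ge0 ltW.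
have {H} H : mu A <= \sum_(k <oo) ((lam^-1)%:E * wlength idfun (F k)).
  apply: (@le_trans _ _ (mu (\bigcup_k (A `&` f @^-1` F k)))).
    apply: le_outer_measure => x Ax.
    by have [|k _ Fk] := FA (f x); [exists x|exists k].
  apply: (le_trans (outer_measure_sigma_subadditive mu _)).
  by apply: lee_nneseries => // k _ *; exact: H.
rewrite nneseriesZl in H; last by move=> k _; exact: wlength_ge0.
apply: (@le_trans _ _ (lam%:E * ((lam^-1)%:E * \sum_(k <oo) wlength idfun (F k)))).
  by rewrite lee_pmul2l.
by rewrite muleA -EFinM mulfV ?mul1e// gt_eqF.
Qed.

(** Caratheodory's criterion: [X] need not be measurable. *)
Lemma lebesgue_split (S X : set R) : measurable S ->
  mu X = mu (X `&` S) + mu (X `&` ~` S).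
Proof. by move=> mS; exact: (sub_caratheodory (wlength idfun) mS X). Qed.

End counting.

(** The number of times [j < n] at which the orbit of [x] is outside [V]. *)
Definition misses {R : realType} (f : R -> R) (V : set R) (n : nat) (x : R) : nat :=
  (\sum_(j < n) ~~ `[< V (iter j f x) >])%N.

Lemma missesS {R : realType} (f : R -> R) V n x :
  misses f V n.+1 x = (~~ `[< V x >] + misses f V n (f x))%N.
Proof.
rewrite /misses big_ord_recl/=; congr addn; apply: eq_bigr => j _.
by rewrite -iterS iterSr.
Qed.

(** The points whose orbit up to time [n] avoids [c] and is outside [V] at most [k]
    times. *)
Definition few_misses {R : realType} (c : R) (f : R -> R) V n k : set R :=
  [set x | [/\ 0 < x < 1, (forall j, (j < n)%N -> iter j f x != c) &
               (misses f V n x <= k)%N]].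

Section few_misses_measure.
Context {R : realType} (c lam theta : R) (f : R -> R) (V S : set R).
Local Notation mu := (@lebesgue_measure R).
Local Notation E := (few_misses c f V).
Hypothesis lam1 : 0 < lam.
Hypothesis theta01 : 0 < theta <= 1.
Hypothesis f_itv : forall x, 0 < x < 1 -> x != c -> 0 < f x < 1.
Hypothesis f_exp : expanding c 0 1 lam f.
Hypothesis mS : measurable S.
Hypothesis VS : forall x, 0 < x < 1 -> V x -> x < c -> S (f x).
Hypothesis VSC : forall x, 0 < x < 1 -> V x -> c < x -> ~ S (f x).

Let preimage_le (A B : set R) :
  (A `<=` [set x | 0 < x < c /\ x < 1] \/ A `<=` [set x | c < x < 1 /\ 0 < x]) ->
  (forall x, A x -> B (f x)) -> (mu A <= (lam^-1)%:E * mu B)%E.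
Proof.
move=> sA AB.
have : (lam%:E * mu A <= mu (f @` A))%E.
  apply: expanding_outer_measure => // x y Ax Ay xy.
  apply: le_trans (ler_norm _); apply: f_exp => //.
  - by case: sA => /(_ _ Ax)/= [] /andP[? ?].
  - by case: sA => /(_ _ Ay)/= [] /andP[? ?].
  - case: sA => sA; [left; have /= [/andP[]//] := sA _ Ay|].
    by right; have /= [/andP[]//] := sA _ Ax.
have fAB : (mu (f @` A) <= mu B)%E.
  by apply: le_outer_measure => _ [x Ax <-]; exact: AB.
move=> /le_trans/(_ fAB) H.
rewrite -[leLHS]mul1e -(@mulVf _ lam) ?gt_eqF// EFinM -muleA.
by rewrite lee_pmul2l// lte_fin invr_gt0.
Qed.

Let few_missesS n k x : E n.+1 k x ->
  [/\ 0 < x < 1, x != c & V x /\ E n k (f x) \/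
     (0 < k)%N /\ E n k.-1 (f x)].
Proof.
move=> [x01 xc]; have xc0 := xc 0%N (ltn0Sn _); rewrite missesS => m.
have fc j : (j < n)%N -> iter j f (f x) != c.
  by move=> jn; rewrite -iterSr; exact: (xc j.+1).
split => //; case: (pselect (V x)) => Vx.
  left; split => //; split => //; first exact: f_itv.
  by move: m; rewrite asboolT.
right; move: m; rewrite asboolF//= add1n; case: k => // k; rewrite ltnS => m.
by split => //; split => //; exact: f_itv.
Qed.

(** The set [S] separates the images under the two branches of [f] of the points
    of [V]. A point visited from [V] has thus one relevant preimage, and a point
    visited from outside [V] at most two, which gives the recursion
    [b (n + 1) k <= (b n k + 2 b n (k - 1)) / lam] solved by the bound. *)
Lemma few_misses_le n k :
  (mu (E n k) <= (theta^-1 ^+ k * ((1 + 2 * theta) / lam) ^+ n)%:E)%E.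
Proof.
have /andP[t0 t1] := theta01.
have q0 : 0 <= (1 + 2 * theta) / lam by rewrite divr_ge0 ?(ltW lam1)//; lra.
elim: n k => [|n IH] k.
  apply: (@le_trans _ _ (mu `]0%R, 1%R[%classic)).
    by apply: le_outer_measure => x [x01 _ _]; rewrite /= in_itv.
  rewrite lebesgue_measure_itv/= lte_fin ltr01 oppr0 adde0 lee_fin expr0 mulr1.
  by apply: exprn_ege1; rewrite invf_ge1.
pose q := (1 + 2 * theta) / lam.
pose b := theta^-1 ^+ k * q ^+ n.
pose A1 := [set x | (0 < x < c /\ x < 1) /\ V x /\ E n k (f x)].
pose A2 := [set x | (c < x < 1 /\ 0 < x) /\ V x /\ E n k (f x)].
pose B1 := [set x | (0 < x < c /\ x < 1) /\ (0 < k)%N /\ E n k.-1 (f x)].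
pose B2 := [set x | (c < x < 1 /\ 0 < x) /\ (0 < k)%N /\ E n k.-1 (f x)].
have sub : E n.+1 k `<=` (A1 `|` A2) `|` (B1 `|` B2).
  move=> x /few_missesS [/andP[x0 x1] xc].
  case: (ltgtP x c) xc => // xc _ [H|H].
  - by left; left; split => //; rewrite x0 xc.
  - by right; left; split => //; rewrite x0 xc.
  - by left; right; split => //; rewrite x1 xc.
  - by right; right; split => //; rewrite x1 xc.
have hA1 : (mu A1 <= (lam^-1)%:E * mu (E n k `&` S))%E.
  apply: preimage_le; first by left => x [].
  move=> x [[/andP[x0 xc] x1] [Vx Ex]]; split => //.
  by apply: VS => //; rewrite x0.
have hA2 : (mu A2 <= (lam^-1)%:E * mu (E n k `&` ~` S))%E.
  apply: preimage_le; first by right => x [].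
  move=> x [[/andP[x0 xc] x1] [Vx Ex]]; split => //=.
  by apply: VSC => //; rewrite x1.
have hA : (mu A1 + mu A2 <= (lam^-1 * b)%:E)%E.
  apply: (le_trans (leeD hA1 hA2)).
  rewrite -muleDr; [|by []|by rewrite ge0_adde_def// inE].
  by rewrite -lebesgue_split// EFinM lee_pmul2l ?lte_fin ?invr_gt0.
have hB1 : (mu B1 <= (lam^-1 * (theta * b))%:E)%E.
  case: (posnP k) => [k0|k0].
    rewrite (_ : B1 = set0) ?measure0 ?lee_fin.
      by rewrite !mulr_ge0 ?exprn_ge0 ?invr_ge0 ?(ltW t0) ?(ltW lam1).
    by apply/seteqP; split => // x [_ []]; rewrite k0.
  apply: (@le_trans _ _ ((lam^-1)%:E * mu (E n k.-1))%E).
    by apply: preimage_le; [left => x []|move=> x [_ []]].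
  rewrite EFinM lee_pmul2l ?lte_fin ?invr_gt0//.
  apply: (le_trans (IH _)); rewrite lee_fin /b -{2}(prednK k0) exprS.
  by rewrite !mulrA mulfV ?mul1r ?gt_eqF.
have hB2 : (mu B2 <= (lam^-1 * (theta * b))%:E)%E.
  case: (posnP k) => [k0|k0].
    rewrite (_ : B2 = set0) ?measure0 ?lee_fin.
      by rewrite !mulr_ge0 ?exprn_ge0 ?invr_ge0 ?(ltW t0) ?(ltW lam1).
    by apply/seteqP; split => // x [_ []]; rewrite k0.
  apply: (@le_trans _ _ ((lam^-1)%:E * mu (E n k.-1))%E).
    by apply: preimage_le; [right => x []|move=> x [_ []]].
  rewrite EFinM lee_pmul2l ?lte_fin ?invr_gt0//.
  apply: (le_trans (IH _)); rewrite lee_fin /b -{2}(prednK k0) exprS.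
  by rewrite !mulrA mulfV ?mul1r ?gt_eqF.
apply: (le_trans (le_outer_measure mu _ _ sub)).
apply: (le_trans (outer_measureU2 mu _ _)).
apply: (@le_trans _ _ ((mu A1 + mu A2) + (mu B1 + mu B2))%E).
  by apply: leeD; exact: outer_measureU2.
apply: (le_trans (leeD hA (leeD hB1 hB2))).
rewrite -!EFinD lee_fin exprS -/q [leRHS]mulrCA -/b /q; move: (b) => B.
rewrite le_eqVlt; apply/orP; left; apply/eqP.
by field; rewrite gt_eqF.
Qed.

End few_misses_measure.

(** The proportion [1/e] of misses that is tolerated depends only on the
    expansion. *)
Lemma frequent_visits_null {R : realType} (lam : R) : 1 < lam ->
  exists2 e, (0 < e)%N & forall (c : R) (f : R -> R) (V S : set R),
  (forall x, 0 < x < 1 -> x != c -> 0 < f x < 1) ->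
  expanding c 0 1 lam f -> measurable S ->
  (forall x, 0 < x < 1 -> V x -> x < c -> S (f x)) ->
  (forall x, 0 < x < 1 -> V x -> c < x -> ~ S (f x)) ->
  lebesgue_measure [set x | exists N, forall k, (N <= k)%N ->
     few_misses c f V (e * k) k x] = 0%E.
Proof.
move=> lam1.
pose theta := Num.min 1 ((lam - 1) / 4).
have t0 : 0 < theta by rewrite lt_min ltr01 divr_gt0// subr_gt0.
have t1 : theta <= 1 by rewrite ge_min lexx.
have t2 : theta <= (lam - 1) / 4 by rewrite ge_min lexx orbT.
pose q := (1 + 2 * theta) / lam.
have q0 : 0 <= q by rewrite divr_ge0//; lra.
have q1 : q < 1 by rewrite /q ltr_pdivrMr; lra.
(* With this choice the bound at time e * k is at most 2^-k. *)
have [e e0 qe] : exists2 e, (0 < e)%N & q ^+ e <= theta / 2.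
  have : q ^+ n @[n --> \oo] --> 0 by apply: cvg_expr; rewrite ger0_norm.
  move=> /cvgrPdist_le/(_ (theta / 2)); rewrite divr_gt0// => /(_ isT) [N _ H].
  exists N.+1 => //; have := H N.+1 (leqnSn _).
  by rewrite sub0r normrN ger0_norm// exprn_ge0.
exists e => // c f V S f_itv f_exp mS VS VSC.
rewrite (_ : [set x | _] = \bigcup_N \bigcap_(k in [set k | (N <= k)%N])
   few_misses c f V (e * k) k); last first.
  apply/seteqP; split => [x [N H]|x [N _ H]]; first by exists N.
  by exists N.
apply/eqP; rewrite eq_le measure_ge0 andbT.
apply: (le_trans (outer_measure_sigma_subadditive (@lebesgue_measure R) _)).
rewrite eseries0// => N _ _; apply/eqP; rewrite eq_le measure_ge0 andbT.
apply/lee_addgt0Pr => d d0; rewrite add0e.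
have : (2^-1 : R) ^+ n @[n --> \oo] --> 0.
  by apply: cvg_expr; rewrite ger0_norm// invf_lt1// ltr1n.
move=> /cvgrPdist_le/(_ _ d0)[M _ H].
pose k := maxn N M.
have := H k (leq_maxr _ _); rewrite sub0r normrN ger0_norm// => Hk.
apply: (@le_trans _ _ (lebesgue_measure (few_misses c f V (e * k) k))).
  by apply: le_outer_measure => x; apply; exact: leq_maxl.
have t01 : 0 < theta <= 1 by rewrite t0.
apply: le_trans (few_misses_le (lt_trans ltr01 lam1) t01 f_itv f_exp mS VS VSC _ _) _.
rewrite lee_fin; apply: le_trans Hk.
rewrite exprM -exprMn; apply: lerXn2r; rewrite ?nnegrE ?mulr_ge0 ?exprn_ge0 ?invr_ge0 ?(ltW t0)//.
by rewrite [leLHS]mulrC ler_pdivrMr// [leRHS]mulrC.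
Qed.

(** * One-sided derivatives *)

Section derive_in_mvt.
Context {R : realType}.
Implicit Types (D : set R) (u : R -> R).

Lemma derivable_inP D u z : derivable_in D u z -> forall e, 0 < e ->
  exists2 d, 0 < d & forall w, D w -> w != z -> `|w - z| < d ->
    `|derive_in D u z - (u w - u z) / (w - z)| <= e.
Proof.
move=> du e e0.
have /cvgrPdist_le/(_ _ e0)[d /= d0 H] : (u y - u z) / (y - z) @[y --> within D z^']
  --> derive_in D u z by exact: du.
by exists d => // w Dw wz wzd; apply: H => //=; rewrite distrC.
Qed.

Lemma derivable_in_lipschitz_at D u z : derivable_in D u z ->
  exists K d, [/\ 0 < K, 0 < d & forall w, D w -> `|w - z| < d ->
    `|u w - u z| <= K * `|w - z|].
Proof.
move=> /derivable_inP/(_ 1 ltr01)[d d0 H].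
exists (`|derive_in D u z| + 1), d; split => //.
move=> w Dw wzd; have [->|wz] := eqVneq w z; first by rewrite !subrr normr0 mulr0.
rewrite -ler_pdivrMr ?normr_gt0 ?subr_eq0// -normf_div.
have := H _ Dw wz wzd; set q := _ / _; set l := derive_in _ _ _ => Hq.
have := ler_normB l (l - q); rewrite opprB addrCA subrr addr0; lra.
Qed.

Lemma derivable_in_continuous D u z : derivable_in D u z ->
  u w @[w --> within D (nbhs z)] --> u z.
Proof.
move=> /derivable_in_lipschitz_at[K [d [K0 d0 H]]].
apply/cvgrPdist_le => e e0; exists (Num.min d (e / K)) => /=.
  by rewrite lt_min d0 divr_gt0.
move=> w /= ; rewrite distrC lt_min => /andP[wd we] Dw.
rewrite distrC (le_trans (H _ Dw wd))// mulrC -ler_pdivlMr//; exact: ltW.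
Qed.

Lemma within_nbhs D (z F : R) u : nbhs z D ->
  u w @[w --> within D (nbhs z)] --> F -> u w @[w --> z] --> F.
Proof.
move=> Dz H A /H HA; by apply: filterS2 Dz HA => w Dw; apply.
Qed.

Lemma derivable_in_is_derive D u (z : R) : nbhs z D -> derivable_in D u z ->
  is_derive z 1 u (derive_in D u z).
Proof.
move=> [d1 /= d10 H1] /derivable_inP du.
have H : (fun h => h^-1 *: ((u \o shift z) (h *: 1) - u z)) @ 0^' -->
    derive_in D u z.
  apply/cvgrPdist_le => e e0; have [d d0 H] := du _ e0.
  exists (Num.min d d1); first by rewrite /= lt_min d0.
  move=> h /=; rewrite sub0r normrN lt_min => /andP[hd hd1] h0.
  have -> : h^-1 *: (u (h *: 1 + z) - u z) = (u (h + z) - u z) / ((h + z) - z).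
    by rewrite addrK /GRing.scale/= mulr1 mulrC.
  apply: H; rewrite ?addrK//.
  - by apply: H1 => /=; rewrite opprD addrCA subrr addr0 normrN.
  - by rewrite -subr_eq0 addrK.
split; first by apply/cvg_ex; exists (derive_in D u z).
exact: cvg_lim.
Qed.

Lemma MVT_in D u x y : x < y -> (forall z, x <= z <= y -> D z) ->
  (forall z, x <= z <= y -> derivable_in D u z) ->
  exists2 z, x < z < y & u y - u x = derive_in D u z * (y - x).
Proof.
move=> xy xyD du.
have [||z] := @MVT R u (derive_in D u) x y xy.
- move=> z; rewrite in_itv/= => /andP[xz zy]; apply: derivable_in_is_derive.
    have : z \in `]x, y[ by rewrite in_itv/= xz.
    move=> /near_in_itvoo; apply: filterS => w; rewrite in_itv/= => /andP[? ?].
    by apply: xyD; rewrite !ltW.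
  by apply: du; rewrite !ltW.
- apply/subspace_continuousP => z; rewrite /= in_itv/= => zxy.
  have := derivable_in_continuous (du _ zxy).
  apply: cvg_trans; apply: cvg_app; apply: within_subset => w /=.
  by rewrite in_itv; exact: xyD.
by rewrite in_itv; exists z.
Qed.

End derive_in_mvt.

Section C1holder_itv.
Context {R : realType} (rho a b : R) (u : R -> R).
Hypothesis rho0 : 0 < rho.

Lemma C1holder_derive_bounded : C1holder rho `[a, b] u ->
  exists2 M, 0 < M & forall x, a <= x <= b -> `|derive_in `[a, b] u x| <= M.
Proof.
move=> [du [K HK]]; exists (`|derive_in `[a, b] u a| + `|K| * (b - a) `^ rho + 1).
  by rewrite ltr_wpDl// addr_ge0// mulr_ge0// powR_ge0.
move=> x /andP[ax xb]; have ab := le_trans ax xb.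
have aI : `[a, b]%classic a by rewrite /= in_itv/= lexx.
have xI : `[a, b]%classic x by rewrite /= in_itv/= ax.
have H1 := HK _ _ xI aI; have H2 : K * `|x - a| `^ rho <= `|K| * (b - a) `^ rho.
  apply: (@le_trans _ _ (`|K| * `|x - a| `^ rho)).
    by rewrite ler_wpM2r ?powR_ge0// ler_norm.
  rewrite ler_wpM2l// ge0_ler_powR ?nnegrE ?(ltW rho0)// ?subr_ge0//.
  by rewrite ger0_norm ?subr_ge0// lerD2r.
have := ler_normD (derive_in `[a, b] u x - derive_in `[a, b] u a)
  (derive_in `[a, b] u a); rewrite subrK; lra.
Qed.

Lemma derive_in_lipschitz M : 0 <= M ->
  (forall x, a <= x <= b -> derivable_in `[a, b] u x) ->
  (forall x, a <= x <= b -> `|derive_in `[a, b] u x| <= M) ->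
  forall x y, a <= x <= b -> a <= y <= b -> `|u x - u y| <= M * `|x - y|.
Proof.
move=> M0 du dM.
suff W x y : a <= x -> x < y -> y <= b -> `|u y - u x| <= M * `|y - x|.
  move=> x y /andP[ax xb] /andP[ay yb].
  have [xy|yx|->] := ltgtP x y; [|exact: W|by rewrite !subrr normr0 mulr0].
  by rewrite distrC (distrC x); exact: W.
move=> ax xy yb; have [||z /andP[xz zy] ->] := @MVT_in R `[a, b] u x y xy.
- by move=> z /andP[xz zy] /=; rewrite in_itv/= (le_trans ax xz) (le_trans zy yb).
- by move=> z /andP[xz zy]; apply: du; rewrite (le_trans ax xz) (le_trans zy yb).
rewrite normrM ler_wpM2r//; apply: dM.
by rewrite (le_trans ax (ltW xz)) (le_trans (ltW zy) yb).
Qed.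

Lemma C1holder_lipschitz : C1holder rho `[a, b] u ->
  exists2 M, 0 < M & forall x y, a <= x <= b -> a <= y <= b ->
    `|u x - u y| <= M * `|x - y|.
Proof.
move=> Cu; have [M M0 HM] := C1holder_derive_bounded Cu.
exists M => //; apply: derive_in_lipschitz => //; first exact: ltW.
by move=> x xab; case: Cu => + _; apply; rewrite /= in_itv.
Qed.

Lemma C1holder_norm_lt (e : R) : a < b -> (C1holder_norm rho `[a, b] u < e%:E)%E ->
  forall x, a <= x <= b -> `|u x| <= e /\ `|derive_in `[a, b] u x| <= e.
Proof.
move=> ab Ne.
have aI : `[a, b]%classic a by rewrite /= in_itv/= lexx ltW.
have bI : `[a, b]%classic b by rewrite /= in_itv/= lexx ltW.
set s0 := ereal_sup [set (`|u x|)%:E | x in `[a, b]].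
set s1 := ereal_sup [set (`|derive_in `[a, b] u x|)%:E | x in `[a, b]].
set s2 := ereal_sup [set (`|derive_in `[a, b] u p.1 - derive_in `[a, b] u p.2|
   / `|p.1 - p.2| `^ rho)%:E
   | p in [set p : R * R | [/\ `[a, b]%classic p.1, `[a, b]%classic p.2 & p.1 != p.2]]].
have p0 : (0 <= s0)%E.
  by apply: le_trans (ereal_sup_ubound _); last by exists a; [|reflexivity].
have p1 : (0 <= s1)%E.
  by apply: le_trans (ereal_sup_ubound _); last by exists a; [|reflexivity].
have p2 : (0 <= s2)%E.
  apply: le_trans (ereal_sup_ubound _); last first.
    by exists (a, b); [split => //=; rewrite lt_eqF|reflexivity].
  by rewrite lee_fin divr_ge0// powR_ge0.
have Ne' : (s0 + s1 + s2 < e%:E)%E by exact: Ne.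
move=> x xab; have xI : `[a, b]%classic x by rewrite /= in_itv.
split; rewrite -lee_fin; apply: le_trans (ltW Ne').
  apply: (@le_trans _ _ s0); first by apply: ereal_sup_ubound; exists x.
  by rewrite -addeA leeDl// adde_ge0.
apply: (@le_trans _ _ s1); first by apply: ereal_sup_ubound; exists x.
by rewrite -addeA addeC -addeA leeDl// adde_ge0.
Qed.

End C1holder_itv.

Lemma C1holder_norm_ge0 {R : realType} (rho a b : R) u : a < b ->
  (0 <= C1holder_norm rho `[a, b] u)%E.
Proof.
move=> ab.
have aI : `[a, b]%classic a by rewrite /= in_itv/= lexx ltW.
have bI : `[a, b]%classic b by rewrite /= in_itv/= lexx ltW.
rewrite /C1holder_norm !adde_ge0//.
- by apply: le_trans (ereal_sup_ubound _); last by exists a; [|reflexivity].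
- by apply: le_trans (ereal_sup_ubound _); last by exists a; [|reflexivity].
- apply: le_trans (ereal_sup_ubound _); last first.
    by exists (a, b); [split => //=; rewrite lt_eqF|reflexivity].
  by rewrite lee_fin divr_ge0// powR_ge0.
Qed.

(** * Concavity of powers with exponent less than one *)

Section powR_concave.
Context {R : realType} (al : R).
Hypothesis al01 : 0 < al < 1.

(** Deduced from the convexity of the inverse function. *)
Lemma powR_concave t x y : 0 <= t <= 1 -> 0 <= x -> 0 <= y ->
  t * x `^ al + (1 - t) * y `^ al <= (t * x + (1 - t) * y) `^ al.
Proof.
move=> /andP[t0 t1] x0 y0; have /andP[a0 a1] := al01.
have p1 : 1 <= al^-1 by rewrite invf_ge1// ltW.
have K z : 0 <= z -> (z `^ al) `^ al^-1 = z.
  by move=> z0; rewrite -powRrM mulfV ?gt_eqF// powRr1.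
have := convex_powR p1 (Itv01 t0 t1) (x := x `^ al) (y := y `^ al).
rewrite !inE/= !in_itv/= !andbT !powR_ge0 => /(_ isT isT).
rewrite !convRE/= !K// => H.
have nn : 0 <= t * x `^ al + (1 - t) * y `^ al.
  by rewrite addr_ge0// mulr_ge0 ?powR_ge0// subr_ge0.
have K2 : ((t * x `^ al + (1 - t) * y `^ al) `^ al^-1) `^ al =
   t * x `^ al + (1 - t) * y `^ al.
  by rewrite -powRrM mulVf ?gt_eqF// powRr1.
rewrite -{1}K2; apply: ge0_ler_powR; rewrite ?nnegrE ?powR_ge0 ?(ltW a0)//.
by rewrite addr_ge0// mulr_ge0// subr_ge0.
Qed.

Lemma powR_incr_anti u a h : 0 <= u -> u <= a -> 0 <= h ->
  (a + h) `^ al - a `^ al <= (u + h) `^ al - u `^ al.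
Proof.
move=> u0 ua h0.
have [E|ne] := eqVneq (a + h) u.
  have -> : h = 0 by lra.
  have -> : a = u by lra.
  by rewrite !addr0.
have D : 0 < a + h - u by rewrite subr_gt0 lt_neqAle eq_sym ne/=; lra.
pose t := (a - u) / (a + h - u).
have t0 : 0 <= t by rewrite divr_ge0//; lra.
have t1 : t <= 1 by rewrite ler_pdivrMr//; lra.
have tD : t * (a + h - u) = a - u by rewrite mulfVK// gt_eqF.
have ah : 0 <= a + h by lra.
have t01 : 0 <= t <= 1 by rewrite t0.
have t01' : 0 <= 1 - t <= 1 by apply/andP; split; lra.
have H1 := powR_concave t01 ah u0.
have H2 := powR_concave t01' ah u0.
rewrite (_ : t * (a + h) + (1 - t) * u = a) in H1; last by lra.
rewrite (_ : (1 - t) * (a + h) + (1 - (1 - t)) * u = u + h) in H2; last by lra.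
lra.
Qed.

Lemma powR_incr_scale u h k : 0 <= u -> 0 <= h -> 0 <= k <= 1 ->
  k * ((u + h) `^ al - u `^ al) <= (u + k * h) `^ al - u `^ al.
Proof.
move=> u0 h0 k01; have uh : 0 <= u + h by lra.
have := powR_concave k01 uh u0.
rewrite (_ : k * (u + h) + (1 - k) * u = u + k * h); lra.
Qed.

(** Increments of [x^al] are stable: if [a'] and [b' - a'] are close to [a] and
    [b - a] up to a factor, so is the increment of the power. *)
Lemma powR_robust d a b a' b' : 0 <= d -> d < 1 -> 0 <= a -> a <= b ->
  0 <= a' -> a' <= (1 + d) * a -> (1 - d) * (b - a) <= b' - a' ->
  (1 - d) / (1 + d) * (b `^ al - a `^ al) <= b' `^ al - a' `^ al.
Proof.
move=> d0 d1 a0 ab a'0 a'a bb; have /andP[al0 al1] := al01.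
have k0 : 0 < 1 + d by lra.
pose k := (1 - d) / (1 + d); pose u := a' / (1 + d).
have u0 : 0 <= u by rewrite divr_ge0// ltW.
have ua : u <= a by rewrite ler_pdivrMr// mulrC.
have ab0 : 0 <= b - a by lra.
have kk : 0 <= k <= 1.
  by rewrite divr_ge0 ?(ltW k0)//= ?ler_pdivrMr//; lra.
have /andP[kk0 kk1] := kk.
have ku : (1 + d) * u = a' by rewrite mulrC mulfVK// gt_eqF.
have kE : (1 + d) * k = 1 - d by rewrite mulrC mulfVK// gt_eqF.
have s1 := powR_incr_scale u0 ab0 kk.
have s2 := powR_incr_anti u0 ua ab0.
rewrite (_ : a + (b - a) = b) in s2; last by lra.
have s3 : k * (b `^ al - a `^ al) <= k * ((u + (b - a)) `^ al - u `^ al).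
  by rewrite ler_wpM2l.
have nn : 0 <= u + k * (b - a) by rewrite addr_ge0// mulr_ge0.
have s4 : (1 + d) `^ al * ((u + k * (b - a)) `^ al - u `^ al) <= b' `^ al - a' `^ al.
  rewrite mulrBr -!powRM ?(ltW k0)// ku lerD2r.
  apply: ge0_ler_powR; rewrite ?nnegrE ?(ltW al0)//.
  - by rewrite mulr_ge0// ltW.
  - nra.
  - by rewrite mulrDr ku mulrA kE; lra.
have s5 : 1 <= (1 + d) `^ al.
  have {1}<- : 1 `^ al = 1 :> R by rewrite powR1.
  by apply: ge0_ler_powR; rewrite ?nnegrE ?(ltW al0) ?(ltW k0) ?lerDl.
have s6 : 0 <= (u + k * (b - a)) `^ al - u `^ al.
  rewrite subr_ge0; apply: ge0_ler_powR; rewrite ?nnegrE ?(ltW al0)//.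
  by rewrite lerDl mulr_ge0.
apply: le_trans s4; apply: (le_trans s3); apply: (le_trans s1).
by rewrite ler_peMl.
Qed.

Lemma powR_dist_le a b : 0 <= a -> 0 <= b -> `|a `^ al - b `^ al| <= `|a - b| `^ al.
Proof.
have /andP[al0 al1] := al01.
wlog ab : a b / a <= b => [W a0 b0|a0 b0].
  have [ab|/ltW ba] := leP a b; first exact: W.
  by rewrite distrC (distrC a); exact: W.
have h0 : 0 <= b - a by lra.
have := powR_incr_anti (lexx 0) a0 h0.
rewrite add0r powR0 ?gt_eqF// subr0 (_ : a + (b - a) = b); last by lra.
have mono : a `^ al <= b `^ al by apply: ge0_ler_powR; rewrite ?nnegrE ?(ltW al0).
by rewrite distrC (distrC a) !ger0_norm// subr_ge0.
Qed.

Lemma powR_small e : 0 < e -> exists2 d, 0 < d &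
  forall x, 0 <= x -> x <= d -> x `^ al <= e.
Proof.
have /andP[al0 al1] := al01 => e0; exists (e `^ al^-1); first exact: powR_gt0.
move=> x x0 xd; have -> : e = (e `^ al^-1) `^ al.
  by rewrite -powRrM mulVf ?gt_eqF// powRr1// ltW.
by apply: ge0_ler_powR; rewrite ?nnegrE ?(ltW al0) ?powR_ge0.
Qed.

End powR_concave.

(** * Elementary properties of Lorenz maps *)

Lemma C1holder_diffeo_expand {R : realType} (rho a b B : R) u : 0 < rho ->
  C1holder_diffeo rho `[a, b] `[0, B] u ->
  exists2 m, 0 < m & forall x y, a <= x <= b -> a <= y <= b ->
    m * `|x - y| <= `|u x - u y|.
Proof.
move=> rho0 [Cu [v [Cv [uB vA vK _]]]].
have [M M0 HM] := C1holder_lipschitz rho0 Cv.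
exists M^-1 => [|x y xab yab]; first by rewrite invr_gt0.
have xI : `[a, b]%classic x by rewrite /= in_itv.
have yI : `[a, b]%classic y by rewrite /= in_itv.
have := uB _ xI; rewrite /= in_itv => ux.
have := uB _ yI; rewrite /= in_itv => uy.
rewrite ler_pdivrMl//; have := HM _ _ ux uy; by rewrite !vK.
Qed.

Lemma le_adde4 {R : realType} (a b n m : \bar R) :
  (0 <= a -> 0 <= b -> 0 <= n -> 0 <= m ->
  [/\ a <= a + b + n + m, b <= a + b + n + m, n <= a + b + n + m &
      m <= a + b + n + m])%E.
Proof.
move=> a0 b0 n0 m0; split.
- by rewrite -!addeA leeDl// !adde_ge0.
- by rewrite -!addeA addeCA leeDl// !adde_ge0.
- by rewrite -addeA addeCA leeDl// !adde_ge0.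
- by rewrite leeDr// !adde_ge0.
Qed.

Section lorenz_basics.
Context {R : realType} {rho c alpha beta : R}.
Hypothesis hrho : 0 < rho < 1.
Hypothesis halpha : 0 < alpha < 1.
Hypothesis hbeta : 0 < beta < 1.
Local Notation L := (lorenz_map rho c alpha beta).
Implicit Types f g : L.

Lemma lorenz_c01 f : 0 < c < 1.
Proof. by have [] := lorenz_expanding f. Qed.

Lemma lorenz_derivable f x : lorenz_dom c x -> derivable_in (lorenz_dom c) f x.
Proof. by have [_ [_ [+ _]] _ _ _] := lorenz_expanding f; apply. Qed.

Lemma lorenz_slope f M x y : 0 <= x -> x <= y -> y <= 1 -> y < c \/ c < x ->
  (forall z, x < z < y -> M <= derive_in (lorenz_dom c) f z) ->
  M * (y - x) <= f y - f x.
Proof.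
move=> x0; rewrite le_eqVlt => /orP[/eqP->|xy]; first by rewrite !subrr mulr0.
move=> y1 side Mz.
have D z : x <= z <= y -> lorenz_dom c z.
  move=> /andP[xz zy]; split; first by rewrite /= in_itv/=; apply/andP; split; lra.
  by move=> /= zc; case: side; lra.
have [z xzy ->] := MVT_in xy D (fun z zxy => @lorenz_derivable f _ (D _ zxy)).
by rewrite ler_wpM2r ?Mz//; lra.
Qed.

Lemma lorenz_slope_gt1 f : exists2 sigma, 1 < sigma &
  forall x y, 0 <= x -> x <= y -> y <= 1 -> y < c \/ c < x ->
    sigma * (y - x) <= f y - f x.
Proof.
have [_ _ _ [s s1 Hs] _] := lorenz_expanding f.
exists s => // x y x0 xy y1 side; apply: lorenz_slope => // z /andP[xz zy].
apply: Hs; split; first by rewrite /= in_itv/=; apply/andP; split; lra.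
by move=> /= zc; case: side; lra.
Qed.

Lemma lorenz_expanding_near f M : exists r, [/\ 0 < r, 0 <= c - r, c + r <= 1 &
  expanding c (c - r) (c + r) M f].
Proof.
have /andP[c0 c1] := lorenz_c01 f.
have [_ _ _ _ [/cvgryPge/(_ M)[r1 /= r10 H1] /cvgryPge/(_ M)[r2 /= r20 H2]]] :=
  lorenz_expanding f.
pose r := Num.min (Num.min r1 r2) (Num.min c (1 - c)).
have r0 : 0 < r by rewrite !lt_min r10 r20 c0 subr_gt0.
have rr1 : r <= r1 by rewrite !ge_min lexx.
have rr2 : r <= r2 by rewrite !ge_min lexx !orbT.
have rc : r <= c by rewrite !ge_min lexx !orbT.
have rc1 : r <= 1 - c by rewrite !ge_min lexx !orbT.
exists r; split => //; [lra|lra|].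
move=> x y ax xy yb side; apply: lorenz_slope => //; [lra|lra|].
move=> z /andP[xz zy]; case: side => side.
  by apply: H1; [rewrite /= ger0_norm; lra|lra].
by apply: H2; [rewrite /= ltr0_norm; lra|lra].
Qed.

Lemma lorenz_gt0_lt1 f x : 0 < x < 1 -> x != c -> 0 < f x < 1.
Proof.
move=> /andP[x0 x1] xc; have /andP[c0 c1] := lorenz_c01 f.
have [_ [f01 _] [f0 f1] _ _] := lorenz_expanding f.
have [s s1 Hs] := lorenz_slope_gt1 f.
have I y : 0 <= y <= 1 -> y != c -> 0 <= f y <= 1.
  move=> y01 yc; have : lorenz_dom c y.
    by split; [rewrite /= in_itv|move=> /= E; rewrite E eqxx in yc].
  by move=> /f01; rewrite /= in_itv.
case: (ltgtP x c) xc => // xc _.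
  have H1 := Hs 0 x (lexx _) (ltW x0) (ltW x1) (or_introl xc).
  have m : x < (x + c) / 2 by lra.
  have mc : (x + c) / 2 < c by lra.
  have m1 : (x + c) / 2 <= 1 by lra.
  have H2 := Hs x ((x + c) / 2) (ltW x0) (ltW m) m1 (or_introl mc).
  have /andP[_ H3] : 0 <= f ((x + c) / 2) <= 1.
    by apply: I; [apply/andP; split; lra|rewrite lt_eqF].
  by rewrite f0 in H1; apply/andP; split; nra.
have H1 := Hs x 1 (ltW x0) (ltW x1) (lexx _) (or_intror xc).
have m : (x + c) / 2 < x by lra.
have mc : c < (x + c) / 2 by lra.
have m1 : 0 <= (x + c) / 2 by lra.
have H2 := Hs ((x + c) / 2) x m1 (ltW m) (ltW x1) (or_intror mc).
have /andP[H3 _] : 0 <= f ((x + c) / 2) <= 1.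
  by apply: I; [apply/andP; split; lra|rewrite gt_eqF].
by rewrite f1 in H1; apply/andP; split; nra.
Qed.

Lemma lorenz_continuous f x : 0 < x < 1 -> x != c -> f y @[y --> x] --> f x.
Proof.
move=> x01 xc.
have D : nbhs x (lorenz_dom c).
  have x01' : x \in `]0, 1[ by rewrite in_itv.
  have xc' : nbhs x (~` [set c]).
    by apply: open_nbhs_nbhs; split; [exact/closed_openC/closed_eq|exact/eqP].
  apply: filterS2 (near_in_itvoo x01') xc' => y y01 yc; split => //=.
  by apply: subset_itv_oo_cc.
apply: (within_nbhs D); apply: derivable_in_continuous.
by apply: lorenz_derivable; exact: (nbhs_singleton D).
Qed.

Lemma lorenz_phi0_facts f :
  [/\ lorenz_phi0 f c = 0,
   (forall x, 0 <= x <= c -> 0 <= lorenz_phi0 f x),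
   (exists2 m, 0 < m & forall x y, 0 <= x <= c -> 0 <= y <= c ->
    m * `|x - y| <= `|lorenz_phi0 f x - lorenz_phi0 f y|),
   (forall x, 0 <= x <= c -> derivable_in `[0, c] (lorenz_phi0 f) x) &
   (exists2 M, 0 < M & forall x y, 0 <= x <= c -> 0 <= y <= c ->
    `|lorenz_phi0 f x - lorenz_phi0 f y| <= M * `|x - y|)].
Proof.
have /andP[rho0 _] := hrho.
have D := lorenz_diffeo0 f; have [Cu [v [_ [uB _ _ _]]]] := D.
split.
- by have [] := lorenz_phi_c f.
- move=> x x0; have /uB : `[0, c]%classic x by rewrite /= in_itv.
  by rewrite /= in_itv/= => /andP[].
- exact: C1holder_diffeo_expand rho0 D.
- by move=> x x0; case: Cu => + _; apply; rewrite /= in_itv.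
- exact: C1holder_lipschitz rho0 Cu.
Qed.

Lemma lorenz_phi1_facts f :
  [/\ lorenz_phi1 f c = 0,
   (forall x, c <= x <= 1 -> 0 <= lorenz_phi1 f x),
   (exists2 m, 0 < m & forall x y, c <= x <= 1 -> c <= y <= 1 ->
    m * `|x - y| <= `|lorenz_phi1 f x - lorenz_phi1 f y|),
   (forall x, c <= x <= 1 -> derivable_in `[c, 1] (lorenz_phi1 f) x) &
   (exists2 M, 0 < M & forall x y, c <= x <= 1 -> c <= y <= 1 ->
    `|lorenz_phi1 f x - lorenz_phi1 f y| <= M * `|x - y|)].
Proof.
have /andP[rho0 _] := hrho.
have D := lorenz_diffeo1 f; have [Cu [v [_ [uB _ _ _]]]] := D.
split.
- by have [] := lorenz_phi_c f.
- move=> x x0; have /uB : `[c, 1]%classic x by rewrite /= in_itv.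
  by rewrite /= in_itv/= => /andP[].
- exact: C1holder_diffeo_expand rho0 D.
- by move=> x x0; case: Cu => + _; apply; rewrite /= in_itv.
- exact: C1holder_lipschitz rho0 Cu.
Qed.

Lemma lorenz_left_value f : left_value c f = lorenz_d0 f.
Proof.
have /andP[c0 c1] := lorenz_c01 f.
have [pc p0 _ _ [M M0 HM]] := lorenz_phi0_facts f.
apply: cvg_lim => //; apply/cvgrPdist_le => e e0.
have [d d0 Hd] := powR_small halpha e0.
exists (Num.min c (d / M)) => /=; first by rewrite lt_min c0 divr_gt0.
move=> x /=; rewrite lt_min => /andP[xc xd] xltc.
have x0 : 0 <= x < c.
  by rewrite xltc andbT; move: xc; rewrite ger0_norm; lra.
have /andP[x1 x2] := x0; have x0' : 0 <= x <= c by rewrite x1 ltW.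
have cc : 0 <= c <= c by rewrite lexx ltW.
rewrite lorenz_fun_left// opprB addrC subrK ger0_norm ?powR_ge0//.
apply: Hd; first exact: p0.
have := HM _ _ cc x0'; rewrite pc sub0r normrN ger0_norm ?p0// => /le_trans; apply.
by rewrite mulrC -ler_pdivlMr// ltW.
Qed.

Lemma lorenz_right_value f : right_value c f = 1 - lorenz_d1 f.
Proof.
have /andP[c0 c1] := lorenz_c01 f.
have [pc p0 _ _ [M M0 HM]] := lorenz_phi1_facts f.
apply: cvg_lim => //; apply/cvgrPdist_le => e e0.
have [d d0 Hd] := powR_small hbeta e0.
exists (Num.min (1 - c) (d / M)) => /=; first by rewrite lt_min subr_gt0 c1 divr_gt0.
move=> x /=; rewrite lt_min => /andP[xc xd] xltc.
have x0 : c < x <= 1.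
  by rewrite xltc/=; move: xc; rewrite ltr0_norm; lra.
have /andP[x1 x2] := x0; have x0' : c <= x <= 1 by rewrite x2 ltW.
have cc : c <= c <= 1 by rewrite lexx ltW.
rewrite lorenz_fun_right// opprD addrA subrr sub0r normrN ger0_norm ?powR_ge0//.
apply: Hd; first exact: p0.
have := HM _ _ cc x0'; rewrite pc sub0r normrN ger0_norm ?p0// => /le_trans; apply.
by rewrite mulrC -ler_pdivlMr// ltW.
Qed.

Lemma lorenz_d0_gt0 f : 0 < lorenz_d0 f <= 1.
Proof.
have /andP[c0 c1] := lorenz_c01 f; have /andP[_ ->] := lorenz_d0_itv f.
have c2 : 0 <= c / 2 < c by apply/andP; split; lra.
have := @lorenz_gt0_lt1 f (c / 2); rewrite lorenz_fun_left// => H.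
have /andP[H1 _] : 0 < lorenz_d0 f - lorenz_phi0 f (c / 2) `^ alpha < 1.
  by apply: H; [apply/andP; split; lra|rewrite lt_eqF//; lra].
by have := powR_ge0 (lorenz_phi0 f (c / 2)) alpha; rewrite andbT; lra.
Qed.

Lemma lorenz_dist_lt f g e : (lorenz_dist f g < e%:E)%E ->
  [/\ `|lorenz_d0 f - lorenz_d0 g| <= e, `|lorenz_d1 f - lorenz_d1 g| <= e,
   (forall x, 0 <= x <= c -> `|lorenz_phi0 f x - lorenz_phi0 g x| <= e),
   (forall x, c <= x <= 1 -> `|lorenz_phi1 f x - lorenz_phi1 g x| <= e) &
   (forall x y, 0 <= x <= c -> 0 <= y <= c ->
     `|(lorenz_phi0 f x - lorenz_phi0 g x) - (lorenz_phi0 f y - lorenz_phi0 g y)|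
       <= e * `|x - y|) /\
   (forall x y, c <= x <= 1 -> c <= y <= 1 ->
     `|(lorenz_phi1 f x - lorenz_phi1 g x) - (lorenz_phi1 f y - lorenz_phi1 g y)|
       <= e * `|x - y|)].
Proof.
have /andP[c0 c1] := lorenz_c01 f; have /andP[rho0 _] := hrho.
rewrite /lorenz_dist !lorenz_left_value !lorenz_right_value.
set n0 := C1holder_norm _ _ _; set n1 := C1holder_norm _ _ _ => H.
have n00 : (0 <= n0)%E by exact: C1holder_norm_ge0.
have n10 : (0 <= n1)%E by exact: C1holder_norm_ge0.
have A0 : (0 <= (`|lorenz_d0 f - lorenz_d0 g|)%:E)%E by rewrite lee_fin.
have A1 : (0 <= (`|1 - lorenz_d1 f - (1 - lorenz_d1 g)|)%:E)%E by rewrite lee_fin.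
have [l0 l1 l2 l3] := le_adde4 A0 A1 n00 n10.
have h0 : (n0 < e%:E)%E by exact: le_lt_trans l2 H.
have h1 : (n1 < e%:E)%E by exact: le_lt_trans l3 H.
have h2 : `|lorenz_d0 f - lorenz_d0 g| <= e.
  by rewrite -lee_fin; apply: le_trans (ltW H).
have h3 : `|lorenz_d1 f - lorenz_d1 g| <= e.
  rewrite -normrN (_ : - _ = 1 - lorenz_d1 f - (1 - lorenz_d1 g)); last by lra.
  by rewrite -lee_fin; apply: le_trans (ltW H).
have [_ _ _ df0 _] := lorenz_phi0_facts f.
have [_ _ _ dg0 _] := lorenz_phi0_facts g.
have [_ _ _ df1 _] := lorenz_phi1_facts f.
have [_ _ _ dg1 _] := lorenz_phi1_facts g.
have b0 := C1holder_norm_lt c0 h0.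
have b1 := C1holder_norm_lt c1 h1.
have e0 : 0 <= e by apply: le_trans h3.
split => //.
- by move=> x /b0[].
- by move=> x /b1[].
- split.
  + apply: (derive_in_lipschitz (u := lorenz_phi0 f \- lorenz_phi0 g) e0) => x xc.
      by apply: (derivable_inB); [exact: df0|exact: dg0].
    by have [] := b0 _ xc.
  + apply: (derive_in_lipschitz (u := lorenz_phi1 f \- lorenz_phi1 g) e0) => x xc.
      by apply: (derivable_inB); [exact: df1|exact: dg1].
    by have [] := b1 _ xc.
Qed.

(** Closeness in the metric implies uniform closeness of the maps. *)
Lemma lorenz_near_C0 f e : 0 < e -> exists2 d, 0 < d & forall g,
  (lorenz_dist f g < d%:E)%E -> `|lorenz_d0 f - lorenz_d0 g| <= e /\
  forall x, 0 < x < 1 -> x != c -> `|f x - g x| <= e.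
Proof.
move=> e0; have e2 : 0 < e / 2 by rewrite divr_gt0.
have [d1 d10 H1] := powR_small halpha e2.
have [d2 d20 H2] := powR_small hbeta e2.
exists (Num.min (e / 2) (Num.min d1 d2)); first by rewrite !lt_min e2 d10.
set d := Num.min _ _.
have dd1 : d <= d1 by rewrite !ge_min lexx !orbT.
have dd2 : d <= d2 by rewrite !ge_min lexx !orbT.
have de : d <= e / 2 by rewrite !ge_min lexx.
move=> g /lorenz_dist_lt[h0 h1 h2 h3 _]; split; first by lra.
have [_ f0 _ _ _] := lorenz_phi0_facts f.
have [_ g0 _ _ _] := lorenz_phi0_facts g.
have [_ f1 _ _ _] := lorenz_phi1_facts f.
have [_ g1 _ _ _] := lorenz_phi1_facts g.
move=> x /andP[x0 x1] xc; case: (ltgtP x c) xc => // xc _.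
  have x00 : 0 <= x < c by rewrite xc ltW.
  have x0c : 0 <= x <= c by rewrite !ltW.
  rewrite !lorenz_fun_left//.
  have := powR_dist_le halpha (f0 _ x0c) (g0 _ x0c).
  have := H1 _ (normr_ge0 (lorenz_phi0 f x - lorenz_phi0 g x)) (le_trans (h2 _ x0c) dd1).
  set A := _ `^ _; set B := _ `^ _; set D := _ `^ _ => hA hB.
  rewrite (_ : _ - _ = (lorenz_d0 f - lorenz_d0 g) - (B - D)); last by lra.
  by rewrite (le_trans (ler_normB _ _))//; lra.
have x00 : c < x <= 1 by rewrite xc ltW.
have x0c : c <= x <= 1 by rewrite !ltW.
rewrite !lorenz_fun_right//.
have := powR_dist_le hbeta (f1 _ x0c) (g1 _ x0c).
have := H2 _ (normr_ge0 (lorenz_phi1 f x - lorenz_phi1 g x)) (le_trans (h3 _ x0c) dd2).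
set A := _ `^ _; set B := _ `^ _; set D := _ `^ _ => hA hB.
rewrite (_ : _ - _ = - (lorenz_d1 f - lorenz_d1 g) + (B - D)); last by lra.
by rewrite (le_trans (ler_normD _ _))// normrN; lra.
Qed.

End lorenz_basics.

(** * Stability under small perturbations *)

Lemma powR_le_inv {R : realType} (al a b : R) : 0 < al -> 0 <= a -> 0 <= b ->
  a `^ al <= b `^ al -> a <= b.
Proof.
move=> al0 a0 b0; apply: contraTT; rewrite -!ltNge => ba.
by apply: gt0_ltr_powR; rewrite ?nnegrE.
Qed.

(** The two functions vanish at [c0], the first is expanding, and their difference
    has a small Lipschitz constant; [p] and [q] are two points ordered by the
    values of [phi]. *)
Lemma powR_robust_near {R : realType} (al d m lo hi c0 p q : R) (phi psi : R -> R) :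
  0 < al < 1 -> 0 <= d -> d < 1 -> 0 < m ->
  lo <= c0 <= hi -> phi c0 = 0 -> psi c0 = 0 ->
  (forall x, lo <= x <= hi -> 0 <= phi x) ->
  (forall x, lo <= x <= hi -> 0 <= psi x) ->
  (forall x y, lo <= x <= hi -> lo <= y <= hi ->
     m * `|x - y| <= `|phi x - phi y|) ->
  (forall x y, lo <= x <= hi -> lo <= y <= hi ->
     `|(phi x - psi x) - (phi y - psi y)| <= d * m * `|x - y|) ->
  lo <= p <= hi -> lo <= q <= hi -> phi p <= phi q ->
  (1 - d) / (1 + d) * (phi q `^ al - phi p `^ al) <= psi q `^ al - psi p `^ al.
Proof.
move=> al01 d0 d1 m0 ci pc sc p0 s0 hm hd pi_ qi pq.
have H x y : lo <= x <= hi -> lo <= y <= hi -> phi x <= phi y ->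
    `|(phi y - psi y) - (phi x - psi x)| <= d * (phi y - phi x).
  move=> xi yi xy; apply: (le_trans (hd _ _ yi xi)).
  rewrite -mulrA ler_wpM2l//; apply: (le_trans (hm _ _ yi xi)).
  by rewrite ger0_norm// subr_ge0.
apply: powR_robust => //; [exact: p0|exact: s0| |].
- have cp : phi c0 <= phi p by rewrite pc p0.
  have := H _ _ ci pi_ cp; rewrite pc sc !subr0 ler_norml => /andP[]; lra.
- have := H _ _ pi_ qi pq; rewrite ler_norml => /andP[]; lra.
Qed.

Section lorenz_near.
Context {R : realType} {rho c alpha beta : R}.
Hypothesis hrho : 0 < rho < 1.
Hypothesis halpha : 0 < alpha < 1.
Hypothesis hbeta : 0 < beta < 1.
Local Notation L := (lorenz_map rho c alpha beta).
Implicit Types f g : L.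

(** The expansion of a map near [f] is almost that of [f], uniformly up to the
    singularity. *)
Lemma lorenz_near_slope f k : 0 <= k < 1 -> exists2 d, 0 < d & forall g,
  (lorenz_dist f g < d%:E)%E -> forall x y, 0 < x -> x <= y -> y < 1 ->
  y < c \/ c < x -> k * (f y - f x) <= g y - g x.
Proof.
move=> /andP[k0 k1]; have /andP[c0 c1] := lorenz_c01 f.
have /andP[al0 al1] := halpha; have /andP[be0 be1] := hbeta.
have [fc0 f0 [m0 m00 hm0] _ _] := lorenz_phi0_facts hrho f.
have [fc1 f1 [m1 m10 hm1] _ _] := lorenz_phi1_facts hrho f.
pose d := (1 - k) / 2.
have d0 : 0 < d by rewrite divr_gt0// subr_gt0.
have d1 : d < 1 by rewrite ltr_pdivrMr//; lra.
have dk : k <= (1 - d) / (1 + d).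
  by rewrite ler_pdivlMr ?addr_gt0// /d; nra.
exists (d * Num.min m0 m1); first by rewrite mulr_gt0// lt_min m00.
have mm0 : d * Num.min m0 m1 <= d * m0 by rewrite ler_pM2l// ge_min lexx.
have mm1 : d * Num.min m0 m1 <= d * m1 by rewrite ler_pM2l// ge_min lexx orbT.
move=> g /(lorenz_dist_lt hrho halpha hbeta)[_ _ _ _ [h0 h1]] x y x0 xy y1 side.
have [gc0 g0 _ _ _] := lorenz_phi0_facts hrho g.
have [gc1 g1 _ _ _] := lorenz_phi1_facts hrho g.
have [s s1 Hs] := lorenz_slope_gt1 f.
have fxy : 0 <= f y - f x.
  apply: le_trans (Hs _ _ (ltW x0) xy (ltW y1) side).
  by rewrite mulr_ge0 ?subr_ge0// (le_trans ler01)// ltW.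
apply: (@le_trans _ _ ((1 - d) / (1 + d) * (f y - f x))).
  by rewrite ler_wpM2r.
case: side => side.
  have xl : 0 <= x < c by rewrite (ltW x0) (le_lt_trans xy side).
  have yl : 0 <= y < c by rewrite (le_trans (ltW x0) xy) side.
  have xi : 0 <= x <= c by rewrite (ltW x0) (le_trans xy (ltW side)).
  have yi : 0 <= y <= c by rewrite (le_trans (ltW x0) xy) (ltW side).
  have E (h : L) : h y - h x = lorenz_phi0 h x `^ alpha - lorenz_phi0 h y `^ alpha.
    by rewrite !lorenz_fun_left//; lra.
  rewrite !E; rewrite E subr_ge0 in fxy.
  have ci : 0 <= c <= c by rewrite lexx ltW.
  apply: (powR_robust_near (lo := 0) (hi := c) halpha (ltW d0) d1 m00 ci) => //.
    by move=> z w zi wi; apply: (le_trans (h0 _ _ zi wi)); rewrite ler_wpM2r.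
  by apply: powR_le_inv al0 _ _ fxy; [exact: f0|exact: f0].
have xl : c < x <= 1 by rewrite side (le_trans xy (ltW y1)).
have yl : c < y <= 1 by rewrite (lt_le_trans side xy) (ltW y1).
have xi : c <= x <= 1 by rewrite (ltW side) (le_trans xy (ltW y1)).
have yi : c <= y <= 1 by rewrite (le_trans (ltW side) xy) (ltW y1).
have E (h : L) : h y - h x = lorenz_phi1 h y `^ beta - lorenz_phi1 h x `^ beta.
  by rewrite !lorenz_fun_right//; lra.
rewrite !E; rewrite E subr_ge0 in fxy.
have ci : c <= c <= 1 by rewrite lexx ltW.
apply: (powR_robust_near (lo := c) (hi := 1) hbeta (ltW d0) d1 m10 ci) => //.
  by move=> z w zi wi; apply: (le_trans (h1 _ _ zi wi)); rewrite ler_wpM2r.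
by apply: powR_le_inv be0 _ _ fxy; [exact: f1|exact: f1].
Qed.

Lemma lorenz_iter_itv f x k : 0 < x < 1 ->
  (forall j, (j < k)%N -> iter j f x != c) -> 0 < iter k f x < 1.
Proof.
move=> x01; elim: k => [//|k IH] xc; rewrite iterS.
apply: lorenz_gt0_lt1; last exact: xc.
by apply: IH => j jk; apply: xc; exact: ltnW.
Qed.

(** An orbit segment that meets [c] at most at its end depends continuously on the
    map and on the initial point. *)
Lemma lorenz_orbit_near f x k : 0 < x < 1 ->
  (forall j, (j < k)%N -> iter j f x != c) -> forall e, 0 < e ->
  exists2 d, 0 < d & forall g y, (lorenz_dist f g < d%:E)%E -> `|y - x| < d ->
    forall j, (j <= k)%N -> `|iter j g y - iter j f x| < e.
Proof.
move=> x01; elim: k => [|k IH] xc e e0.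
  by exists e => // g y _ yx j; rewrite leqn0 => /eqP ->.
have xc' j : (j < k)%N -> iter j f x != c by move=> jk; apply: xc; exact: ltnW.
have z01 := lorenz_iter_itv x01 xc'.
set z := iter k f x in z01; have zc : z != c by exact: xc.
have e2 : 0 < e / 2 by rewrite divr_gt0.
have N : \forall w \near z, [/\ `|f z - f w| < e / 2, 0 < w < 1 & w != c].
  have zc' : nbhs z (~` [set c]).
    by apply: open_nbhs_nbhs; split; [exact/closed_openC/closed_eq|exact/eqP].
  have z01' : z \in `]0, 1[ by rewrite in_itv.
  have /cvgrPdist_lt Hc : f w @[w --> z] --> f z by exact: lorenz_continuous.
  have H := Hc _ e2.
  apply: filterS3 H (near_in_itvoo z01') zc' => w H; rewrite in_itv => w01 wc.
  by split => //; exact/eqP.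
have [d1 /= d10 H1] := N.
have [d2 d20 H2] := lorenz_near_C0 hrho halpha hbeta f (divr_gt0 e2 (ltr0n _ 2)).
have m0 : 0 < Num.min d1 e by rewrite lt_min d10.
have [d3 d30 H3] := IH xc' _ m0.
exists (Num.min d2 d3); first by rewrite lt_min d20.
move=> g y gd; rewrite lt_min => /andP[yd2 yd3].
have gd2 : (lorenz_dist f g < d2%:E)%E.
  by apply: (lt_le_trans gd); rewrite lee_fin ge_min lexx.
have gd3 : (lorenz_dist f g < d3%:E)%E.
  by apply: (lt_le_trans gd); rewrite lee_fin ge_min lexx orbT.
have {}H3 := H3 _ _ gd3 yd3.
move=> j; rewrite leq_eqVlt ltnS => /orP[/eqP->|jk]; last first.
  by have := H3 _ jk; rewrite lt_min => /andP[].
have := H3 _ (leqnn k); rewrite lt_min -/z => /andP[wd1 _].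
rewrite !iterS -/z; set w := iter k g y in wd1 *.
have [Hfw w01 wc] : [/\ `|f z - f w| < e / 2, 0 < w < 1 & w != c].
  by apply: H1; rewrite /= distrC.
have [_ /(_ _ w01 wc) H] := H2 _ gd2.
rewrite (_ : g w - f z = - (f w - g w) - (f z - f w)); last by lra.
by rewrite (le_lt_trans (ler_normB _ _))// normrN; lra.
Qed.

End lorenz_near.

(** * Scaling the left branch *)

Section derivable_in_of.
Context {R : realType}.
Implicit Types (D : set R) (u v : R -> R).

Lemma derivable_in_of D u (z l : R) : ProperFilter (within D z^') ->
  (forall e, 0 < e -> exists2 d, 0 < d & forall w, D w -> w != z ->
    `|w - z| < d -> `|l - (u w - u z) / (w - z)| <= e) ->
  derivable_in D u z /\ derive_in D u z = l.
Proof.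
move=> PF H.
have C : (u y - u z) / (y - z) @[y --> within D z^'] --> l.
  apply/cvgrPdist_le => e e0; have [d d0 Hd] := H _ e0.
  by exists d => // w /= wz wnz Dw; apply: Hd => //; rewrite distrC.
by split; [apply/cvg_ex; exists l|exact: cvg_lim].
Qed.

Lemma derive_in_near_scale D u v (k r z : R) : ProperFilter (within D z^') ->
  0 < r -> u z = k * v z ->
  (forall w, D w -> `|w - z| < r -> u w = k * v w) -> derivable_in D v z ->
  derivable_in D u z /\ derive_in D u z = k * derive_in D v z.
Proof.
move=> PF r0 uz uw dv; apply: derivable_in_of => e e0.
have k0 : 0 < `|k| + 1 by rewrite ltr_wpDl.
have [d d0 H] := derivable_inP dv (divr_gt0 e0 k0).
exists (Num.min d r); first by rewrite lt_min d0.
move=> w Dw wz; rewrite lt_min => /andP[wd wr].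
rewrite uz uw// -mulrBr -mulrA -mulrBr normrM.
have := H _ Dw wz wd; rewrite ler_pdivlMr// => He; apply: le_trans He.
by rewrite mulrDr mulr1 mulrC lerDl.
Qed.

Lemma within_lorenz_dom_proper (c x : R) : lorenz_dom c x ->
  ProperFilter (within (lorenz_dom c) x^').
Proof.
move=> [x01 xc]; have PF := within_itv_dnbhs_proper (@ltr01 R) x01.
split; last exact: within_filter.
move=> H; apply: (@filter_not_empty _ _ PF).
have xc' : nbhs x (~` [set c]).
  by apply: open_nbhs_nbhs; split => //; exact/closed_openC/closed_eq.
have {xc'} : x^' (~` [set c]) by exact: nbhs_dnbhs.
have {}H : x^' [set w | lorenz_dom c w -> False] := H.
move=> xc'; change (x^' [set w | `[0, 1]%classic w -> False]).
by apply: filterS2 H xc' => w Hw wc w01; apply: Hw.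
Qed.

Lemma C1holder_scale (rho a b k : R) u : a < b -> C1holder rho `[a, b] u ->
  C1holder rho `[a, b] (fun x => k * u x) /\
  forall x, `[a, b]%classic x ->
    derive_in `[a, b] (fun x => k * u x) x = k * derive_in `[a, b] u x.
Proof.
move=> ab [du [K HK]].
have S x : `[a, b]%classic x -> derivable_in `[a, b] (fun x => k * u x) x /\
    derive_in `[a, b] (fun x => k * u x) x = k * derive_in `[a, b] u x.
  move=> xab; apply: (derive_in_near_scale (r := 1)) => //.
    exact: within_itv_dnbhs_proper.
  exact: du.
split; last by move=> x /S[].
split; first by move=> x /S[].
exists (`|k| * K) => x y xab yab; have [_ ->] := S _ xab; have [_ ->] := S _ yab.
by rewrite -mulrBr normrM -mulrA ler_wpM2l// HK.
Qed.

Lemma C1holder_precomp_scale (rho B t : R) v : 0 < rho -> 0 < B -> 0 < t ->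
  C1holder rho `[0, B] v -> C1holder rho `[0, t * B] (fun x => v (x / t)).
Proof.
move=> rho0 B0 t0 [dv [K HK]].
have tB0 : 0 < t * B by rewrite mulr_gt0.
have I x : `[0, t * B]%classic x -> `[0, B]%classic (x / t).
  rewrite /= !in_itv/= => /andP[x0 xB].
  by rewrite divr_ge0 ?(ltW t0)//= ler_pdivrMr// mulrC.
have S x : `[0, t * B]%classic x ->
    derivable_in `[0, t * B] (fun x => v (x / t)) x /\
    derive_in `[0, t * B] (fun x => v (x / t)) x = t^-1 * derive_in `[0, B] v (x / t).
  move=> xI; apply: derivable_in_of; first exact: within_itv_dnbhs_proper.
  move=> e e0; have [d d0 H] := derivable_inP (dv _ (I _ xI)) (mulr_gt0 t0 e0).
  exists (t * d); first by rewrite mulr_gt0.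
  move=> w wI wx wd; have tn : t != 0 by rewrite gt_eqF.
  have wx0 : w - x != 0 by rewrite subr_eq0.
  have E : (v (w / t) - v (x / t)) / (w - x) =
      t^-1 * ((v (w / t) - v (x / t)) / (w / t - x / t)).
    by field; rewrite wx0 tn.
  rewrite E -mulrBr normrM ger0_norm ?invr_ge0 ?(ltW t0)// ler_pdivrMl//.
  apply: H; first exact: I.
  - by rewrite -subr_eq0 -mulrBl mulf_neq0// invr_eq0.
  - by rewrite -mulrBl normrM (ger0_norm (x := t^-1)) ?invr_ge0 ?(ltW t0)//
      ltr_pdivrMr// mulrC.
split; first by move=> x /S[].
exists (t^-1 * (K * (t^-1) `^ rho)) => x y xI yI.
have [_ ->] := S _ xI; have [_ ->] := S _ yI.
rewrite -mulrBr normrM ger0_norm ?invr_ge0 ?(ltW t0)// -mulrA.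
rewrite ler_wpM2l ?invr_ge0 ?(ltW t0)//; apply: (le_trans (HK _ _ (I _ xI) (I _ yI))).
rewrite -mulrBl normrM (ger0_norm (x := t^-1)) ?invr_ge0 ?(ltW t0)//.
by rewrite powRM ?invr_ge0 ?(ltW t0)// (mulrC (_ `^ _)) mulrA.
Qed.

Lemma C1holder_norm_scale_le (rho a b : R) u : 0 < rho -> a < b ->
  C1holder rho `[a, b] u -> exists2 N, 0 < N & forall k, 0 <= k ->
    (C1holder_norm rho `[a, b] (fun x => (k * u x)%R) <= (k * N)%:E)%E.
Proof.
move=> rho0 ab Cu; have [M1 M10 H1] := C1holder_lipschitz rho0 Cu.
have [M2 M20 H2] := C1holder_derive_bounded rho0 Cu.
have [du [K HK]] := Cu.
have aab : a <= a <= b by rewrite lexx ltW.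
exists ((`|u a| + M1 * (b - a)) + M2 + `|K|).
  have : 0 <= M1 * (b - a) by rewrite mulr_ge0 ?subr_ge0 ?(ltW M10) ?(ltW ab).
  by have := normr_ge0 (u a); have := normr_ge0 K; lra.
move=> k k0; have [_ S] := C1holder_scale k ab Cu.
rewrite /C1holder_norm (mulrDr k (_ + M2)) (mulrDr k _ M2) 2!EFinD.
apply: leeD; [apply: leeD|].
- apply: ge_ereal_sup => _ [x xI <-]; rewrite lee_fin normrM ger0_norm//.
  rewrite ler_wpM2l//; move: xI; rewrite /= in_itv/= => xI.
  have := H1 _ _ xI aab; have /andP[ax xb] := xI.
  rewrite (ger0_norm (x := x - a)) ?subr_ge0//.
  have := ler_normD (u x - u a) (u a); rewrite subrK.
  have : M1 * (x - a) <= M1 * (b - a) by rewrite ler_wpM2l ?(ltW M10)// lerD2r.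
  lra.
- apply: ge_ereal_sup => _ [x xI <-]; rewrite lee_fin S// normrM ger0_norm//.
  by rewrite ler_wpM2l// H2//; move: xI; rewrite /= in_itv.
- apply: ge_ereal_sup => _ [[x y] /= [xI yI xy] <-].
  rewrite lee_fin !S// -mulrBr normrM ger0_norm// -mulrA ler_wpM2l//.
  have xy0 : 0 < `|x - y| `^ rho by rewrite powR_gt0// normr_gt0 subr_eq0.
  rewrite ler_pdivrMr//; apply: (le_trans (HK _ _ xI yI)).
  by rewrite ler_wpM2r ?powR_ge0// ler_norm.
Qed.

End derivable_in_of.

Section lorenz_perturbation.
Context {R : realType} {rho c alpha beta : R}.
Hypothesis hrho : 0 < rho < 1.
Hypothesis halpha : 0 < alpha < 1.
Hypothesis hbeta : 0 < beta < 1.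
Local Notation L := (lorenz_map rho c alpha beta).
Implicit Types f g : L.

(** The left branch is multiplied by [t]. *)
Let scl (f : R -> R) (t x : R) := if x < c then t * f x else f x.

Let scl_derive f t x : lorenz_dom c x ->
  derivable_in (lorenz_dom c) (scl f t) x /\
  derive_in (lorenz_dom c) (scl f t) x =
    (if x < c then t else 1) * derive_in (lorenz_dom c) f x.
Proof.
move=> xD; have PF := within_lorenz_dom_proper xD.
have df := lorenz_derivable xD (f := f).
have xc : x != c by apply/eqP => E; case: xD => _; apply.
have r0 : 0 < `|x - c| by rewrite normr_gt0 subr_eq0.
apply: (derive_in_near_scale (r := `|x - c|)) => //.
  by rewrite /scl; case: ifP => // _; rewrite mul1r.
move=> w _; rewrite /scl; case: (ltgtP x c) xc => // xc _ wx.
  have -> // : w < c.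
  by move: wx; rewrite (ltr0_norm (x := x - c)) ?subr_lt0// ltr_norml; lra.
rewrite mul1r (_ : w < c = false)//; apply/negbTE; rewrite -leNgt.
by move: wx; rewrite (gtr0_norm (x := x - c)) ?subr_gt0// ltr_norml; lra.
Qed.

Let expanding_scl f (t s : R) : 0 < t <= 1 -> 1 < t * s ->
  (forall x, lorenz_dom c x -> s <= derive_in (lorenz_dom c) f x) ->
  expanding_lorenz rho c (scl f t).
Proof.
move=> /andP[t0 t1] ts Hs.
have [c01 [f01 [_ fh]] [f0 f1] _ [fl fr]] := lorenz_expanding f.
have /andP[c0 c1] := c01.
have s0 : 0 < s by rewrite -(pmulr_rgt0 _ t0); lra.
have sg x : (if x < c then t else 1) <= 1 :> R by case: ifP.
have sg0 x : 0 < (if x < c then t else 1) :> R by case: ifP.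
have tsg x : t <= (if x < c then t else 1) by case: ifP.
split => //.
- split.
    move=> x xD; have := f01 _ xD; rewrite /= !in_itv/= /scl.
    case: ifP => // _ /andP[a b]; rewrite mulr_ge0 ?(ltW t0)//=.
    by rewrite (le_trans _ b)// ler_piMl.
  split; first by move=> x /(scl_derive f t)[].
  move=> z zD; have [K [U [Uz HU]]] := fh z zD.
  have zc : z != c by apply/eqP => E; case: zD => _; apply.
  have r0 : 0 < `|z - c| by rewrite normr_gt0 subr_eq0.
  pose V := [set w | `|z - w| < `|z - c|].
  have Vz : nbhs z V by exists `|z - c|.
  exists `|K|, (U `&` V); split; first exact: filterI.
  have side w : V w -> (w < c) = (z < c).
    rewrite /V/=; case: (ltgtP z c) zc => // zc _.
      by rewrite (ltr0_norm (x := z - c)) ?subr_lt0// ltr_norml => H; lra.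
    rewrite (gtr0_norm (x := z - c)) ?subr_gt0// ltr_norml => H.
    by apply/negbTE; rewrite -leNgt; lra.
  move=> x y [[Ux Vx] Dx] [[Uy Vy] Dy].
  have [_ ->] := scl_derive f t Dx; have [_ ->] := scl_derive f t Dy.
  rewrite !side// -mulrBr normrM gtr0_norm//.
  have H := HU x y (conj Ux Dx) (conj Uy Dy).
  apply: (@le_trans _ _ `|derive_in (lorenz_dom c) f x - derive_in (lorenz_dom c) f y|).
    by rewrite ler_piMl.
  apply: (le_trans H); by rewrite ler_wpM2r ?powR_ge0// ler_norm.
- by rewrite /scl c0 (ltNge 1) (ltW c1)/= f0 mulr0.
- exists (t * s) => // x xD; have [_ ->] := scl_derive f t xD.
  have H := Hs _ xD; have H' := tsg x.
  by apply: ler_pM => //; exact: ltW.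
- split; apply/cvgryPge => A.
    have /cvgryPge/(_ (A / t)) := fl; apply: filter_app.
    exists c => //; move=> x /= xc xlt; rewrite ger0_norm ?subr_ge0 ?(ltW xlt)// in xc.
    have xD : lorenz_dom c x.
      split; first by rewrite /= in_itv/=; apply/andP; split; lra.
      by move=> /= E; rewrite E ltxx in xlt.
    have [_ ->] := scl_derive f t xD; rewrite xlt.
    by rewrite ler_pdivrMr// mulrC.
  have /cvgryPge/(_ A) := fr; apply: filter_app.
  exists (1 - c); first by rewrite /= subr_gt0.
  move=> x /= xc xlt; rewrite ltr0_norm ?subr_lt0// in xc.
  have xD : lorenz_dom c x.
    split; first by rewrite /= in_itv/=; apply/andP; split; lra.
    by move=> /= E; rewrite E ltxx in xlt.
  by have [_ ->] := scl_derive f t xD; rewrite ltNge (ltW xlt)/= mul1r.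
Qed.

(** The perturbed map has [tau phi0] in place of [phi0], whence the factor
    [tau^alpha]. The condition [tau > 1/s], where [s] bounds the derivative of [f]
    from below, keeps the map expanding, since [tau <= tau^alpha]. *)
Lemma lorenz_scale f : exists N tau0, [/\ 0 < N, 0 < tau0 < 1 &
  forall tau, tau0 < tau < 1 -> exists g : L,
  [/\ (forall x, g x = if x < c then tau `^ alpha * f x else f x),
      lorenz_d0 g = tau `^ alpha * lorenz_d0 f &
      (lorenz_dist f g <= ((1 - tau) * N)%:E)%E]].
Proof.
have /andP[c0 c1] := lorenz_c01 f; have /andP[rho0 rho1] := hrho.
have /andP[al0 al1] := halpha.
have [_ _ _ [s s1 Hs] _] := lorenz_expanding f.
have s0 : 0 < s by lra.
have [Cu0 [v0 [Cv0 [u0B v0A vu0 uv0]]]] := lorenz_diffeo0 f.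
have [N N0 HN] := C1holder_norm_scale_le rho0 c0 Cu0.
have /andP[d00 d01] := lorenz_d0_gt0 f.
exists (1 + N), s^-1; split; first by rewrite addr_gt0.
  by rewrite invr_gt0 s0 invf_lt1.
move=> tau /andP[stau tau1].
have tau0 : 0 < tau by apply: lt_trans stau; rewrite invr_gt0.
set t := tau `^ alpha.
have t0 : 0 < t by exact: powR_gt0.
have taut : tau <= t by apply: ger1_powR; [rewrite tau0 ltW|exact: ltW].
have t1 : t <= 1.
  have {1}<- : 1 `^ alpha = 1 :> R by rewrite powR1.
  by apply: ge0_ler_powR; rewrite ?nnegrE ?(ltW al0) ?(ltW tau0) ?(ltW tau1).
have ts : 1 < t * s.
  have : s^-1 * s < tau * s by rewrite ltr_pM2r.
  rewrite mulVf ?gt_eqF// => /lt_le_trans; apply.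
  by rewrite ler_wpM2r// ltW.
have t01 : 0 < t <= 1 by rewrite t0.
have tK : t `^ alpha^-1 = tau.
  by rewrite -powRrM mulfV ?gt_eqF// powRr1// ltW.
have Bt : (t * lorenz_d0 f) `^ alpha^-1 = tau * lorenz_d0 f `^ alpha^-1.
  by rewrite powRM ?(ltW t0) ?(ltW d00)// tK.
have B0 : 0 < lorenz_d0 f `^ alpha^-1 by rewrite powR_gt0.
have d0itv : 0 <= t * lorenz_d0 f <= 1.
  by rewrite mulr_ge0 ?(ltW t0) ?(ltW d00)//= mulr_ile1 ?(ltW t0) ?(ltW d00).
have dif0 : C1holder_diffeo rho `[0, c] `[0, (t * lorenz_d0 f) `^ alpha^-1]
    (fun x => tau * lorenz_phi0 f x).
  rewrite Bt; split; first by have [] := C1holder_scale tau c0 Cu0.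
  exists (fun x => v0 (x / tau)); split; first exact: C1holder_precomp_scale.
  have I y : `[0, tau * lorenz_d0 f `^ alpha^-1]%classic y ->
      `[0, lorenz_d0 f `^ alpha^-1]%classic (y / tau).
    rewrite /= !in_itv/= => /andP[a b].
    by rewrite divr_ge0 ?(ltW tau0)//= ler_pdivrMr// mulrC.
  split.
  - move=> x /u0B; rewrite /= !in_itv/= => /andP[a b].
    by rewrite mulr_ge0 ?(ltW tau0)//= ler_pM2l.
  - by move=> y /I /v0A.
  - by move=> x xA; rewrite mulrC mulKf ?vu0// gt_eqF.
  - by move=> y /I /uv0 ->; rewrite mulrC mulfVK// gt_eqF.
have pc : tau * lorenz_phi0 f c = 0 /\ lorenz_phi1 f c = 0.
  by have [-> ->] := lorenz_phi_c f; rewrite mulr0.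
have pe : tau * lorenz_phi0 f 0 = (t * lorenz_d0 f) `^ alpha^-1 /\
    lorenz_phi1 f 1 = lorenz_d1 f `^ beta^-1.
  by have [-> ->] := lorenz_phi_end f; rewrite Bt.
have [_ p0 _ _ _] := lorenz_phi0_facts hrho f.
have fl x : 0 <= x < c ->
    scl f t x = t * lorenz_d0 f - (tau * lorenz_phi0 f x) `^ alpha.
  move=> /andP[x0 xc]; rewrite /scl xc lorenz_fun_left ?x0//.
  by rewrite powRM ?(ltW tau0) ?p0 ?x0 ?(ltW xc)// mulrBr.
have fr x : c < x <= 1 ->
    scl f t x = 1 - lorenz_d1 f + lorenz_phi1 f x `^ beta.
  by move=> /[dup] xc /andP[/ltW]; rewrite /scl leNgt => /negbTE -> _; rewrite lorenz_fun_right.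
pose g := LorenzMap (expanding_scl t01 ts Hs) d0itv (lorenz_d1_itv f) dif0
  (lorenz_diffeo1 f) pc pe fl fr.
exists g; split => //.
rewrite /lorenz_dist !(lorenz_left_value hrho halpha) !(lorenz_right_value hrho hbeta) /=.
rewrite subrr normr0 adde0.
have -> : lorenz_phi1 f \- lorenz_phi1 f = cst 0.
  by apply/funext => x /=; rewrite subrr.
rewrite C1holder_norm0// adde0.
have -> : lorenz_phi0 f \- (fun x => tau * lorenz_phi0 f x) =
    (fun x => (1 - tau) * lorenz_phi0 f x).
  by apply/funext => x /=; rewrite mulrBl mul1r.
rewrite mulrDr mulr1 EFinD; apply: leeD; last by apply: HN; lra.
rewrite lee_fin (_ : _ - _ = (1 - t) * lorenz_d0 f); last by lra.
rewrite normrM !ger0_norm ?subr_ge0 ?(ltW d00)//.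
by nra.
Qed.

End lorenz_perturbation.

(** * Preperiodic points near the singularity *)

Lemma iter_period {T : Type} (f : T -> T) n p m : iter n f p = p ->
  iter (m * n) f p = p.
Proof. by move=> fp; elim: m => // m IH; rewrite mulSn iterD IH. Qed.

Lemma iter_period_avoid {T : eqType} (f : T -> T) (c : T) n p : (0 < n)%N ->
  iter n f p = p -> (forall j, (j < n)%N -> iter j f p != c) ->
  forall j, iter j f p != c.
Proof.
move=> n0 fp pc j; rewrite (divn_eq j n) addnC iterD iter_period//.
by apply: pc; rewrite ltn_mod.
Qed.

Section phase.
Context {R : realType} (c r lam : R) (f : R -> R).
Hypothesis lam1 : 1 < lam.
Hypothesis r0 : 0 < r.
Hypothesis cr0 : 0 <= c - r.
Hypothesis cr1 : c + r <= 1.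
Hypothesis f_itv : forall x, 0 < x < 1 -> x != c -> 0 < f x < 1.
Hypothesis f_exp : expanding c 0 1 lam f.
Hypothesis f_exp8 : expanding c (c - r) (c + r) 8 f.
Hypothesis f_cont : forall x, 0 < x < 1 -> x != c -> f y @[y --> x] --> f x.

Lemma phase_family a b : 0 < a -> a < b -> b < 1 ->
  expanding_family c r lam a b (fun=> f) id.
Proof.
move=> a0 ab b1; split => //.
- by move=> _ x _; exact: f_itv.
- move=> t x _ x01 xc /=.
  have C := f_cont x01 xc; apply: cvg_comp C; exact: cvg_snd.
- by move=> t /andP[? ?]; apply/andP; split; lra.
- by apply: continuous_subspaceT => x; exact: cvg_id.
Qed.

(** [f^n] avoids [c] up to time [n] on the interval from [a] to [b], and maps it
    onto the interval from [A] to [B]. *)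
Definition covers n a b A B := [/\ a < b,
  (forall j t, (j < n)%N -> a <= t <= b -> iter j f t != c),
  iter n f a = A & iter n f b = B].

Let covers_branch n a b A B : 0 < a -> b < 1 -> covers n a b A B ->
  increasing_branch (fun=> f) id n a b.
Proof.
move=> a0 b1 [ab F _ _].
by apply: (family_branch (phase_family a0 ab b1)) => //; exact: ltW.
Qed.

Let covers_preimage n a b A B v : 0 < a -> b < 1 -> covers n a b A B ->
  A <= v <= B -> exists2 q, a <= q <= b & iter n f q = v.
Proof.
move=> a0 b1 C /andP[Av vB]; have G := covers_branch a0 b1 C.
have [ab _ EA EB] := C; have AB := le_trans Av vB.
have [|d dab dv] := @IVT R (iter n f) a b v (ltW ab) (branch_cont G).
  by rewrite EA EB (min_idPl AB) (max_idPr AB) Av.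
by exists d => //; move: dab; rewrite in_itv.
Qed.

Let covers_comp n m a b A B a' b' A' B' : 0 < a -> b < 1 ->
  covers n a b A B -> covers m a' b' A' B' -> A <= a' -> b' <= B ->
  exists a2 b2, [/\ a <= a2, b2 <= b & covers (n + m) a2 b2 A' B'].
Proof.
move=> a0 b1 C C' Aa bB; have G := covers_branch a0 b1 C.
have [ab F EA EB] := C; have [ab' F' EA' EB'] := C'.
have [|a2 /andP[aa2 a2b] E2] := covers_preimage (v := a') a0 b1 C.
  by apply/andP; split; lra.
have [|b2 /andP[ab2 b2b] E3] := covers_preimage (v := b') a0 b1 C.
  by apply/andP; split; lra.
have ab2' : a2 < b2.
  have [//|ba] := ltP a2 b2; exfalso.
  have : iter n f b2 <= iter n f a2.
    move: ba; rewrite le_eqVlt => /orP[/eqP->//|ba].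
    by apply/ltW/(branch_mono G).
  lra.
have M s t : a <= s -> s <= t -> t <= b -> iter n f s <= iter n f t.
  move=> as_; rewrite le_eqVlt => /orP[/eqP->//|st] tb.
  by apply/ltW/(branch_mono G).
exists a2, b2; split => //; split => //.
- move=> j t jnm /andP[ta tb]; have [jn|nj] := ltnP j n.
    by apply: F => //; apply/andP; split; lra.
  rewrite -(subnK nj) iterD; apply: F'; first by rewrite ltn_subLR.
  by rewrite -E2 -E3; apply/andP; split; apply: M => //; lra.
- by rewrite addnC iterD E2.
- by rewrite addnC iterD E3.
Qed.

Let covers_fixed n a b A B : 0 < a -> b < 1 -> covers n a b A B ->
  A < a -> b < B -> exists p, [/\ a <= p <= b, (0 < n)%N, iter n f p = p &
    forall j, iter j f p != c].
Proof.
move=> a0 b1 C Aa bB; have G := covers_branch a0 b1 C.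
have [ab F EA EB] := C.
have n0 : (0 < n)%N by case: n EA {C G F EB} => // /= E; move: Aa; rewrite -E ltxx.
have Cg : {within `[a, b], continuous (fun t => iter n f t - t)}.
  move=> x; apply: cvgB; first exact: (branch_cont G).
  by apply: continuous_subspaceT => y; exact: cvg_id.
have [|p pab Ep] := @IVT R (fun t => iter n f t - t) a b 0 (ltW ab) Cg.
  rewrite EA EB ge_min le_max; apply/andP; split; apply/orP; [left|right]; lra.
exists p; have pab' : a <= p <= b by move: pab; rewrite in_itv.
have fp : iter n f p = p by apply/eqP; rewrite -subr_eq0 Ep.
by split => //; apply: (iter_period_avoid n0 fp) => j jn; exact: F.
Qed.

(** Two periodic points with the common period [K], indexed by the side of [c]
    ([false] for left, [true] for right), possibly equal; [q i] is a point on the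
    side [i] that is mapped to [p i] in [k i] steps. A small interval on the left
    of [c] covers a larger interval on the left or on the right of [c], and
    likewise on the right. A loop from one side to itself contains a periodic
    point, and if there is a single loop the other side is mapped onto it. *)
Lemma preperiodic_near : exists K (p q : bool -> R) (k : bool -> nat),
  [/\ (0 < K)%N,
   forall i, [/\ 0 < p i < 1, iter K f (p i) = p i &
                 forall j, iter j f (p i) != c],
   c - r < q false < c, c < q true < c + r &
   forall i, (forall j, (j < k i)%N -> iter j f (q i) != c) /\
             iter (k i) f (q i) = p i].
Proof.
have [r0' cr0' cr1'] := And3 r0 cr0 cr1.
set u1 := c - 4 / 5 * r; set l1 := c - 3 / 5 * r.
set l2 := c - 2 / 5 * r; set u2 := c - 1 / 5 * r.
set w1 := c + 1 / 5 * r; set m1 := c + 2 / 5 * r.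
set m2 := c + 3 / 5 * r; set w2 := c + 4 / 5 * r.
have P a b : 0 < a -> a < b -> b < 1 -> exists n a' b', [/\ a <= a', b' <= b &
    covers n a' b' u1 u2 \/ covers n a' b' w1 w2].
  move=> a0 ab b1; have [||||||n [a' [b' [aa ab' bb F E]]]] :=
    family_sweeps (phase_family a0 ab b1) (u1 := u1) (u2 := u2) (w1 := w1) (w2 := w2).
  1-6: by rewrite /u1 /u2 /w1 /w2; lra.
  exists n, a', b'; split => //.
  by case: E => [[E1 E2]|[E1 E2]]; [left|right]; split.
have [|||nL [aL [bL [lL Ll HL]]]] := P l1 l2.
1-3: by rewrite /l1 /l2; lra.
have [|||nR [aR [bR [mR Rm HR]]]] := P m1 m2.
1-3: by rewrite /m1 /m2; lra.
have aL0 : 0 < aL by rewrite /l1 in lL; lra.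
have bL1 : bL < 1 by rewrite /l2 in Ll; lra.
have aR0 : 0 < aR by rewrite /m1 in mR; lra.
have bR1 : bR < 1 by rewrite /m2 in Rm; lra.
have build nK p q1 q2 k1 k2 : (0 < nK)%N -> l1 <= q1 <= l2 -> m1 <= q2 <= m2 ->
   0 < p < 1 -> iter nK f p = p -> (forall j, iter j f p != c) ->
   (forall j, (j < k1)%N -> iter j f q1 != c) -> iter k1 f q1 = p ->
   (forall j, (j < k2)%N -> iter j f q2 != c) -> iter k2 f q2 = p ->
   exists K (p q : bool -> R) (k : bool -> nat),
    [/\ (0 < K)%N, forall i, [/\ 0 < p i < 1, iter K f (p i) = p i &
                 forall j, iter j f (p i) != c],
     c - r < q false < c, c < q true < c + r &
     forall i, (forall j, (j < k i)%N -> iter j f (q i) != c) /\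
             iter (k i) f (q i) = p i].
  move=> nK0 /andP[q11 q12] /andP[q21 q22] p01 fp pc q1c q1p q2c q2p.
  exists nK, (fun=> p), (fun i => if i then q2 else q1),
    (fun i => if i then k2 else k1); split => //.
  - by move: q11 q12; rewrite /l1 /l2 => *; apply/andP; split; lra.
  - by move: q21 q22; rewrite /m1 /m2 => *; apply/andP; split; lra.
  - by case.
have itv x : l1 <= x <= l2 \/ m1 <= x <= m2 -> 0 < x < 1.
  by rewrite /l1 /l2 /m1 /m2 => -[] /andP[? ?]; apply/andP; split; lra.
have uL x : l1 <= x <= l2 -> u1 <= x <= u2.
  by rewrite /l1 /l2 /u1 /u2 => /andP[? ?]; apply/andP; split; lra.
have wR x : m1 <= x <= m2 -> w1 <= x <= w2.
  by rewrite /m1 /m2 /w1 /w2 => /andP[? ?]; apply/andP; split; lra.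
have sub (a b a' b' x : R) : a <= a' -> b' <= b -> a' <= x <= b' -> a <= x <= b.
  by move=> ? ? /andP[? ?]; apply/andP; split; lra.
have u1a : u1 < aL by move: lL; rewrite /u1 /l1; lra.
have u2b : bL < u2 by move: Ll; rewrite /u2 /l2; lra.
have w1a : w1 < aR by move: mR; rewrite /w1 /m1; lra.
have w2b : bR < w2 by move: Rm; rewrite /w2 /m2; lra.
have RL p : l1 <= p <= l2 -> covers nR aR bR u1 u2 ->
    exists2 q, m1 <= q <= m2 & (forall j, (j < nR)%N -> iter j f q != c) /\
      iter nR f q = p.
  move=> pl C; have [q qab fq] := covers_preimage aR0 bR1 C (uL _ pl).
  exists q; first exact: sub qab.
  by split => // j jn; case: C => _ F _ _; exact: F.
case: HL => HL.
  have [p [pab n0 fp pc]] := covers_fixed aL0 bL1 HL u1a u2b.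
  have pl := sub _ _ _ _ _ lL Ll pab.
  case: HR => HR.
    have [q ql [qc fq]] := RL _ pl HR.
    by apply: (build nL p p q 0%N nR) => //; apply: itv; left.
  have [p' [pab' n0' fp' pc']] := covers_fixed aR0 bR1 HR w1a w2b.
  have pl' := sub _ _ _ _ _ mR Rm pab'.
  exists (nL * nR)%N, (fun i => if i then p' else p),
    (fun i => if i then p' else p), (fun=> 0%N); split => //.
  - by rewrite muln_gt0 n0.
  - case; split => //; rewrite ?itv//; try by [left|right].
      exact: iter_period.
    by rewrite mulnC; exact: iter_period.
  - by move: pl; rewrite /l1 /l2 => /andP[? ?]; apply/andP; split; lra.
  - by move: pl'; rewrite /m1 /m2 => /andP[? ?]; apply/andP; split; lra.
case: HR => HR; last first.
  have [p [pab n0 fp pc]] := covers_fixed aR0 bR1 HR w1a w2b.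
  have pl := sub _ _ _ _ _ mR Rm pab.
  have [q qab fq] := covers_preimage aL0 bL1 HL (wR _ pl).
  have ql := sub _ _ _ _ _ lL Ll qab.
  apply: (build nR p q p nL 0%N) => //; first by apply: itv; right.
  by move=> j jn; case: HL => _ F _ _; exact: F.
(* Left covers right and right covers left: the composition is a loop. *)
have [a2 [b2 [aa2 bb2 C2]]] := covers_comp aL0 bL1 HL HR (ltW w1a) (ltW w2b).
have a20 : 0 < a2 by lra.
have b21 : b2 < 1 by lra.
have u1a2 : u1 < a2 by lra.
have u2b2 : b2 < u2 by lra.
have [p [pab n0 fp pc]] := covers_fixed a20 b21 C2 u1a2 u2b2.
have pl := sub _ _ _ _ _ lL Ll (sub _ _ _ _ _ aa2 bb2 pab).
have [q ql [qc fq]] := RL _ pl HR.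
by apply: (build _ p p q 0%N nR n0) => //; apply: itv; left.
Qed.

End phase.

(** * Residual sets, minima and bump functions *)

(** Every point has a neighbourhood on which, for a common index [i], the property
    [G i] holds and all the open sets [U i k] are dense; as [i] ranges over a
    countable type, the generic point satisfies [G i] and all the [U i k] for some
    [i]. *)
Lemma residual_countable_local {T : topologicalType} {J : countType} (G : J -> set T)
    (U : J -> nat -> set T) :
  (forall i k, open (U i k)) ->
  (forall x : T, exists i W, [/\ nbhs x W, W `<=` G i &
     forall k, W `<=` closure (U i k)]) ->
  residual [set x : T | exists i, G i x /\ forall k, U i k x].
Proof.
move=> oU H.
pose W i := interior (G i `&` \bigcap_k closure (U i k)).
pose B (ik : J * nat) := U ik.1 ik.2 `|` ~` closure (W ik.1).
have oB ik : open (B ik).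
  apply: openU; first exact: oU.
  by apply/closed_openC/closed_closure.
have dB ik : dense (B ik).
  case: ik => i k O [x Ox] oO.
  have [[y [Oy Wy]]|OW] := pselect (O `&` W i !=set0).
    have /= [_ /(_ k I)cl] := interior_subset Wy.
    by have [z [Uz Oz]] := cl O (open_nbhs_nbhs (conj oO Oy)); exists z; split => //; left.
  exists x; split => //; right => cW; apply: OW.
  by have [z [Wz Oz]] := cW O (open_nbhs_nbhs (conj oO Ox)); exists z.
exists (fun n => if unpickle n is Some ik then B ik else setT); split.
  move=> n; case: unpickle => [ik|]; first by split; [exact: oB|exact: dB].
  by split; [exact: openT|move=> O [x Ox] _; exists x].
move=> x Hx; have [i [V [xV VG VU]]] := H x.
have Wx : W i x.
  apply: filterS xV => y Vy; split; first exact: VG.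
  by move=> k _; exact: VU.
exists i; split; first by have [] := interior_subset Wx.
move=> k; have := Hx (pickle (i, k)) I; rewrite pickleK => -[//|].
by move=> nc; exfalso; apply: nc; exact: subset_closure.
Qed.

(** Finitely many requirements met by all small enough numbers are met
    simultaneously. *)
Lemma fin_pos {R : realType} (k : nat) (P : nat -> R -> Prop) :
  (forall j, (j < k)%N -> exists2 d, 0 < d & P j d) ->
  (forall j d d', P j d -> d' <= d -> P j d') ->
  exists2 d, 0 < d & forall j, (j < k)%N -> P j d.
Proof.
move=> H M; elim: k H => [|k IH] H; first by exists 1.
have [d d0 Hd] := IH (fun j jk => H j (ltnW jk)).
have [d' d'0 Hd'] := H k (ltnSn k).
exists (Num.min d d'); first by rewrite lt_min d0.
move=> j; rewrite ltnS leq_eqVlt => /orP[/eqP->|jk].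
  by apply: M Hd' _; rewrite ge_min lexx orbT.
by apply: M (Hd _ jk) _; rewrite ge_min lexx.
Qed.

Lemma bool_fin_pos {R : realType} (k : nat) (P : bool -> nat -> R -> Prop) :
  (forall i j, (j < k)%N -> exists2 d, 0 < d & P i j d) ->
  (forall i j d d', P i j d -> d' <= d -> P i j d') ->
  exists2 d, 0 < d & forall i j, (j < k)%N -> P i j d.
Proof.
move=> H M; have [d d0 Hd] := fin_pos (H false) (M false).
have [d' d'0 Hd'] := fin_pos (H true) (M true).
exists (Num.min d d'); first by rewrite lt_min d0.
case=> j jk; [apply: M (Hd' _ jk) _|apply: M (Hd _ jk) _];
by rewrite ge_min lexx ?orbT.
Qed.

Section bump_function.
Context {R : realType}.

(** A continuous function with values in the unit interval, equal to [1] within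
    [1/N] of the rational points [s] and to [0] at distance at least [2/N] from all
    of them. Such functions form a countable family. *)
Definition bump (s : seq rat) (N : nat) (x : R) : R :=
  Num.min 1 (\sum_(q <- s) Num.max 0 (2 - N%:R * `|x - ratr q|)).

Lemma bump_itv s N x : 0 <= bump s N x <= 1.
Proof.
rewrite /bump le_min ler01/= ge_min lexx andbT.
by apply: sumr_ge0 => q _; rewrite le_max lexx.
Qed.

Lemma bump_eq1 s N x q : q \in s -> N%:R * `|x - ratr q| <= 1 -> bump s N x = 1.
Proof.
move=> qs H; rewrite /bump; apply/min_idPl; rewrite (big_rem q)//=.
have h0 : 0 <= \sum_(y <- rem q s) Num.max 0 (2 - N%:R * `|x - ratr y|).
  by apply: sumr_ge0 => z _; rewrite le_max lexx.
have : 1 <= Num.max 0 (2 - N%:R * `|x - ratr q|) by rewrite le_max; apply/orP; right; lra.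
lra.
Qed.

Lemma bump_neq0 s N x : bump s N x != 0 ->
  exists2 q, q \in s & N%:R * `|x - ratr q| < 2.
Proof.
move=> H; apply: contrapT => nq; move/negP: H; apply; apply/eqP.
rewrite /bump big_seq big1 ?minEle ?ler10// => q qs.
apply/max_idPl; rewrite leNgt; apply/negP => h; apply: nq; exists q => //; lra.
Qed.

Lemma bump_lipschitz s N : exists2 C, 0 < C & forall x y,
  `|bump s N x - bump s N y| <= C * `|x - y|.
Proof.
exists (N%:R * (size s)%:R + 1); first by rewrite ltr_wpDl.
move=> x y.
have min1 (a b : R) : `|Num.min 1 a - Num.min 1 b| <= `|a - b|.
  rewrite /Num.min; case: ifPn => h1; case: ifPn => h2; rewrite -?leNgt in h1 h2;
  rewrite ler_norml; case: (ger0P (a - b)) => h3; apply/andP; split; lra.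
have max0 (a b : R) : `|Num.max 0 a - Num.max 0 b| <= `|a - b|.
  rewrite /Num.max; case: ifPn => h1; case: ifPn => h2; rewrite -?leNgt in h1 h2;
  rewrite ler_norml; case: (ger0P (a - b)) => h3; apply/andP; split; lra.
apply: (le_trans (min1 _ _)).
apply: (@le_trans _ _ (N%:R * (size s)%:R * `|x - y|)); last first.
  by rewrite mulrDl mul1r lerDl.
rewrite -sumrB; apply: (le_trans (ler_norm_sum _ _ _)).
rewrite -mulrA mulrCA -(sum1_size s) natr_sum mulr_suml.
apply: ler_sum => q _; rewrite mul1r; apply: (le_trans (max0 _ _)).
rewrite (_ : _ - _ = N%:R * (`|y - ratr q| - `|x - ratr q|)); last by ring.
rewrite normrM ger0_norm// ler_wpM2l//; apply: (le_trans (ler_dist_dist _ _)).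
by rewrite opprB addrA subrK distrC.
Qed.

Lemma bump_continuous s N : {within `[0, 1], continuous (bump s N)}.
Proof.
apply: continuous_subspaceT => x; have [C C0 H] := bump_lipschitz s N.
apply/cvgrPdist_le => e e0; exists (e / C) => /=; first by rewrite divr_gt0.
move=> y xy; apply: (le_trans (H _ _)).
by rewrite mulrC -ler_pdivlMr// ltW.
Qed.

End bump_function.

(** * Uniform expansion and stretching near a given map *)

Lemma stretch_margin {R : realType} (z zl zr wl wr l m e : R) :
  l * e <= z - zl -> l * e <= zr - z ->
  `|wl - zl| < (l - m) * e -> `|wr - zr| < (l - m) * e ->
  wl <= z - m * e /\ z + m * e <= wr.
Proof. by rewrite !ltr_norml => h1 h2 /andP[h3 h4] /andP[h5 h6]; split; lra. Qed.

Section lorenz_local.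
Context {R : realType} {rho c alpha beta : R}.
Hypothesis hrho : 0 < rho < 1.
Hypothesis halpha : 0 < alpha < 1.
Hypothesis hbeta : 0 < beta < 1.
Local Notation L := (lorenz_map rho c alpha beta).
Implicit Types f g : L.

Lemma lorenz_local_expansion f : exists lam r d, [/\ 1 < lam, 0 < r,
   0 <= c - r /\ c + r <= 1, 0 < d &
   forall g, (lorenz_dist f g < d%:E)%E ->
     expanding c 0 1 lam g /\ expanding c (c - r) (c + r) 8 g].
Proof.
have [s s1 Hs] := lorenz_slope_gt1 f.
have [r [r0 cr0 cr1 Hr]] := lorenz_expanding_near f 16.
pose lam := (1 + s) / 2.
have lam1 : 1 < lam by rewrite /lam; lra.
have s0 : 0 < s by lra.
have ls : lam < s by rewrite /lam; lra.
pose k := Num.max (1 / 2) (lam / s).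
have k0 : 0 <= k < 1.
  have ls1 : lam / s < 1 by rewrite ltr_pdivrMr// mul1r.
  rewrite le_max gt_max ls1 andbT.
  by apply/andP; split; [apply/orP; left|]; lra.
have k12 : 1 / 2 <= k by rewrite le_max lexx.
have ks : lam / s <= k by rewrite le_max lexx orbT.
have [d d0 H] := lorenz_near_slope hrho halpha hbeta f k0.
exists lam, r, d; split => // g gd.
split => x y x0 xy y1 side.
  apply: le_trans (H _ gd _ _ x0 xy y1 side).
  have fx := Hs _ _ (ltW x0) xy (ltW y1) side.
  rewrite ler_pdivrMr// in ks.
  apply: (@le_trans _ _ (k * (s * (y - x)))).
    by rewrite mulrA ler_wpM2r// subr_ge0.
  by rewrite ler_wpM2l//; case/andP: k0.
have fx := Hr _ _ x0 xy y1 side.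
have x0' : 0 < x by apply: le_lt_trans x0.
have y1' : y < 1 by apply: lt_le_trans cr1.
apply: le_trans (H _ gd _ _ x0' xy y1' side).
apply: (@le_trans _ _ (k * (16 * (y - x)))).
  rewrite mulrA ler_wpM2r ?subr_ge0//; lra.
by rewrite ler_wpM2l//; case/andP: k0.
Qed.

Let dist0 f d : 0 < d -> (lorenz_dist f f < d%:E)%E.
Proof. by move=> d0; rewrite lorenz_distxx lte_fin. Qed.

(** A small interval centred at a point whose first [k] iterates avoid [c] is
    followed by all the maps near [f], and stretched by the factor [mu] at least. *)
Lemma lorenz_stretch f lam x k mu e : 1 < lam -> expanding c 0 1 lam f ->
  0 < x < 1 -> (forall j, (j < k)%N -> iter j f x != c) ->
  mu < lam ^+ k -> 0 < e ->
  exists2 d, 0 < d & forall eta, 0 < eta -> eta < d ->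
  exists2 d', 0 < d' & forall g, (lorenz_dist f g < d'%:E)%E ->
   [/\ (forall y j, x - eta <= y <= x + eta -> (j <= k)%N ->
          `|iter j g y - iter j f x| < e),
       (forall y j, x - eta <= y <= x + eta -> (j < k)%N -> iter j g y != c) &
       iter k g (x - eta) <= iter k f x - mu * eta /\
       iter k f x + mu * eta <= iter k g (x + eta)].
Proof.
move=> lam1 fexp x01 xc mul e0; have /andP[x0 x1] := x01.
have [e1 e10 He1] : exists2 e1, 0 < e1 & forall j, (j < k)%N ->
    e1 <= `|iter j f x - c|.
  apply: (@fin_pos _ k (fun j d => d <= `|iter j f x - c|)).
    by move=> j jk; exists `|iter j f x - c| => //; rewrite normr_gt0 subr_eq0 xc.
  by move=> j d d' H1 H2; exact: le_trans H2 H1.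
have m0 : 0 < Num.min e e1 by rewrite lt_min e0.
have [d d0 Hd] := lorenz_orbit_near hrho halpha hbeta x01 xc m0.
exists (Num.min d (Num.min x (1 - x))).
  by rewrite !lt_min d0 x0 subr_gt0.
move=> eta eta0; rewrite !lt_min => /and3P[etad etax eta1].
have near g y j : (lorenz_dist f g < d%:E)%E -> x - eta <= y <= x + eta ->
    (j <= k)%N -> `|iter j g y - iter j f x| < Num.min e e1.
  move=> gd /andP[y1 y2] jk; apply: Hd => //.
  by rewrite ltr_norml; apply/andP; split; lra.
have side g j : (lorenz_dist f g < d%:E)%E -> (j < k)%N ->
    (forall y, x - eta <= y <= x + eta -> iter j g y < c) \/
    (forall y, x - eta <= y <= x + eta -> c < iter j g y).
  move=> gd jk; have := He1 _ jk; have : iter j f x != c by exact: xc.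
  case: (ltgtP (iter j f x) c) => // fc _.
    rewrite ltr0_norm ?subr_lt0// => h; left => y ye.
    have := near _ _ _ gd ye (ltnW jk); rewrite lt_min ltr_norml => /andP[_].
    by rewrite ltr_norml => /andP[]; lra.
  rewrite gtr0_norm ?subr_gt0// => h; right => y ye.
  have := near _ _ _ gd ye (ltnW jk); rewrite lt_min ltr_norml => /andP[_].
  by rewrite ltr_norml => /andP[]; lra.
have avoid g y j : (lorenz_dist f g < d%:E)%E -> x - eta <= y <= x + eta ->
    (j < k)%N -> iter j g y != c.
  move=> gd ye jk; case: (side _ _ gd jk) => /(_ _ ye) H; first by rewrite lt_eqF.
  by rewrite gt_eqF.
have itv y : x - eta <= y <= x + eta -> 0 < y < 1.
  by move=> /andP[? ?]; apply/andP; split; lra.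
have stretch y z j : (j <= k)%N -> x - eta <= y -> y <= z -> z <= x + eta ->
    lam ^+ j * (z - y) <= iter j f z - iter j f y.
  move=> jk y1 yz z1; have yI : x - eta <= y <= x + eta by apply/andP; split; lra.
  have zI : x - eta <= z <= x + eta by apply/andP; split; lra.
  elim: j jk => [|j IH] jk; first by rewrite mul1r.
  have {}IH := IH (ltnW jk).
  have ff := dist0 f d0.
  have avj w : x - eta <= w <= x + eta -> forall i, (i < j)%N -> iter i f w != c.
    by move=> wI i ij; apply: avoid => //; exact: ltn_trans jk.
  have /andP[a1 a2] := lorenz_iter_itv (itv _ yI) (avj _ yI).
  have /andP[b1 b2] := lorenz_iter_itv (itv _ zI) (avj _ zI).
  have lj : 0 <= lam ^+ j * (z - y).
    by rewrite mulr_ge0 ?subr_ge0// exprn_ge0// (le_trans ler01)// ltW.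
  have lez : iter j f y <= iter j f z by lra.
  have sd : iter j f z < c \/ c < iter j f y.
    by case: (side _ _ ff jk) => S; [left|right]; exact: S.
  rewrite exprS -mulrA !iterS; apply: le_trans (fexp _ _ a1 lez b2 sd).
  by rewrite ler_pM2l// (lt_trans ltr01).
have xe1 : x - eta <= x by rewrite gerBl ltW.
have xe2 : x <= x + eta by rewrite lerDl ltW.
have xl : x - eta <= x - eta <= x + eta by rewrite lexx (le_trans xe1 xe2).
have xr : x - eta <= x + eta <= x + eta by rewrite lexx (le_trans xe1 xe2).
have gap : 0 < (lam ^+ k - mu) * eta by rewrite mulr_gt0// subr_gt0.
have ff := dist0 f d0.
have [d1 d10 Hd1] := lorenz_orbit_near hrho halpha hbeta (itv _ xl)
  (fun j jk => avoid f _ j ff xl jk) gap.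
have [d2 d20 Hd2] := lorenz_orbit_near hrho halpha hbeta (itv _ xr)
  (fun j jk => avoid f _ j ff xr jk) gap.
exists (Num.min d (Num.min d1 d2)); first by rewrite !lt_min d0 d10.
move=> g gd.
have gd0 : (lorenz_dist f g < d%:E)%E.
  by apply: (lt_le_trans gd); rewrite lee_fin !ge_min lexx.
have gd1 : (lorenz_dist f g < d1%:E)%E.
  by apply: (lt_le_trans gd); rewrite lee_fin !ge_min lexx ?orbT.
have gd2 : (lorenz_dist f g < d2%:E)%E.
  by apply: (lt_le_trans gd); rewrite lee_fin !ge_min lexx ?orbT.
split.
- move=> y j ye jk; have := near _ _ _ gd0 ye jk.
  by rewrite lt_min => /andP[].
- by move=> y j ye jk; exact: avoid.
- have z0 (w : R) d' : 0 < d' -> `|w - w| < d' by rewrite subrr normr0.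
  have := Hd1 _ _ gd1 (z0 _ _ d10) _ (leqnn k).
  have := Hd2 _ _ gd2 (z0 _ _ d20) _ (leqnn k).
  have s1 : lam ^+ k * (x - (x - eta)) <= iter k f x - iter k f (x - eta).
    exact: stretch.
  have s2 : lam ^+ k * (x + eta - x) <= iter k f (x + eta) - iter k f x.
    exact: stretch.
  rewrite subKr in s1; rewrite addrAC subrr add0r in s2.
  by move=> t2 t1; exact: stretch_margin s1 s2 t1 t2.
Qed.

End lorenz_local.

(** * Frequent visits and basins *)

Section basin_and_visits.
Context {R : realType} (c : R) (f : R -> R) (s : seq rat) (N e : nat).
Context (mu : probability (measurableTypeR R) R) (x0 : R).
Local Notation V := [set x | bump s N x != 0 :> R].

Lemma misses_le_bump n x :
  (misses f V n x)%:R <= n%:R - \sum_(j < n) bump s N (iter j f x).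
Proof.
rewrite /misses natr_sum -[X in X%:R - _]card_ord -sum1_card natr_sum -sumrB.
apply: ler_sum => j _; have /andP[b0 b1] := bump_itv s N (iter j f x).
case: asboolP => /= [_|/negP]; first by rewrite subr_ge0.
by rewrite negbK => /eqP ->; rewrite subr0.
Qed.

(** The bump function is a continuous observable: its averages have the same limit
    along all orbits of the basin, and this limit is at least [1 - 1/(2 e)] if the
    orbit of [x0] visits often enough. *)
Lemma not_basin : (0 < e)%N ->
  lebesgue_measure [set x | exists M, forall k, (M <= k)%N ->
    few_misses c f V (e * k) k x] = 0%E ->
  (forall k, exists m, [/\ (k <= m)%N, (0 < m)%N &
     1 - (2 * e)%:R^-1 < m%:R^-1 * \sum_(j < m) bump s N (iter j f x0)]) ->
  SRB_measure c f mu -> ~ basin c f mu x0.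
Proof.
move=> e0 null freq [_ mu0] [_ _ /(_ _ (@bump_continuous R s N))].
set l := \int[mu]_(y in _) _ => cv0.
have eR0 : 0 < e%:R :> R by rewrite ltr0n.
have e2 : (2 * e)%:R^-1 = e%:R^-1 / 2 :> R by rewrite natrM invfM mulrC.
have ei0 : 0 < e%:R^-1 :> R by rewrite invr_gt0.
have le : 1 - e%:R^-1 / 2 <= l.
  rewrite leNgt; apply/negP => ll.
  have [M _ HM] := (cvgrPdist_lt _ _).1 cv0 _ (etrans (subr_gt0 _ _) ll).
  have [m [Mm m0]] := freq M; rewrite e2 => Hm.
  have := HM m Mm; rewrite /= ltr_norml => /andP[]; lra.
have B : basin c f mu `<=` [set 0; 1] `|` [set x | exists M, forall k, (M <= k)%N ->
    few_misses c f V (e * k) k x].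
  move=> x [x01 xD /(_ _ (@bump_continuous R s N))]; rewrite -/l => cv.
  have [->|xn0] := eqVneq x 0; first by left; left.
  have [->|xn1] := eqVneq x 1; first by left; right.
  right; have lt : 0 < l - (1 - e%:R^-1) by lra.
  have [M _ HM] := (cvgrPdist_lt _ _).1 cv _ lt.
  exists M.+1 => k Mk; have k0 : (0 < k)%N by exact: leq_ltn_trans Mk.
  have ek0 : 0 < (e * k)%:R :> R by rewrite ltr0n muln_gt0 e0.
  split.
  - by move: x01; rewrite /= in_itv/= !lt_neqAle eq_sym xn0 xn1.
  - by move=> j _; have [_ /= xc] := xD j; apply/eqP.
  - have Mek : (M <= e * k)%N.
      by rewrite (leq_trans (ltnW Mk))// leq_pmull.
    have := HM _ Mek; rewrite /= ltr_norml => /andP[_ H].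
    have {}H : 1 - e%:R^-1 < (e * k)%:R^-1 * \sum_(j < e * k) bump s N (iter j f x).
      by lra.
    rewrite ltr_pdivlMl// in H.
    have := misses_le_bump (e * k) x; rewrite -(ler_nat R) => /le_trans; apply.
    have -> : k%:R = (e * k)%:R * e%:R^-1 :> R.
      by rewrite natrM mulrC mulKf// gt_eqF.
    lra.
move: mu0; apply/negP; rewrite -leNgt.
apply: (le_trans (le_outer_measure (@lebesgue_measure R) _ _ B)).
apply: (le_trans (outer_measureU2 (@lebesgue_measure R) _ _)).
rewrite [X in (_ + X)%E](_ : _ = 0%E) ?adde0; last exact: null.
have c01 : countable [set 0; 1 : R] by apply: finite_set_countable; exact: finite_set2.
by rewrite le_eqVlt; apply/orP; left; apply/eqP; exact: countable_lebesgue_measure0.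
Qed.

End basin_and_visits.

Lemma powR_cvg {R : realType} (al t : R) : 0 < al < 1 -> 0 < t ->
  x `^ al @[x --> t] --> t `^ al.
Proof.
move=> al01 t0; apply/cvgrPdist_le => e e0.
have [d d0 Hd] := powR_small al01 e0.
exists (Num.min d t) => /=; first by rewrite lt_min d0.
move=> x /=; rewrite lt_min => /andP[xd xt].
have x0 : 0 <= x by move: xt; rewrite ltr_norml => /andP[]; lra.
apply: (le_trans (powR_dist_le al01 (ltW t0) x0)).
by apply: Hd => //; exact: ltW.
Qed.

Section frequent_visits.
Context {R : realType} {rho c alpha beta : R}.
Hypothesis hrho : 0 < rho < 1.
Hypothesis halpha : 0 < alpha < 1.
Hypothesis hbeta : 0 < beta < 1.
Local Notation L := (lorenz_map rho c alpha beta).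
Implicit Types f g : L.

(** The orbit of the left singular value avoids [c] up to some time [m >= k] and has
    then an average of [phi] greater than [1 - eps]. Requiring the singular value to
    be less than [1] keeps its orbit in the open unit interval. *)
Definition visits_often (phi : R -> R) (eps : R) (k : nat) : set L :=
  [set g : L | lorenz_d0 g < 1 /\ exists m, [/\ (k <= m)%N, (0 < m)%N,
     forall j, (j < m)%N -> iter j g (lorenz_d0 g) != c &
     1 - eps < m%:R^-1 * \sum_(j < m) phi (iter j g (lorenz_d0 g))]].

Lemma visits_often_open s N eps k : open (visits_often (bump s N) eps k).
Proof.
rewrite openE => g [g1 [m [km m0 gc Hm]]].
have /andP[d00 _] := lorenz_d0_gt0 g.
have d01 : 0 < lorenz_d0 g < 1 by rewrite d00.
have [C C0 HC] := @bump_lipschitz R s N.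
set A := m%:R^-1 * _ in Hm.
have [e1 e10 He1] : exists2 e1, 0 < e1 & forall j, (j < m)%N ->
    e1 <= `|iter j g (lorenz_d0 g) - c|.
  apply: (@fin_pos _ m (fun j d => d <= `|iter j g (lorenz_d0 g) - c|)).
    move=> j jk; exists `|iter j g (lorenz_d0 g) - c| => //.
    by rewrite normr_gt0 subr_eq0 gc.
  by move=> j d d' H1 H2; exact: le_trans H2 H1.
pose w := (A - (1 - eps)) / 2.
have w0 : 0 < w by rewrite divr_gt0// subr_gt0.
have m'0 : 0 < Num.min e1 (w / C) by rewrite lt_min e10 divr_gt0.
have [d d0 Hd] := lorenz_orbit_near hrho halpha hbeta d01 gc m'0.
have d2 : 0 < Num.min d (1 - lorenz_d0 g) / 2.
  by rewrite divr_gt0// lt_min d0 subr_gt0.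
have [d' d'0 Hd'] := lorenz_near_C0 hrho halpha hbeta g d2.
apply/nbhs_ballP; exists (Num.min d d'); first by rewrite /= lt_min d0.
move=> h /= gh.
have ghd : (lorenz_dist g h < d%:E)%E.
  by apply: (lt_le_trans gh); rewrite lee_fin ge_min lexx.
have ghd' : (lorenz_dist g h < d'%:E)%E.
  by apply: (lt_le_trans gh); rewrite lee_fin ge_min lexx orbT.
have [D _] := Hd' _ ghd'.
have dd : Num.min d (1 - lorenz_d0 g) <= d by rewrite ge_min lexx.
have dd1 : Num.min d (1 - lorenz_d0 g) <= 1 - lorenz_d0 g by rewrite ge_min lexx orbT.
have D1 : `|lorenz_d0 h - lorenz_d0 g| < d by rewrite distrC; lra.
have {}Hd := Hd _ _ ghd D1.
split.
  by move: D; rewrite ler_norml => /andP[]; lra.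
exists m; split => //.
  move=> j jm; have := Hd _ (ltnW jm); rewrite lt_min => /andP[H _].
  have {}H := lt_le_trans H (He1 _ jm).
  by apply/eqP => E; move: H; rewrite E distrC ltxx.
have mR0 : 0 < m%:R :> R by rewrite ltr0n.
suff : A - m%:R^-1 * \sum_(j < m) bump s N (iter j h (lorenz_d0 h)) <= w.
  by rewrite /w; lra.
rewrite /A -mulrBr -sumrB ler_pdivrMl//.
rewrite -[X in X%:R * _]card_ord -sum1_card natr_sum mulr_suml.
apply: ler_sum => j _; rewrite mul1r; apply: (le_trans (ler_norm _)).
apply: (le_trans (HC _ _)); rewrite mulrC -ler_pdivlMr// distrC ltW//.
by have := Hd _ (ltnW (ltn_ord j)); rewrite lt_min => /andP[].
Qed.

(** All that is asked of a map to steer a moving point: on each side [i] of [c], the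
    interval from [v1 i] to [v2 i] is stretched in [k i] steps across the interval
    from [y1 i] to [y2 i], which is stretched in [K] steps across itself while its
    iterates remain where the bump function is [1]. *)
Record target (lam r : R) (s : seq rat) (N K : nat) (v1 v2 : bool -> R)
    (k : bool -> nat) (y1 y2 : bool -> R) (g : R -> R) : Prop := Target {
  target_exp : expanding c 0 1 lam g ;
  target_exp8 : expanding c (c - r) (c + r) 8 g ;
  target_avoid : forall i y j, v1 i <= y <= v2 i -> (j < k i)%N ->
    iter j g y != c ;
  target_land : forall i, iter (k i) g (v1 i) <= y1 i /\
    y2 i <= iter (k i) g (v2 i) ;
  target_visit : forall i y j, y1 i <= y <= y2 i -> (j < K)%N ->
    iter j g y != c /\ bump s N (iter j g y) = 1 ;
  target_return : forall i, iter K g (y1 i) <= y1 i /\ y2 i <= iter K g (y2 i)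
}.

(** The family of [lorenz_scale]. *)
Let h (g : L) (t x : R) := if x < c then t `^ alpha * g x else g x.

Let scaled_family g lam r a b : 1 < lam -> 0 < a -> a < b -> b < 1 ->
  (forall t, a <= t <= b -> exists g' : L, h g t = g' /\
     expanding c 0 1 lam g' /\ expanding c (c - r) (c + r) 8 g') ->
  expanding_family c r lam a b (h g) (fun t => t `^ alpha * lorenz_d0 g).
Proof.
move=> lam1 a0 ab b1 H; have /andP[al0 al1] := halpha.
have /andP[d0 d1] := lorenz_d0_gt0 g.
have pw s t : a <= s -> s < t -> s `^ alpha < t `^ alpha.
  by move=> s1 st; apply: gt0_ltr_powR; rewrite ?nnegrE//; lra.
have pw1 t : t <= b -> a <= t -> 0 < t `^ alpha < 1.
  move=> tb at_; rewrite powR_gt0/=; last by lra.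
  have {1}<- : 1 `^ alpha = 1 :> R by rewrite powR1.
  by apply: gt0_ltr_powR; rewrite ?nnegrE//; lra.
split => //.
- move=> t x tab x01 xc; have [g' [-> _]] := H _ tab.
  exact: lorenz_gt0_lt1.
- move=> s t x as_ st tb x01 xc; rewrite /h; case: ifP => // _.
  have /andP[g0 _] := lorenz_gt0_lt1 g x01 xc.
  rewrite ler_wpM2r ?(ltW g0)//; move: st; rewrite le_eqVlt => /orP[/eqP->//|st].
  exact/ltW/pw.
- by move=> t tab; have [g' [-> []]] := H _ tab.
- by move=> t tab; have [g' [-> []]] := H _ tab.
- move=> t x /andP[at_ tb] x01 xc.
  have t0 : 0 < t by lra.
  have Cg : g z.2 @[z --> (t, x)] --> g x.
    by apply: cvg_comp (lorenz_continuous x01 xc); exact: cvg_snd.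
  have Ct : z.1 `^ alpha @[z --> (t, x)] --> t `^ alpha.
    have Cp := powR_cvg halpha t0; apply: (cvg_comp _ _ _ Cp); exact: cvg_fst.
  have nx : \forall z \near (t, x), (z.2 < c) = (x < c).
    have nx : \forall y \near x, (y < c) = (x < c).
      case: (ltgtP x c) xc => // xc _.
        by apply: filterS (lt_nbhsl xc) => y ->.
      by apply: filterS (lt_nbhsr xc) => y cy; apply/negbTE; rewrite -leNgt ltW.
    exact: (cvg_snd nx).
  rewrite /h; case: (ltgtP x c) xc nx => // xc _ nx.
    apply: cvg_trans (cvgM Ct Cg); apply: near_eq_cvg.
    by apply: filterS nx => z ->.
  apply: cvg_trans Cg; apply: near_eq_cvg.
  by apply: filterS nx => z ->.
- move=> t /andP[at_ tb]; have /andP[p0 p1] := pw1 _ tb at_.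
  by rewrite mulr_gt0//= (le_lt_trans _ p1)// ler_piMr// ltW.
- move=> s t as_ st tb; rewrite ltr_pM2r//; exact: pw.
- apply/subspace_continuousP => t; rewrite /= in_itv/= => /andP[at_ tb].
  apply: cvgM; last exact: cvg_cst.
  by apply: cvg_within_filter; apply: powR_cvg => //; lra.
Qed.

(** Every map near which all maps share the same target can be perturbed so that its
    left singular value visits often. *)
Lemma visits_often_dense lam r s N K v1 v2 k y1 y2 g (O : set L) eps k0 :
  1 < lam -> (0 < K)%N -> (forall i, v1 i < v2 i) -> (forall i, y1 i < y2 i) ->
  c - r < v1 false -> v2 false < c -> c < v1 true -> v2 true < c + r ->
  nbhs g O -> (forall g', O g' -> target lam r s N K v1 v2 k y1 y2 g') ->
  0 < eps -> exists2 g', O g' & visits_often (bump s N) eps k0 g'.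
Proof.
move=> lam1 K0 v12 y12 rv1 v2c cv1 v2r /nbhs_ballP[e1 /= e10 eO] OT eps0.
have [N' [t0 [N'0 /andP[t00 t01] Hs]]] := lorenz_scale hrho halpha hbeta g.
have eN : 0 < e1 / N' by rewrite divr_gt0.
pose m := Num.max t0 (1 - e1 / N').
have m1 : m < 1 by rewrite gt_max t01; lra.
have mt : t0 <= m by rewrite le_max lexx.
have me : 1 - e1 / N' <= m by rewrite le_max lexx orbT.
(* Any two parameters between m and 1 would do. *)
pose a := (2 * m + 1) / 3; pose b := (m + 2) / 3.
have ma : m < a by rewrite /a; lra.
have ab : a < b by rewrite /a /b; lra.
have b1 : b < 1 by rewrite /b; lra.
have H t : a <= t <= b -> exists g' : L, [/\ h g t = g',
    lorenz_d0 g' = t `^ alpha * lorenz_d0 g & O g'].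
  move=> /andP[ta tb]; have [|g' [E1 E2 E3]] := Hs t; first by apply/andP; split; lra.
  exists g'; split => //; first by apply/funext => x; rewrite E1.
  apply: eO; apply: (le_lt_trans E3); rewrite lte_fin -ltr_pdivlMr//; lra.
have FH : expanding_family c r lam a b (h g) (fun t => t `^ alpha * lorenz_d0 g).
  apply: scaled_family => //; first by lra.
  move=> t tab; have [g' [E1 _ /OT T]] := H _ tab; exists g'; split => //.
  by split; [exact: target_exp T|exact: target_exp8 T].
have TH t : a <= t <= b -> target lam r s N K v1 v2 k y1 y2 (h g t).
  by move=> tab; have [g' [-> _ /OT]] := H _ tab.
have [n [a1 [b1' [aa1 ab1 bb1 av cov]]]] :=
  family_sweeps FH (v12 false) (v12 true) v2c cv1 rv1 v2r.
have [i [ca cb]] : exists i, iter n (h g a1) (a1 `^ alpha * lorenz_d0 g) = v1 i /\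
    iter n (h g b1') (b1' `^ alpha * lorenz_d0 g) = v2 i.
  by case: cov => -[? ?]; [exists false|exists true].
have [_ [a2 [b2 [a12 ab2 b12 av2 [ca2 cb2]]]]] := family_follow FH aa1 ab1 bb1 av
  ca cb (y12 i) (fun t y j tI yI jk => target_avoid (TH t tI) yI jk)
  (fun t tI => target_land (TH t tI) i).
set n2 := (n + k i)%N in av2 ca2 cb2.
have [n0 n0e] : exists n0 : nat, eps^-1 < n0%:R.
  by exists (Num.truncn eps^-1).+1; rewrite truncnS_gt.
(* So many returns that the n2 steps before the first visit are negligible. *)
pose M := (n0 * n2 + k0).+1.
have [t [/andP[at_ tb] avt vis]] := family_stay FH M (le_trans aa1 a12) ab2
  (le_trans b12 bb1) av2 ca2 cb2 (y12 i)
  (fun t y j tI yI jK => (target_visit (TH t tI) yI jK).1)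
  (fun t tI => target_return (TH t tI) i).
have tab : a <= t <= b.
  by rewrite (le_trans (le_trans aa1 a12) at_) (le_trans tb (le_trans b12 bb1)).
have [g' [E1 E2 Og']] := H _ tab.
exists g' => //.
have /andP[d0 d1] := lorenz_d0_gt0 g.
split.
  rewrite E2; have := family_X0_itv FH tab; by case/andP.
have Mm : (M <= n2 + M * K)%N by rewrite (leq_trans (leq_pmulr M K0))// leq_addl.
exists (n2 + M * K)%N; split.
- by apply: leq_trans Mm; rewrite /M ltnW// ltnS leq_addl.
- exact: leq_trans Mm.
- by move=> j jm; rewrite E2 -E1; exact: avt.
have m0 : 0 < (n2 + M * K)%:R :> R by rewrite ltr0n (leq_trans _ Mm).
rewrite ltr_pdivlMl// E2 -E1.
set x := t `^ alpha * lorenz_d0 g.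
have B1 j : (n2 <= j)%N -> (j < n2 + M * K)%N -> bump s N (iter j (h g t) x) = 1.
  move=> nj jm; have E : j = ((j - n2) %% K + (n2 + (j - n2) %/ K * K))%N.
    by rewrite addnCA addnC [X in (X + _)%N]addnC -divn_eq subnK.
  rewrite E iterD; apply: (target_visit (TH t tab) (i := i) _ _).2.
    by apply: vis; rewrite ltn_divLR// ltn_subLR.
  by rewrite ltn_mod.
have S1 : (M * K)%:R <= \sum_(j < n2 + M * K) bump s N (iter j (h g t) x) :> R.
  rewrite big_split_ord/=.
  have -> : \sum_(j < M * K) bump s N (iter (n2 + j) (h g t) x) = (M * K)%:R :> R.
    rewrite (eq_bigr (fun=> 1)); last by move=> j _; rewrite B1 ?leq_addr// ltn_add2l.
    by rewrite sumr_const card_ord.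
  by rewrite lerDr sumr_ge0// => j _; have /andP[] := bump_itv s N (iter j (h g t) x).
apply: lt_le_trans S1.
have n2M : n2%:R < eps * (n2 + M * K)%:R :> R.
  apply: (@lt_le_trans _ _ (eps * M%:R)); last first.
    by rewrite ler_wpM2l ?(ltW eps0)// ler_nat.
  rewrite -ltr_pdivrMl//; apply: (@le_lt_trans _ _ ((n0 * n2)%:R)).
    by rewrite natrM ler_wpM2r// ltW.
  by rewrite ltr_nat /M ltnS leq_addr.
by rewrite natrD in n2M *; lra.
Qed.

End frequent_visits.

(** * A common target near every map *)

Lemma ltr_itv_around {R : realType} (x e : R) : 0 < e -> x - e < x + e.
Proof. by lra. Qed.

Section local_target.
Context {R : realType} {rho c alpha beta : R}.
Hypothesis hrho : 0 < rho < 1.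
Hypothesis halpha : 0 < alpha < 1.
Hypothesis hbeta : 0 < beta < 1.
Local Notation L := (lorenz_map rho c alpha beta).
Implicit Types f g : L.

(** Points of the periodic orbits on different sides of [c] have different images,
    since a map permutes its periodic points of period [K]. *)
Lemma periodic_separation (f : R -> R) (K : nat) (p : bool -> R) : (0 < K)%N ->
  (forall i, iter K f (p i) = p i) ->
  exists2 d, 0 < d & forall i i' j j', (j < K)%N -> (j' < K)%N ->
    iter j f (p i) < c -> c < iter j' f (p i') ->
    d * 2 <= `|iter j.+1 f (p i) - iter j'.+1 f (p i')|.
Proof.
move=> K0 fp.
pose P i j d := forall i' j', (j' < K)%N -> iter j f (p i) < c ->
  c < iter j' f (p i') -> d * 2 <= `|iter j.+1 f (p i) - iter j'.+1 f (p i')|.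
have [||d d0 Hd] := @bool_fin_pos R K P; last first.
- by exists d => // i i' j j' jK j'K; exact: Hd.
- by move=> i j d d' H d'd i' j' j'K jc cj; apply: le_trans (H _ _ j'K jc cj); lra.
move=> i j jK.
pose Q i' j' d := iter j f (p i) < c -> c < iter j' f (p i') ->
  d * 2 <= `|iter j.+1 f (p i) - iter j'.+1 f (p i')|.
have [||d d0 Hd] := @bool_fin_pos R K Q; last first.
- by exists d => // i' j' j'K; exact: Hd.
- by move=> i' j' d d' H d'd jc cj; apply: le_trans (H jc cj); lra.
move=> i' j' j'K; rewrite /Q.
have [E|ne] := eqVneq (iter j.+1 f (p i)) (iter j'.+1 f (p i')).
  (* Applying f K - 1 more times recovers the two points. *)
  exists 1 => // jc cj; exfalso.
  have back m l : iter K.-1 f (iter m.+1 f (p l)) = iter m f (p l).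
    by rewrite -iterD addnS -addSn prednK// addnC iterD fp.
  have : iter j f (p i) = iter j' f (p i') by rewrite -[LHS]back -[RHS]back E.
  lra.
exists (`|iter j.+1 f (p i) - iter j'.+1 f (p i')| / 2); last by lra.
by rewrite divr_gt0// normr_gt0 subr_eq0.
Qed.

Lemma rational_centers (K N : nat) (P : bool -> nat -> R) : (0 < N)%N ->
  exists s : seq rat,
  (forall q, q \in s -> exists i j, (j < K)%N /\ `|P i j - ratr q| < (2 * N%:R)^-1) /\
  (forall i j, (j < K)%N -> exists2 q, q \in s & `|P i j - ratr q| < (2 * N%:R)^-1).
Proof.
move=> N0; have NR : 0 < (2 * N%:R)^-1 :> R by rewrite invr_gt0 mulr_gt0// ltr0n.
have H (ij : bool * nat) : exists q : rat, `|P ij.1 ij.2 - ratr q| < (2 * N%:R)^-1.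
  have [|q] := @rat_in_itvoo R (P ij.1 ij.2) (P ij.1 ij.2 + (2 * N%:R)^-1).
    by rewrite ltrDl.
  rewrite in_itv/= => /andP[q1 q2]; exists q; rewrite ltr0_norm; lra.
have [F HF] := choice H.
pose s := [seq F (i, j) | i <- [:: false; true], j <- iota 0 K].
exists s; split.
  move=> q /allpairsP[[i j] /= [_]]; rewrite mem_iota/= add0n => jK ->.
  by exists i, j; split => //; exact: (HF (i, j)).
move=> i j jK; exists (F (i, j)); last exact: (HF (i, j)).
by apply/allpairsP; exists (i, j); split => //=; [case: i|rewrite mem_iota].
Qed.

(** A neighbourhood of the periodic orbits, given by a bump function, such that for
    all maps near [f] an open set [S] contains the images of its points on the left
    of [c], and none of those of its points on the right. *)
Lemma periodic_orbits_neighborhood f (K : nat) (p : bool -> R) : (0 < K)%N ->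
  (forall i, [/\ 0 < p i < 1, iter K f (p i) = p i &
     forall j, iter j f (p i) != c]) ->
  exists s N (S : set R) d, [/\ (0 < N)%N, 0 < d,
   (forall y i j, (j < K)%N -> `|y - iter j f (p i)| < (2 * N%:R)^-1 ->
      bump s N y = 1 :> R), open S &
   forall g : L, (lorenz_dist f g < d%:E)%E ->
     (forall x, bump s N x != 0 :> R -> x < c -> S (g x)) /\
     (forall x, bump s N x != 0 :> R -> c < x -> ~ S (g x))].
Proof.
move=> K0 Hp; pose P i j := iter j f (p i).
have P01 i j : 0 < P i j < 1.
  by have [p01 _ pc] := Hp i; apply: lorenz_iter_itv => // j' _; exact: pc.
have Pc i j : P i j != c by have [_ _ pc] := Hp i; exact: pc.
have [eps eps0 sep] := @periodic_separation f K p K0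
  (fun i => let: And3 _ h _ := Hp i in h).
have [del del0 Hdel] : exists2 del : R, 0 < del & forall i j, (j < K)%N ->
    del <= `|P i j - c| /\ forall (g : L) y, (lorenz_dist f g < del%:E)%E ->
      `|y - P i j| < del -> `|g y - P i j.+1| < eps.
  apply: (@bool_fin_pos R K (fun i j d => d <= `|P i j - c| /\
    forall (g : L) y, (lorenz_dist f g < d%:E)%E ->
      `|y - P i j| < d -> `|g y - P i j.+1| < eps)).
    move=> i j jK; have xc j' : (j' < 1)%N -> iter j' f (P i j) != c.
      by rewrite ltnS leqn0 => /eqP ->; exact: Pc.
    have [d d0 H] := lorenz_orbit_near hrho halpha hbeta (P01 i j) xc eps0.
    exists (Num.min d `|P i j - c|).
      by rewrite lt_min d0 normr_gt0 subr_eq0 Pc.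
    split; first by rewrite ge_min lexx orbT.
    move=> g y gd; rewrite lt_min => /andP[yd _].
    have gd' : (lorenz_dist f g < d%:E)%E.
      by apply: (lt_le_trans gd); rewrite lee_fin ge_min lexx.
    exact: (H g y gd' yd 1%N (leqnn 1)).
  move=> i j d d' [H1 H2] d'd; split; first exact: le_trans H1.
  move=> g y gd yd; apply: H2; last exact: lt_le_trans d'd.
  by apply: (lt_le_trans gd); rewrite lee_fin.
have [N N0 HN] : exists2 N : nat, (0 < N)%N & 3 / del < N%:R.
  by exists (Num.truncn (3 / del)).+1 => //; rewrite truncnS_gt.
have NR : 0 < N%:R :> R by rewrite ltr0n.
have N3 : 3 / N%:R < del by rewrite ltr_pdivrMr// mulrC -ltr_pdivrMr.
have N2E : (2 * N%:R)^-1 = N%:R^-1 / 2 :> R by rewrite invfM mulrC.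
have Ni0 : 0 < N%:R^-1 :> R by rewrite invr_gt0.
have [s [Hs1 Hs2]] := @rational_centers K N P N0.
have bumpP y : bump s N y != 0 :> R -> exists i j, (j < K)%N /\ `|y - P i j| < del.
  move=> /bump_neq0[x xs]; rewrite -ltr_pdivlMl// => yx.
  have [i [j [jK Pj]]] := Hs1 _ xs; exists i, j; split => //.
  rewrite distrC -(subrK (ratr x) (P i j)) -addrA.
  apply: (le_lt_trans (ler_normD _ _)); rewrite (distrC _ y).
  move: Pj yx N3 Ni0; rewrite N2E; clear; lra.
have bump1 y i j : (j < K)%N -> `|y - P i j| < (2 * N%:R)^-1 -> bump s N y = 1.
  move=> jK yP; have [x xs Px] := Hs2 i j jK; apply: (bump_eq1 xs).
  rewrite -ler_pdivlMl// mulr1 -(subrK (P i j) y) -addrA.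
  apply: (le_trans (ler_normD _ _)).
  move: yP Px; rewrite N2E; clear; lra.
have side y i j : (j < K)%N -> `|y - P i j| < del -> (y < c) = (P i j < c).
  move=> jK; have [+ _] := Hdel i j jK; move: (Pc i j).
  case: (ltgtP (P i j) c) => // Pcc _.
    rewrite (ltr0_norm (x := P i j - c)) ?subr_lt0// ltr_norml => h1 /andP[_].
    move: h1; clear; lra.
  rewrite (gtr0_norm (x := P i j - c)) ?subr_gt0// ltr_norml => h1 /andP[h2 _].
  apply/negbTE; rewrite -leNgt; move: h1 h2; clear; lra.
pose S := \bigcup_(ij in [set ij : bool * nat | (ij.2 < K)%N && (P ij.1 ij.2 < c)])
   ball (P ij.1 ij.2.+1) eps.
exists s, N, S, del; split => //.
  by apply: bigcup_open => ij _; exact: ball_open.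
move=> g gd; split=> x /bumpP[i [j [jK xP]]].
  rewrite (side _ _ _ jK xP) => Pcc; exists (i, j) => /=; first by rewrite jK.
  have [_ Hg] := Hdel i j jK.
  by rewrite /ball/= distrC; exact: Hg.
move=> cx; have cP : c < P i j.
  by rewrite lt_neqAle eq_sym Pc leNgt -(side _ _ _ jK xP) -leNgt ltW.
move=> [[i' j'] /= /andP[j'K P'c]]; rewrite /ball/= => B.
have [_ /(_ _ _ gd xP) A] := Hdel i j jK.
have := sep i' i j' j j'K jK P'c cP; apply/negP; rewrite -ltNge.
rewrite -/(P i' j'.+1) -/(P i j.+1) -(subrK (g x) (P i' j'.+1)) -addrA.
apply: (le_lt_trans (ler_normD _ _)); move: A B; clear; lra.
Qed.

(** An interval centred at [q], of half-width [x.1], is stretched in [k] steps across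
    a neighbourhood of the [k]-th iterate of [q] by all maps at distance less than
    [x.2] from [f]. *)
Lemma lorenz_enter f lam q k a b : 1 < lam -> expanding c 0 1 lam f ->
  0 <= a -> b <= 1 -> a < q < b -> (forall j, (j < k)%N -> iter j f q != c) ->
  exists x : R * R, [/\ 0 < x.1, 0 < x.2, a < q - x.1, q + x.1 < b &
   forall g : L, (lorenz_dist f g < x.2%:E)%E ->
    (forall y j, q - x.1 <= y <= q + x.1 -> (j < k)%N -> iter j g y != c) /\
    (iter k g (q - x.1) <= iter k f q - 1 / 2 * x.1 /\
     iter k f q + 1 / 2 * x.1 <= iter k g (q + x.1))].
Proof.
move=> lam1 fexp a0 b1 /andP[aq qb] qc.
have half : 1 / 2 < lam ^+ k.
  have : 1 <= lam ^+ k by rewrite exprn_ege1// ltW.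
  by lra.
have q01 : 0 < q < 1 by rewrite (le_lt_trans a0 aq) (lt_le_trans qb b1).
have [d d0 Hd] := lorenz_stretch hrho halpha hbeta lam1 fexp q01 qc half ltr01.
pose eta := Num.min d (Num.min (q - a) (b - q)) / 2.
have m0 : 0 < Num.min d (Num.min (q - a) (b - q)).
  by rewrite !lt_min d0 !subr_gt0 aq.
have e0 : 0 < eta by rewrite divr_gt0.
have ltm : eta < Num.min d (Num.min (q - a) (b - q)).
  by rewrite /eta; move: m0; lra.
move: (ltm); rewrite !lt_min => /and3P[ed ea eb].
have [d' d'0 Hd'] := Hd _ e0 ed.
exists (eta, d'); split => //=; [by move: ea; lra|by move: eb; lra|].
by move=> g /Hd'[_ av ld]; split.
Qed.

Lemma lorenz_local_target f : exists lam r s N K v1 v2 k y1 y2 e d,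
  [/\ [/\ 1 < lam, (0 < K)%N, (0 < e)%N & 0 < d],
      forall i, v1 i < v2 i, forall i, y1 i < y2 i,
      [/\ c - r < v1 false, v2 false < c, c < v1 true & v2 true < c + r] &
      forall g : L, (lorenz_dist f g < d%:E)%E ->
       @target R c lam r s N K v1 v2 k y1 y2 g /\
       lebesgue_measure [set x | exists M, forall m, (M <= m)%N ->
         few_misses c g [set x | bump s N x != 0 :> R] (e * m) m x] = 0%E].
Proof.
have [lam [r [d1 [lam1 r0 [cr0 cr1] d10 Hexp]]]] :=
  lorenz_local_expansion hrho halpha hbeta f.
have [fexp fexp8] : expanding c 0 1 lam f /\ expanding c (c - r) (c + r) 8 f.
  by apply: Hexp; rewrite lorenz_distxx lte_fin.
have [K [p [q [k [K0 Hp ql qr Hq]]]]] := preperiodic_near lam1 r0 cr0 cr1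
  (@lorenz_gt0_lt1 _ _ _ _ _ f) fexp fexp8 (@lorenz_continuous _ _ _ _ _ f).
have [s [N [S [d2 [N0 d20 bump1 oS HS]]]]] := periodic_orbits_neighborhood K0 Hp.
have [e e0 Hnull] := frequent_visits_null lam1.
have /andP[c0 c1] := lorenz_c01 f.
have enter i : exists x : R * R, [/\ 0 < x.1, 0 < x.2,
    (if i then c else c - r) < q i - x.1, q i + x.1 < (if i then c + r else c) &
   forall g : L, (lorenz_dist f g < x.2%:E)%E ->
    (forall y j, q i - x.1 <= y <= q i + x.1 -> (j < k i)%N -> iter j g y != c) /\
    (iter (k i) g (q i - x.1) <= p i - 1 / 2 * x.1 /\
     p i + 1 / 2 * x.1 <= iter (k i) g (q i + x.1))].
  have [qc <-] := Hq i; apply: (lorenz_enter lam1 fexp) => //.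
  - by case: (i); rewrite ?(ltW c0).
  - by case: (i); rewrite ?(ltW c1).
  - by case: (i).
have [X HX] := choice enter.
have lamK : 1 < lam ^+ K by rewrite exprn_egt1// -lt0n.
have n20 : 0 < (2 * N%:R)^-1 :> R by rewrite invr_gt0 mulr_gt0// ltr0n.
have stay i := let: And3 p01 _ pc := Hp i in
  lorenz_stretch hrho halpha hbeta lam1 fexp p01 (fun j (_ : (j < K)%N) => pc j)
    lamK n20.
have [dpf dpf0 Hpf] := stay false; have [dpt dpt0 Hpt] := stay true.
have [Xf1 Xf2 _ _ _] := HX false; have [Xt1 Xt2 _ _ _] := HX true.
pose m := Num.min (Num.min dpf dpt) (Num.min (X false).1 (X true).1).
have m0 : 0 < m by rewrite !lt_min dpf0 dpt0 Xf1.
pose eta := m / 2.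
have eta0 : 0 < eta by rewrite divr_gt0.
have etam : eta < m by rewrite /eta ltr_pdivrMr// ltr_pMr// ltr1n.
move: (etam); rewrite !lt_min => /andP[/andP[etaf etat] /andP[eXf eXt]].
have etaX i : eta <= 1 / 2 * (X i).1.
  have : m <= (X i).1 by case: i; rewrite !ge_min lexx !orbT.
  by rewrite /eta mulrC mul1r ler_pM2l.
have [d3 d30 H3] := Hpf _ eta0 etaf; have [d4 d40 H4] := Hpt _ eta0 etat.
pose d := Num.min (Num.min d1 d2) (Num.min (Num.min d3 d4)
  (Num.min (X false).2 (X true).2)).
have d0 : 0 < d by rewrite !lt_min d10 d20 d30 d40 Xf2.
exists lam, r, s, N, K, (fun i => q i - (X i).1), (fun i => q i + (X i).1), k,
  (fun i => p i - eta), (fun i => p i + eta), e, d.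
split => //.
- by move=> i; have [X0 _ _ _ _] := HX i; exact: ltr_itv_around.
- by move=> i; exact: ltr_itv_around.
- by split; have [_ _ + + _] := HX false; have [_ _ + + _] := HX true.
move=> g gd; have gd' d' : d <= d' -> (lorenz_dist f g < d'%:E)%E.
  by move=> dd'; apply: (lt_le_trans gd); rewrite lee_fin.
have [gexp gexp8] : expanding c 0 1 lam g /\ expanding c (c - r) (c + r) 8 g.
  by apply/Hexp/gd'; rewrite !ge_min lexx.
have gd2 : (lorenz_dist f g < d2%:E)%E by apply: gd'; rewrite !ge_min lexx ?orbT.
have [gS gSC] := HS g gd2.
split; last first.
  apply: (Hnull _ _ _ S) => //.
  - exact: lorenz_gt0_lt1.
  - exact: open_measurable.
  - by move=> x _; exact: gS.
  - by move=> x _; exact: gSC.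
have gX i : (lorenz_dist f g < (X i).2%:E)%E.
  by apply: gd'; case: i; rewrite !ge_min lexx ?orbT.
have gp i : [/\ forall y j, p i - eta <= y <= p i + eta -> (j <= K)%N ->
        `|iter j g y - iter j f (p i)| < (2 * N%:R)^-1,
     forall y j, p i - eta <= y <= p i + eta -> (j < K)%N -> iter j g y != c &
     iter K g (p i - eta) <= iter K f (p i) - 1 * eta /\
     iter K f (p i) + 1 * eta <= iter K g (p i + eta)].
  by case: i; [apply: H4|apply: H3]; apply: gd'; rewrite !ge_min lexx ?orbT.
split => //.
- by move=> i; have [_ _ _ _ /(_ g (gX i))[]] := HX i.
- move=> i; have [_ _ _ _ /(_ g (gX i))[_ [A B]]] := HX i.
  by split; [apply: (le_trans A); rewrite lerD2l lerN2|apply: le_trans B;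
    rewrite lerD2l]; exact: etaX.
- move=> i y j yI jK; have [A B _] := gp i; split; first exact: B.
  by apply: (bump1 _ i j jK); apply: A => //; exact: ltnW.
- move=> i; have [_ _] := gp i; have [_ -> _] := Hp i.
  by rewrite !mul1r.
Qed.

End local_target.

Theorem corollary5 (R : realType) (rho c alpha beta : R)
    (hrho : 0 < rho < 1) (hc : 0 < c < 1)
    (halpha : 0 < alpha < 1) (hbeta : 0 < beta < 1) :
  residual [set f : lorenz_map rho c alpha beta |
    forall mu : probability (measurableTypeR R) R,
      SRB_measure c f mu ->
      ~ ([set left_value c f; right_value c f] `<=` basin c f mu)].
Proof.
pose G (i : seq rat * nat * nat) := [set g : lorenz_map rho c alpha beta |
  (0 < i.2)%N /\ lebesgue_measure [set x | exists M, forall m, (M <= m)%N ->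
     few_misses c g [set x | bump i.1.1 i.1.2 x != 0 :> R] (i.2 * m) m x] = 0%E].
pose U (i : seq rat * nat * nat) k : set (lorenz_map rho c alpha beta) :=
  visits_often (bump i.1.1 i.1.2) (2 * i.2)%:R^-1 k.
have [||V [oV VGU]] := @residual_countable_local _ _ G U.
- by move=> i k; exact: visits_often_open.
- move=> f; have [lam [r [s [N [K [v1 [v2 [k [y1 [y2 [e [d H]]]]]]]]]]]] :=
    lorenz_local_target hrho halpha hbeta f.
  have [[lam1 K0 e0 d0] v12 y12 [rv vc cv vr] HT] := H.
  exists (s, N, e), (interior [set g | (lorenz_dist f g < d%:E)%E]); split.
  + by apply: nbhs_interior; apply/nbhs_ballP; exists d.
  + by move=> g /interior_subset/HT[_ null].
  + move=> k0 g gW B Bg.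
    have OB : nbhs g ([set g | (lorenz_dist f g < d%:E)%E] `&` B).
      by apply: filterI => //; exact: gW.
    have eps0 : 0 < (2 * e)%:R^-1 :> R by rewrite invr_gt0 ltr0n muln_gt0.
    have [g' [_ Bg'] Ug'] := visits_often_dense hrho halpha hbeta k0 lam1 K0 v12
      y12 rv vc cv vr OB (fun g' Og' => (HT g' Og'.1).1) eps0.
    by exists g'.
exists V; split => // f /VGU[i [[e0 null] Uf]] mu srb sub.
apply: (not_basin (x0 := left_value c f) e0 null _ srb); last by apply: sub; left.
move=> k; have [_ [m [km m0 _ H]]] := Uf k.
by exists m; split => //; rewrite (lorenz_left_value hrho halpha).
Qed.
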